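(* Let $d\ge1$, let $N\ge 2$ and $\widetilde N\ge N$ be integers, and let $T>0$. Assume that the initial condition $X_0=(X_0^1,\dots,X_0^N)$, with values in $(\mathbb R^d)^N$, is $\mathcal F_0$-measurable and satisfies $$\mathbb E\bigl[|X_0|^2\bigr]<\infty,\qquad \mathbb E\bigl[V(X_0^i-X_0^j)\bigr]<\infty\quad\text{for all }1\le i<j\le N .$$ Let $c_0:\mathbb R^d\to[0,\infty)$ be measurable, bounded, with $c_0\in L^2(\mathbb R^d)$ and $0\le c_0(x)\le m_0(x)$ for all $x\in\mathbb R^d$. Then the system, for $t\in[0,T]$, $$dX_t^i=-\frac1{\widetilde N}\sum_{\substack{j=1\\ j\ne i}}^N\nabla V(X_t^i-X_t^j)\,dt+\widetilde G[c(t,\cdot)](X_t^i)\,dt+\sigma\,dW_t^i,\qquad i=1,\dots,N,$$ $$\partial_t c(t,x)=-\lambda\,c(t,x)\,u_N(t,x),\qquad x\in\mathbb R^d,$$ with initial data $X_0$ and $c(0,\cdot)=c_0$, admits a pathwise unique strong solution $(X,c)$ on $[0,T]$. Moreover, with probability one no collisions between particles occur on $[0,T]$, i.e. $$\mathbb P\bigl(\exists\,t\in[0,T],\ \exists\, i\ne j\ \text{such that}\ X_t^i=X_t^j\bigr)=0 ;$$ in particular, the singularity is almost surely never reached in finite time. Finally, almost surely, the environmental field $c$ remains nonnegative, is uniformly bounded on $[0,T]\times\mathbb R^d$, and belongs to $C([0,T];L^2(\mathbb R^d))$.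
   Context: Setting. $(\Omega,\mathcal F,\mathbb F=(\mathcal F_t)_{t\in[0,T]},\mathbb P)$ is a filtered probability space satisfying the usual conditions, and $W^1,\dots,W^N$ are independent $d$-dimensional $\mathbb F$-Wiener processes. $\sigma\in\mathbb R$, $\lambda>0$ and $R>0$ are fixed constants. Potential. $V$ is the Lennard--Jones type potential $$V(x)=\frac{A}{|x|^\alpha}-\frac{B}{|x|^\beta},\qquad x\in\mathbb R^d\setminus\{0\},\quad A,B>0,\ \alpha>\beta>0,$$ with $V(0):=+\infty$ (so the condition $\mathbb E[V(X_0^i-X_0^j)]<\infty$ entails $X_0^i\ne X_0^j$ a.s.). No further restriction is placed on the parameters. Reference profile. $m_0:\mathbb R^d\to(0,\infty)$ is a fixed measurable function with $\overline M\le m_0(x)\le\overline m$ for all $x$, for some constants $0<\overline M\le\overline m<\infty$. Environmental drift. For a function $v:\mathbb R^d\to[0,\infty)$, $$\widetilde G[v](x)=\int_{B_R(x)}\frac{z-x}{|z-x|}\left(1-\frac{v(z)}{m_0(z)}\right)e^{-|z-x|}\,dz,\qquad x\in\mathbb R^d,$$ where $B_R(x)$ is the ball of radius $R$ centred at $x$. Regularized density. $K\in C_b^\infty(\mathbb R^d)$ is a fixed smooth kernel (smooth and bounded with all its derivatives), and $u_N=K*\widetilde\nu^N_t$ where $\widetilde\nu_t^N=\frac1{\widetilde N}\sum_{i=1}^N\varepsilon_{X_t^i}$ ($\varepsilon_x$ is the Dirac mass at $x$), that is, $u_N(t,x)=\frac1{\widetilde N}\sum_{i}K(x-X_t^i)$,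 with the convention that self-interaction is excluded (at a point $x=X_t^i$ the $i$-th term is omitted). Notion of solution. A strong solution on $[0,T]$ is a pair $(X,c)$ on the given probability space, with $X=(X^1,\dots,X^N)$ an $\mathbb F$-adapted continuous $(\mathbb R^d)^N$-valued process and $c$ a nonnegative, adapted, measurable random field on $[0,T]\times\mathbb R^d$, such that almost surely all drift terms are absolutely integrable on $[0,T]$ and both equations hold in time-integrated form: the particle equations for all $t\in[0,T]$, and $c(t,x)=c_0(x)-\lambda\int_0^t c(s,x)u_N(s,x)\,ds$ for all $(t,x)\in[0,T]\times\mathbb R^d$. Pathwise uniqueness means that two strong solutions on the same filtered probability space, with the same Wiener processes and the same initial data, coincide almost surely for all times. *)

(* Defs.v *)
From HB Require Import structures.
From mathcomp Require Import all_boot all_order all_algebra.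
From mathcomp Require Import all_classical all_reals all_analysis.

Set Implicit Arguments.
Unset Strict Implicit.
Unset Printing Implicit Defensive.

Import Order.TTheory GRing.Theory Num.Theory.
Import numFieldNormedType.Exports.

Local Open Scope classical_set_scope.
Local Open Scope ring_scope.

Definition rV_coord (R : realType) (n : nat) (k : 'I_n) (x : 'rV[R]_n) : R :=
  x ord0 k.

Definition rV_display : measure_display. Proof. exact. Qed.

Section rV_measurable.
Context (R : realType) (n : nat).

Let G : set (set 'rV[R]_n) := g_sigma_preimage (@rV_coord R n).

Let G0 : G set0. Proof. exact: sigma_algebra0. Qed.
Let GC A : G A -> G (~` A). Proof. exact: sigma_algebraC. Qed.
Let GU (F : _^nat) : (forall i, G (F i)) -> G (\bigcup_i (F i)).
Proof. exact: sigma_algebra_bigcup. Qed.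

(* B(R^n), generated by the coordinates: the library puts no measurable
   structure on row vectors. *)
HB.instance Definition _ :=
  @isMeasurable.Build rV_display 'rV[R]_n G G0 GC GU.

End rV_measurable.

Lemma measurable_rV_coord (R : realType) n (k : 'I_n) :
  measurable_fun [set: 'rV[R]_n] (rV_coord k).
Proof.
move=> _ B mB; rewrite setTI; apply: sub_sigma_algebra => /=.
rewrite -bigcup_seq/=; exists k => /=; first by rewrite mem_index_enum.
by exists B => //; rewrite setTI.
Qed.

Lemma measurable_fun_rVP (R : realType) d (T : measurableType d) n
    (f : T -> 'rV[R]_n) :
  (forall k, measurable_fun setT (rV_coord k \o f)) -> measurable_fun setT f.
Proof.
move=> mf _ A mA.
suff: g_sigma_preimage (fun k => rV_coord k \o f) `<=` measurable.
  by apply; rewrite g_sigma_preimage_comp; exists A.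
apply: smallest_sub; first exact: sigma_algebra_measurable.
case: n => [|n] in f mf A mA *; first by rewrite big_ord0.
rewrite -bigcup_mkord_ord; apply: bigcup_sub => i Ii.
by move=> B [C mC <-]; exact: mf.
Qed.

Definition rV_cons (R : realType) n (p : R * 'rV[R]_n) : 'rV[R]_n.+1 :=
  row_mx p.1%:M p.2.

Lemma rV_cons0 (R : realType) n (p : R * 'rV[R]_n) :
  rV_cons p ord0 ord0 = p.1.
Proof.
rewrite /rV_cons (_ : ord0 = lshift n (ord0 : 'I_1)); last exact/val_inj.
by rewrite (row_mxEl p.1%:M) mxE eqxx mulr1n.
Qed.

Lemma rV_consS (R : realType) n (p : R * 'rV[R]_n) (k : 'I_n) :
  rV_cons p ord0 (lift ord0 k) = p.2 ord0 k.
Proof.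
rewrite /rV_cons (_ : lift ord0 k = rshift 1 k); last exact/val_inj.
by rewrite (row_mxEr p.1%:M).
Qed.

Lemma measurable_rV_cons (R : realType) n :
  measurable_fun setT (@rV_cons R n).
Proof.
apply: measurable_fun_rVP => k; have [j|] := unliftP ord0 k => ->.
- rewrite (_ : _ \o _ = rV_coord j \o snd).
    by apply: measurableT_comp => //; exact: measurable_rV_coord.
  by apply/funext => p /=; rewrite /rV_coord rV_consS.
- rewrite (_ : _ \o _ = fst) //.
  by apply/funext => p /=; rewrite /rV_coord rV_cons0.
Qed.

(* Lebesgue measure on R^n. *)
Fixpoint lebesgue_rV (R : realType) (n : nat) : set 'rV[R]_n -> \bar R :=
  match n with
  | 0 => \d_(0%R : 'rV[R]_0)
  | n'.+1 => pushforward (lebesgue_measure \x @lebesgue_rV R n')%E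
                         (@rV_cons R n')
  end.

Section rV_cons_measure.
Local Open Scope ereal_scope.
Context (R : realType) (n : nat).
Variable mu : {sigma_finite_measure set 'rV[R]_n -> \bar R}.

Let m : {measure set _ -> \bar R} := lebesgue_measure \x mu.

Definition rV_cons_measure : set 'rV[R]_n.+1 -> \bar R :=
  pushforward m (@rV_cons R n).

Let m_rV_cons A : measurable A -> measurable (@rV_cons R n @^-1` A).
Proof. by rewrite -[X in _ -> measurable X]setTI; exact: measurable_rV_cons. Qed.

Let rV_cons_measure0 : rV_cons_measure set0 = 0.
Proof. by rewrite /rV_cons_measure /pushforward preimage_set0 measure0. Qed.

Let rV_cons_measure_ge0 A : 0 <= rV_cons_measure A.
Proof. exact: (measure_ge0 m). Qed.

Let rV_cons_measure_sigma_additive : semi_sigma_additive rV_cons_measure.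
Proof.
move=> F mF tF mUF; rewrite /rV_cons_measure /pushforward preimage_bigcup.
apply: (@measure_semi_sigma_additive _ _ _ m).
- by move=> k; exact: m_rV_cons.
- apply/trivIsetP => /= i j _ _ ij; rewrite -preimage_setI.
  by move/trivIsetP : tF => /(_ _ _ _ _ ij) ->//; rewrite preimage_set0.
- by rewrite -preimage_bigcup; exact: m_rV_cons.
Qed.

HB.instance Definition _ := isMeasure.Build _ _ _ rV_cons_measure
  rV_cons_measure0 rV_cons_measure_ge0 rV_cons_measure_sigma_additive.

Let rV_uncons (v : 'rV[R]_n.+1) : R * 'rV[R]_n :=
  (v ord0 ord0, \row_k v ord0 (lift ord0 k)).

Let rV_consK : cancel (@rV_cons R n) rV_uncons.
Proof.
move=> [r v]; congr pair; first by rewrite rV_cons0.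
by apply/rowP => k; rewrite mxE rV_consS.
Qed.

Let measurable_rV_uncons : measurable_fun setT rV_uncons.
Proof.
apply/measurable_fun_pairP; split; first exact: (measurable_rV_coord ord0).
apply: measurable_fun_rVP => k.
rewrite (_ : _ \o _ = rV_coord (lift ord0 k)); first exact: measurable_rV_coord.
by apply/funext => v; rewrite /rV_coord /= mxE.
Qed.

Let rV_cons_measure_sigma_finite : sigma_finite setT rV_cons_measure.
Proof.
have [F FT Foo] : sigma_finite setT m.
  have /sigma_finiteP[F [TF ndF Foo]] :=
    sigma_finiteT (@lebesgue_measure R : {sigma_finite_measure set _ -> \bar R}).
  have /sigma_finiteP[G [TG ndG Goo]] := sigma_finiteT mu.
  exists (fun i => F i `*` G i).
    rewrite -setXTT TF TG predeqE => -[x y]; split.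
      move=> [/= [i _ Fix] [j _ Gjy]]; exists (maxn i j) => //; split.
      - by move: x Fix; exact/subsetPset/ndF/leq_maxl.
      - by move: y Gjy; exact/subsetPset/ndG/leq_maxr.
    by move=> [i _ []/= ? ?]; split; exists i.
  move=> i; have [? ?] := Foo i; have [? ?] := Goo i.
  split; first exact: measurableX.
  by rewrite /m /= product_measure1E// lte_mul_pinfty// ge0_fin_numE.
exists (fun i => rV_uncons @^-1` F i).
  by rewrite -preimage_bigcup -FT preimage_setT.
move=> i; have [mF Fi] := Foo i; split.
  by rewrite -[X in measurable X]setTI; exact: measurable_rV_uncons.
rewrite /rV_cons_measure /pushforward -comp_preimage.
by rewrite (_ : _ \o _ = id) //; apply/funext => p /=; exact: rV_consK.
Qed.

HB.instance Definition _ := Measure_isSigmaFinite.Build _ _ _ rV_cons_measure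
  rV_cons_measure_sigma_finite.

End rV_cons_measure.

Section lebesgue_rV_measure.
Local Open Scope ereal_scope.
Context (R : realType) (n : nat).
Local Notation leb := (@lebesgue_rV R n).

Lemma lebesgue_rV_is_measure :
  exists mu : {sigma_finite_measure set 'rV[R]_n -> \bar R}, leb = mu.
Proof.
elim: n => [|k [mu muE]]; first by exists (\d_(0%R : 'rV[R]_0)).
by exists (rV_cons_measure mu); rewrite /= muE.
Qed.

Let leb0 : leb set0 = 0.
Proof. by have [mu ->] := lebesgue_rV_is_measure; exact: measure0. Qed.

Let leb_ge0 A : 0 <= leb A.
Proof. by have [mu ->] := lebesgue_rV_is_measure; exact: measure_ge0. Qed.

Let leb_sigma_additive : semi_sigma_additive leb.
Proof.
have [mu ->] := lebesgue_rV_is_measure; exact: measure_semi_sigma_additive.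
Qed.

HB.instance Definition _ := isMeasure.Build _ _ _ leb
  leb0 leb_ge0 leb_sigma_additive.

Let leb_sigma_finite : sigma_finite setT leb.
Proof. by have [mu ->] := lebesgue_rV_is_measure; exact: sigma_finiteT. Qed.

HB.instance Definition _ := Measure_isSigmaFinite.Build _ _ _ leb
  leb_sigma_finite.

End lebesgue_rV_measure.

Lemma lebesgue_rV_box (R : realType) n (E : 'I_n -> set R) :
  (forall k, measurable (E k)) ->
  (lebesgue_rV [set x : 'rV[R]_n | forall k, E k (x ord0 k)] =
   \prod_(k < n) lebesgue_measure (E k))%E.
Proof.
elim: n => [|n IH] in E * => mE.
  rewrite big_ord0 /= /dirac (_ : [set _ | _] = setT) ?indicT//.
  by apply/seteqP; split => // x _ [].
rewrite big_ord_recl /= /pushforward.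
pose B := [set x : 'rV[R]_n | forall k, E (lift ord0 k) (x ord0 k)].
rewrite (_ : _ @^-1` _ = E ord0 `*` B); last first.
  apply/seteqP; split => [p /= Ep|p [/= E0 ES] k].
    split => /=; first by rewrite -(rV_cons0 p).
    by move=> k; rewrite /= -(rV_consS p).
  by have [j|] := unliftP ord0 k => ->; rewrite ?rV_consS ?rV_cons0.
have mB : measurable B.
  rewrite (_ : B = \bigcap_(k in [set: 'I_n])
      (rV_coord k @^-1` E (lift ord0 k))).
    apply: fin_bigcap_measurable => // k _.
    by rewrite -[X in measurable X]setTI; exact: measurable_rV_coord.
  by apply/seteqP; split => [x Bx k _|x Bx k]; exact: Bx.
rewrite -IH //.
exact: (product_measure1E lebesgue_measure (@lebesgue_rV R n) (mE ord0) mB).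
Qed.

Section analysis_on_rV.
Context (R : realType) (d : nat).
Implicit Types (x y z : 'rV[R]_d) (f : 'rV[R]_d -> R).

(* Euclidean norm; the norm `|x| of the library on row vectors is the sup
   norm. *)
Definition enorm x : R := Num.sqrt (\sum_(k < d) x ord0 k ^+ 2).

Definition eball x (r : R) : set 'rV[R]_d := [set z | enorm (z - x) < r].

Definition partial (k : 'I_d) f x : R := 'D_(delta_mx ord0 k) f x.

Definition gradient f x : 'rV[R]_d := \row_k partial k f x.

(* The space C_b^oo(R^d), by partial derivatives of all orders; the sequence s
   lists the successive directions of differentiation. *)
Definition Cb_smooth f : Prop :=
  forall s : seq 'I_d,
    [/\ forall x k, derivable (foldr partial f s) x (delta_mx ord0 k),
        continuous (foldr partial f s) &
        exists M : R, forall x, `|foldr partial f s x| <= M].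

(* The space C([0,T]; L^2(R^d)). *)
Definition continuous_L2 (T : R) (c : R -> 'rV[R]_d -> R) : Prop :=
  (forall t : R, t \in `[0, T] -> c t \in Lfun (@lebesgue_rV R d) 2%:E) /\
  (forall t0 : R, t0 \in `[0, T] ->
    ('N[@lebesgue_rV R d]_2%:E[EFin \o (c t \- c t0)%R])%E
      @[t --> within `[0, T]%classic (nbhs t0)] --> 0%E).

End analysis_on_rV.

Section stochastic_basis.
Context (R : realType) (disp : measure_display) (Omega : measurableType disp).
Context (P : probability Omega R) (T : R).
Implicit Type F : R -> set (set Omega).

(* Measurability with respect to a sub-sigma-algebra G. *)
Definition sub_measurable (G : set (set Omega)) d (E : measurableType d)
    (f : Omega -> E) : Prop :=
  forall B, measurable B -> G (f @^-1` B).

Record usual_filtration F : Prop := UsualFiltration {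
  filtration_sigma_algebra :
    forall t : R, t \in `[0, T] -> sigma_algebra setT (F t) ;
  filtration_sub_measurable :
    forall t : R, t \in `[0, T] -> F t `<=` measurable ;
  filtration_nondecreasing :
    forall s t : R, 0 <= s -> s <= t -> t <= T -> F s `<=` F t ;
  filtration_right_continuous :
    forall t : R, 0 <= t -> t < T -> \bigcap_(s in `]t, T]%classic) F s = F t ;
  filtration_complete : P.-negligible `<=` F 0 }.

(* d-dimensional F-Wiener process on [0,T]; the law of an increment is
   N(0, (t - s) Id), i.e. its coordinates are i.i.d. N(0, t - s), and the second
   argument of normal_prob is the standard deviation. *)
Record wiener_process F (d : nat) (W : R -> Omega -> 'rV[R]_d) : Prop :=
  WienerProcess {
  wiener_adapted :
    forall t : R, t \in `[0, T] -> sub_measurable (F t) (W t) ;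
  wiener_start : {ae P, forall w, W 0 w = 0} ;
  wiener_continuous :
    {ae P, forall w, {within `[0, T], continuous (fun t : R => W t w)}} ;
  wiener_increment_independent :
    forall s t : R, 0 <= s -> s < t -> t <= T ->
    forall A, F s A -> forall B : set 'rV[R]_d, measurable B ->
      (P (A `&` [set w | B (W t w - W s w)%R]) =
       P A * P [set w | B (W t w - W s w)%R])%E ;
  wiener_increment_law :
    forall s t : R, 0 <= s -> s < t -> t <= T ->
    forall B : 'I_d -> set R, (forall k, measurable (B k)) ->
      (P [set w | forall k, B k ((W t w - W s w)%R ord0 k)] =
       \prod_(k < d) normal_prob 0%R (Num.sqrt (t - s)%R) (B k))%E }.

Definition process_sigma_algebra d (E : measurableType d)
    (X : R -> Omega -> E) : set (set Omega) :=
  <<s [set A | exists (t : R) (B : set E),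
         [/\ t \in `[0, T], measurable B & A = X t @^-1` B]] >>.

Definition independent_processes (I : finType) d (E : measurableType d)
    (X : I -> R -> Omega -> E) : Prop :=
  forall (J : {set I}) (A : I -> set Omega),
    (forall i, i \in J -> process_sigma_algebra (X i) (A i)) ->
    (P (\bigcap_(i in [set i | i \in J]) A i) = \prod_(i in J) P (A i))%E.

End stochastic_basis.

Section particle_system.
Context (R : realType) (d N : nat).
(* A, B, alpha, beta: potential; Rad, m0: environmental drift; K, Nt: regularized
   density, Nt being the normalization written N tilde. *)
Context (A B alpha beta : R) (Rad : R) (m0 : 'rV[R]_d -> R).
Context (K : 'rV[R]_d -> R) (Nt : nat) (sigma lambda : R).

(* The value at x = 0 is meaningless. *)
Definition LJ (x : 'rV[R]_d) : R :=
  A / enorm x `^ alpha - B / enorm x `^ beta.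

Definition LJ_ext (x : 'rV[R]_d) : \bar R :=
  if x == 0 then +oo%E else (LJ x)%:E.

Definition env_drift (v : 'rV[R]_d -> R) (x : 'rV[R]_d) : 'rV[R]_d :=
  \row_k \int[@lebesgue_rV R d]_(z in eball x Rad)
    ((z - x) ord0 k / enorm (z - x) * (1 - v z / m0 z)
      * expR (- enorm (z - x))).

(* Without self-interaction: the particles sitting at y are left out. *)
Definition reg_density (x : 'I_N -> 'rV[R]_d) (y : 'rV[R]_d) : R :=
  Nt%:R^-1 * \sum_(i < N | y != x i) K (y - x i).

Definition drift (x : 'I_N -> 'rV[R]_d) (v : 'rV[R]_d -> R) (i : 'I_N) :
    'rV[R]_d :=
  - (Nt%:R^-1 *: \sum_(j < N | j != i) gradient LJ (x i - x j))
  + env_drift v (x i).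

(* The equations along one trajectory W of the noise. V has no gradient at 0, so
   integrability of the drift presupposes that it is defined for almost every
   time; gradient LJ being total here, this is stated separately. *)
Record path_solution (T : R) (W : 'I_N -> R -> 'rV[R]_d)
    (X0 : 'I_N -> 'rV[R]_d) (c0 : 'rV[R]_d -> R)
    (X : 'I_N -> R -> 'rV[R]_d) (c : R -> 'rV[R]_d -> R) : Prop :=
  PathSolution {
  path_drift_defined :
    {ae lebesgue_measure, forall s : R, s \in `[0, T] ->
       forall i j, i != j -> X i s != X j s} ;
  path_interaction_integrable :
    forall i j k, i != j -> lebesgue_measure.-integrable `[0, T]
      (fun s : R => (gradient LJ (X i s - X j s) ord0 k)%:E) ;
  path_env_drift_integrable :
    forall i k, lebesgue_measure.-integrable `[0, T]
      (fun s : R => (env_drift (c s) (X i s) ord0 k)%:E) ;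
  path_consumption_integrable :
    forall x, lebesgue_measure.-integrable `[0, T]
      (fun s : R => (c s x * reg_density (X^~ s) x)%:E) ;
  path_particles :
    forall i (t : R), t \in `[0, T] ->
      X i t = X0 i
        + \row_k \int[lebesgue_measure]_(s in `[0, t])
            drift (X^~ s) (c s) i ord0 k
        + sigma *: W i t ;
  path_field :
    forall (t : R) x, t \in `[0, T] ->
      c t x = c0 x - lambda *
        \int[lebesgue_measure]_(s in `[0, t])
          (c s x * reg_density (X^~ s) x) }.

Context (disp : measure_display) (Omega : measurableType disp).
Context (P : probability Omega R) (T : R) (F : R -> set (set Omega)).
Context (W : 'I_N -> R -> Omega -> 'rV[R]_d).
Context (X0 : 'I_N -> Omega -> 'rV[R]_d) (c0 : 'rV[R]_d -> R).

Record strong_solution (X : 'I_N -> R -> Omega -> 'rV[R]_d)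
    (c : R -> 'rV[R]_d -> Omega -> R) : Prop := StrongSolution {
  strong_particles_adapted :
    forall i (t : R), t \in `[0, T] -> sub_measurable (F t) (X i t) ;
  strong_particles_continuous :
    forall i w, {within `[0, T], continuous (fun t : R => X i t w)} ;
  strong_field_ge0 :
    forall (t : R) x w, t \in `[0, T] -> 0 <= c t x w ;
  strong_field_adapted :
    forall (t : R) x, t \in `[0, T] -> sub_measurable (F t) (c t x) ;
  strong_field_measurable :
    measurable_fun (`[0, T]%classic `*` [set: ('rV[R]_d * Omega)%type])
      (fun p : R * ('rV[R]_d * Omega)%type => c p.1 p.2.1 p.2.2) ;
  strong_equations :
    {ae P, forall w, path_solution T (fun i t => W i t w) (X0^~ w) c0
                       (fun i t => X i t w) (fun t x => c t x w)} }.

Definition pathwise_unique : Prop :=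
  forall X c X' c', strong_solution X c -> strong_solution X' c' ->
    {ae P, forall w, forall t : R, t \in `[0, T] ->
       (forall i, X i t w = X' i t w) /\ (forall x, c t x w = c' t x w)}.

End particle_system.

(* Main.v *)
(* The noise being additive, the system is solved path by path. Absence of collisions: writing
   the equation as X' = - grad E / Ntilde + bounded drift + noise, suppose that the pair energy E
   passes from r^(-alpha) to twice that value. Then some pair is at distance of order r, and a
   virial argument on a well-separated cluster bounds the total force from below by a multiple
   of r^(-alpha-1). On a time window of length kap r^(alpha+2) the drift thus dissipates more
   energy than the noise can restore, provided that the noise moves by a small multiple of r on
   all such windows; as alpha + 2 > 2, Brownian paths have this property for arbitrarily small r
   because they are Hoelder continuous with an exponent larger than 1/(alpha+2).

   Existence and uniqueness: the field c is an explicit exponential functional of the particle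
   paths, and the self-interaction changes it only on a null set. The environmental drift is
   bounded and Lipschitz, since the kernel has bounded variation on lines. With the singular
   force truncated at distance e, Picard iteration therefore gives a unique adapted solution,
   and by the above a fixed path never feels the truncation once e is small enough. *)
Require Import Defs.
From mathcomp Require Import all_boot all_order all_algebra.
From mathcomp Require Import all_classical all_reals all_analysis.
From mathcomp Require Import measurable_realfun ring lra.

Import Order.TTheory GRing.Theory Num.Theory.
Import numFieldNormedType.Exports.

Set Implicit Arguments.
Unset Strict Implicit.
Unset Printing Implicit Defensive.

Local Open Scope classical_set_scope.
Local Open Scope ring_scope.

(** The window length comes from scaling. At distance [r] forces are of order [P = r^(-alpha-1)] and
    energies of order [M = P r], so that during a time [kap r / P = kap r^(alpha+2)] the drift moves
    the particles by a multiple of [kap r] and dissipates a multiple of [kap M]. Second order Taylor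
    terms cost only a multiple of [kap^2 M], and a noise of amplitude [kap1 r] costs a multiple of
    [kap1 M]: hence [kap] is chosen small first, and then [kap1] small compared with [kap]. The
    drift along a path is merely measurable in time and the noise is not differentiable, so no chain
    rule is available. The energy is compared only between the two ends of a window, and the field
    equation is treated through increments of second order. For uniqueness the competitor is not
    known to avoid collisions. The a priori bound is therefore stated for any continuous path whose
    drift is controlled only while all gaps are above a threshold, and the energy is truncated below
    it, which keeps it continuous. The threshold depends on the noise path alone, so it serves the
    truncated solutions and an arbitrary solution alike. *)

Section euclidean.
Context (R : realType) (d : nat).
Implicit Types (x y z : 'rV[R]_d) (a : R).

Definition dot x y : R := \sum_(k < d) x ord0 k * y ord0 k.

Lemma dotC x y : dot x y = dot y x.
Proof. by apply: eq_bigr => k _; rewrite mulrC. Qed.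

Lemma dotDl x y z : dot (x + y) z = dot x z + dot y z.
Proof. by rewrite /dot -big_split; apply: eq_bigr => k _; rewrite mxE mulrDl. Qed.

Lemma dotDr x y z : dot z (x + y) = dot z x + dot z y.
Proof. by rewrite dotC dotDl !(dotC z). Qed.

Lemma dotZl a x y : dot (a *: x) y = a * dot x y.
Proof. by rewrite /dot mulr_sumr; apply: eq_bigr => k _; rewrite mxE mulrA. Qed.

Lemma dotZr a x y : dot x (a *: y) = a * dot x y.
Proof. by rewrite dotC dotZl dotC. Qed.

Lemma dotNl x y : dot (- x) y = - dot x y.
Proof. by rewrite -scaleN1r dotZl mulN1r. Qed.

Lemma dotNr x y : dot x (- y) = - dot x y.
Proof. by rewrite dotC dotNl dotC. Qed.

Lemma dotBr x y z : dot z (x - y) = dot z x - dot z y.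
Proof. by rewrite dotDr dotNr. Qed.

Lemma dotBl x y z : dot (x - y) z = dot x z - dot y z.
Proof. by rewrite dotDl dotNl. Qed.

Lemma dot_suml (I : finType) (P : pred I) (f : I -> 'rV[R]_d) y :
  dot (\sum_(i | P i) f i) y = \sum_(i | P i) dot (f i) y.
Proof.
rewrite /dot exchange_big /=; apply: eq_bigr => k _.
by rewrite summxE mulr_suml.
Qed.

Lemma dotxx_ge0 x : 0 <= dot x x.
Proof. by apply: sumr_ge0 => k _; rewrite -expr2 sqr_ge0. Qed.

Lemma enormE x : enorm x = Num.sqrt (dot x x).
Proof. by rewrite /enorm; congr Num.sqrt; apply: eq_bigr => k _; rewrite expr2. Qed.

Lemma enorm_ge0 x : 0 <= enorm x.
Proof. by rewrite enormE sqrtr_ge0. Qed.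

Lemma sqr_enorm x : enorm x ^+ 2 = dot x x.
Proof. by rewrite enormE sqr_sqrtr // dotxx_ge0. Qed.

Lemma enormZ a x : enorm (a *: x) = `|a| * enorm x.
Proof.
rewrite !enormE dotZl dotZr mulrA -expr2 sqrtrM ?sqr_ge0//.
by rewrite sqrtr_sqr.
Qed.

Lemma enormN x : enorm (- x) = enorm x.
Proof. by rewrite -scaleN1r enormZ normrN1 mul1r. Qed.

Lemma enormB x y : enorm (x - y) = enorm (y - x).
Proof. by rewrite -enormN opprB. Qed.

Lemma enorm0 : enorm (0 : 'rV[R]_d) = 0.
Proof. by rewrite -(scale0r 0) enormZ normr0 mul0r. Qed.

Lemma coord_le_enorm x k : `|x ord0 k| <= enorm x.
Proof.
rewrite -[leLHS]sqrtr_sqr ler_wsqrtr // (bigD1 k) //= lerDl.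
by apply: sumr_ge0 => j _; rewrite sqr_ge0.
Qed.

Lemma enorm_eq0 x : (enorm x == 0) = (x == 0).
Proof.
apply/eqP/eqP => [x0|->]; last exact: enorm0.
apply/rowP => k; apply/eqP; rewrite mxE -normr_le0.
by rewrite (le_trans (coord_le_enorm x k)) // x0.
Qed.

Lemma enorm_gt0 x : (0 < enorm x) = (x != 0).
Proof. by rewrite lt_def enorm_ge0 andbT enorm_eq0. Qed.

Lemma dot_le x y : dot x y <= enorm x * enorm y.
Proof.
have [->|x0] := eqVneq x 0.
  rewrite enorm0 mul0r /dot big1 // => k _; by rewrite mxE mul0r.
have [->|y0] := eqVneq y 0.
  rewrite enorm0 mulr0 /dot big1 // => k _; by rewrite mxE mulr0.
have := dotxx_ge0 (enorm y *: x - enorm x *: y).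
rewrite !(dotBl, dotBr, dotZl, dotZr) -!sqr_enorm (dotC y x).
have : 0 < enorm x * enorm y by rewrite mulr_gt0 // enorm_gt0.
move: (enorm x) (enorm y) (dot x y) => a b c ab h.
have {h} : 0 <= 2 * (a * b) * (a * b - c) by lra.
by rewrite pmulr_rge0 ?subr_ge0 // mulr_gt0.
Qed.

Lemma normr_dot x y : `|dot x y| <= enorm x * enorm y.
Proof.
rewrite ler_norml dot_le andbT lerNl -dotNl (le_trans (dot_le _ _))//.
by rewrite enormN.
Qed.

Lemma enormD x y : enorm (x + y) <= enorm x + enorm y.
Proof.
rewrite -(@ler_pXn2r _ 2) ?nnegrE ?addr_ge0 ?enorm_ge0 //.
rewrite sqrrD !sqr_enorm !(dotDl, dotDr) (dotC y x).
by have := dot_le x y; lra.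
Qed.

Lemma enorm_subD x y z : enorm (x - z) <= enorm (x - y) + enorm (y - z).
Proof. by rewrite -{1}(subrK y x) -addrA enormD. Qed.

Lemma ler_enormB x y : `|enorm x - enorm y| <= enorm (x - y).
Proof.
rewrite ler_norml; have := enormD (x - y) y; have := enormD (y - x) x.
by rewrite !subrK (enormB y x); lra.
Qed.

Lemma enorm_sum (I : finType) (P : pred I) (f : forall i : I, 'rV[R]_d) :
  enorm (\sum_(i | P i) f i) <= \sum_(i | P i) enorm (f i).
Proof.
elim/big_rec2 : _ => [|i y v _ h]; first by rewrite enorm0.
by rewrite (le_trans (enormD _ _)) // lerD2l.
Qed.

Lemma enorm_le_sum x : enorm x <= \sum_(k < d) `|x ord0 k|.
Proof.
rewrite {1}(row_sum_delta x) (le_trans (enorm_sum _ _)) // ler_sum // => k _.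
rewrite enormZ ler_piMr // enormE /dot (bigD1 k) //= big1 ?addr0.
  by rewrite !mxE !eqxx mulr1 sqrtr1.
by move=> j jk; rewrite !mxE (negbTE jk) andbF mulr0.
Qed.

Lemma enorm_le_coord x e : (forall k, `|x ord0 k| <= e) -> enorm x <= d%:R * e.
Proof.
move=> xe; rewrite (le_trans (enorm_le_sum x)) //.
by rewrite (le_trans (ler_sum _ (fun k _ => xe k))) // sumr_const card_ord mulr_natl.
Qed.

End euclidean.

Section quadratic_remainder.
Context (R : realType) (V : normedModType R).

(** A quadratic remainder identifies a directional derivative. Thus the Taylor bound [force_taylor],
    needed for the energy, also yields the gradient of the potential. *)
Lemma is_derive_quadratic (f : V -> R) (x v : V) (l C : R) (eta : R) :
  0 < eta ->
  (forall h : R, `|h| < eta -> `|f (x + h *: v) - f x - h * l| <= C * h ^+ 2) ->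
  is_derive x v f l.
Proof.
move=> eta0 H.
suff lim : h^-1 *: ((f \o shift x) (h *: v) - f x) @[h --> 0^'] --> l.
  apply: DeriveDef; first by apply/cvg_ex; exists l.
  exact: cvg_lim lim.
have C0 : 0 <= C.
  have e2 : `|eta / 2| < eta by rewrite gtr0_norm ?divr_gt0//; lra.
  have := le_trans (normr_ge0 _) (H _ e2).
  by rewrite pmulr_lge0 // exprn_gt0 // divr_gt0.
apply/cvgrPdist_le => e e0; near=> h.
have h0 : h != 0 by near: h; exact: nbhs_dnbhs_neq.
have hlt : `|h| < eta.
  by near: h; apply: dnbhs0_lt.
have hC : `|h| < e / (C + 1).
  by near: h; apply: dnbhs0_lt; rewrite divr_gt0// ltr_wpDl.
rewrite /= (addrC (h *: v)).
rewrite distrC (_ : _ - _ = h^-1 * (f (x + h *: v) - f x - h * l)); last first.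
  by rewrite [in RHS]mulrBr mulKf.
rewrite normrM normfV ler_pdivrMl ?normr_gt0//.
rewrite (le_trans (H _ hlt)) // -[h ^+ 2]real_normK ?num_real//.
rewrite expr2 mulrA [_ * e]mulrC ler_wpM2r//.
move: hC; rewrite ltr_pdivlMr ?ltr_wpDl//; have := normr_ge0 h; nra.
Unshelve. all: by end_near. Qed.

End quadratic_remainder.

(** * The Lennard-Jones force *)

Section lennard_jones.
Context (R : realType) (A B alpha beta : R).
Hypotheses (A0 : 0 < A) (B0 : 0 < B) (beta0 : 0 < beta) (ab : beta < alpha).

Let alpha0 : 0 < alpha. Proof. exact: lt_trans beta0 ab. Qed.

Lemma powRN_le (p r s : R) : 0 <= p -> 0 < r -> r <= s -> s `^ (- p) <= r `^ (- p).
Proof.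
move=> p0 r0 rs; rewrite !powRN lef_pV2 ?posrE ?powR_gt0//; last exact: lt_le_trans rs.
by apply: ge0_ler_powR => //; rewrite nnegrE ltW // (lt_le_trans r0).
Qed.

Lemma powR_lip (p r s : R) : 0 <= p -> 0 < r -> r <= s ->
  0 <= r `^ (- p) - s `^ (- p) <= p * r `^ (- p - 1) * (s - r).
Proof.
move=> p0 r0 rs; rewrite subr_ge0 powRN_le //=.
have [||c] := @MVT_segment R (fun x => x `^ (- p)) (fun x => - p * x `^ (- p - 1)) r s rs.
- move=> x; rewrite in_itv /= => /andP[rx _]; apply: is_derive1_powR.
  exact: lt_trans rx.
- apply: derivable_within_continuous => x; rewrite in_itv /= => /andP[rx _].
  have x0 : 0 < x by exact: lt_le_trans rx.
  by have [] := is_derive1_powR (- p) x0.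
rewrite in_itv /= => /andP[rc cs] E.
rewrite -opprB E mulNr mulNr opprK ler_wpM2r ?subr_ge0// ler_wpM2l//.
by rewrite -opprD powRN_le // addr_ge0.
Qed.

Lemma powRN_expo_le (p q r : R) : 0 < r -> r <= 1 -> p <= q -> r `^ (- p) <= r `^ (- q).
Proof. by move=> r0 r1 pq; apply: ger_powR; rewrite ?r0 ?lerN2. Qed.

Lemma mul_powR (p r : R) : 0 < r -> r * r `^ (- p - 1) = r `^ (- p).
Proof.
move=> r0; rewrite -[X in X * _]powRr1 ?ltW// -powRD; first by congr powR; ring.
by rewrite (gt_eqF r0) implybT.
Qed.

(* [phi r = - V'(r) / r], so that [- grad V x = phi |x| *: x]. *)
Definition phi (r : R) := alpha * A * r `^ (- alpha - 2) - beta * B * r `^ (- beta - 2).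

(** Minus the derivative of the radial potential [LJr]: the signed strength of the force, positive
    when it is repulsive. *)
Definition psi (r : R) := alpha * A * r `^ (- alpha - 1) - beta * B * r `^ (- beta - 1).

Definition LJr (r : R) := A * r `^ (- alpha) - B * r `^ (- beta).

Let c0 := alpha * A + beta * B.
Let c00 : 0 < c0. Proof. by rewrite addr_gt0 ?mulr_gt0. Qed.

(** The factor [alpha + 5] is [alpha + 1] from the Lipschitz bound of [psi] plus 4 from the
    quadratic term in [force_taylor]; the other bounds on the force fit in it with room to spare. *)
Definition force_cst := (alpha + 5) * c0.

Lemma force_cst_gt0 : 0 < force_cst. Proof. by rewrite mulr_gt0 // addr_gt0. Qed.

Lemma LJE d (x : 'rV[R]_d) : LJ A B alpha beta x = LJr (enorm x).
Proof. by rewrite /LJ /LJr !powRN. Qed.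

Lemma psiE r : 0 < r -> psi r = r * phi r.
Proof.
move=> r0; rewrite /psi /phi.
rewrite (_ : - alpha - 1 = - (alpha + 1)); last lra.
rewrite (_ : - beta - 1 = - (beta + 1)); last lra.
rewrite -(mul_powR (alpha + 1)) // -(mul_powR (beta + 1)) //.
rewrite (_ : - (alpha + 1) - 1 = - alpha - 2); last lra.
rewrite (_ : - (beta + 1) - 1 = - beta - 2); last lra.
by ring.
Qed.

(** No cancellation between repulsion and attraction is exploited: for distances at least [e], with
    [e <= 1], both are bounded through the same power of [e], the one with exponent [alpha]. *)
Lemma abs_comb (u v K : R) : 0 <= u <= K -> 0 <= v <= K ->
  `|alpha * A * u - beta * B * v| <= c0 * K.
Proof.
move=> /andP[u0 uK] /andP[v0 vK]; rewrite (le_trans (ler_normB _ _)) //.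
rewrite !normrM !(gtr0_norm A0) !(gtr0_norm B0) !(gtr0_norm alpha0) !(gtr0_norm beta0).
rewrite !ger0_norm // /c0 mulrDl lerD // ler_wpM2l // mulr_ge0 // ltW //.
Qed.

Lemma norm_phi (e r : R) : 0 < e <= 1 -> e <= r -> `|phi r| <= c0 * e `^ (- alpha - 2).
Proof.
move=> /andP[e0 e1] er; apply: abs_comb; rewrite powR_ge0 /=.
  by rewrite -opprD powRN_le // addr_ge0 // ltW.
rewrite -!opprD (@le_trans _ _ (e `^ (- (beta + 2))))//.
  by rewrite powRN_le // addr_ge0 // ltW.
by rewrite powRN_expo_le // lerD2r ltW.
Qed.

Lemma norm_psi (e r : R) : 0 < e <= 1 -> e <= r -> `|psi r| <= c0 * e `^ (- alpha - 1).
Proof.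
move=> /andP[e0 e1] er; apply: abs_comb; rewrite powR_ge0 /=.
  by rewrite -opprD powRN_le // addr_ge0 // ltW.
rewrite -!opprD (@le_trans _ _ (e `^ (- (beta + 1))))//.
  by rewrite powRN_le // addr_ge0 // ltW.
by rewrite powRN_expo_le // lerD2r ltW.
Qed.

Lemma powR_lip_le (e p q r s : R) : 0 < e <= 1 -> 0 <= p -> p <= q -> e <= r -> r <= s ->
  0 <= r `^ (- p) - s `^ (- p) <= q * e `^ (- q - 1) * (s - r).
Proof.
move=> /andP[e0 e1] p0 pq er rs; have r0 : 0 < r by exact: lt_le_trans er.
have /andP[-> h] /= := powR_lip p0 r0 rs; rewrite (le_trans h)//.
rewrite ler_wpM2r ?subr_ge0// ler_pM ?powR_ge0//.
rewrite -!opprD (@le_trans _ _ (e `^ (- (p + 1))))//.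
  by rewrite powRN_le // addr_ge0.
by rewrite powRN_expo_le // lerD2r.
Qed.

Lemma psi_lip (e r s : R) : 0 < e <= 1 -> e <= r -> e <= s ->
  `|psi r - psi s| <= c0 * (alpha + 1) * e `^ (- alpha - 2) * `|r - s|.
Proof.
move=> e01; wlog rs : r s / r <= s.
  move=> wl er es; have [/wl|/ltW/wl] := leP r s; first exact.
  by rewrite distrC (distrC s); exact.
move=> er es; rewrite (distrC r) (ger0_norm (_ : 0 <= s - r)) ?subr_ge0//.
rewrite (_ : psi r - psi s = alpha * A * (r `^ (- (alpha + 1)) - s `^ (- (alpha + 1)))
   - beta * B * (r `^ (- (beta + 1)) - s `^ (- (beta + 1)))); last first.
  by rewrite /psi !opprD; ring.
rewrite -!(mulrA c0); apply: abs_comb.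
  have := @powR_lip_le e (alpha + 1) (alpha + 1) r s e01.
  rewrite (_ : - (alpha + 1) - 1 = - alpha - 2) ?mulrA; last lra.
  by apply=> //; have := alpha0; lra.
have := @powR_lip_le e (beta + 1) (alpha + 1) r s e01.
rewrite (_ : - (alpha + 1) - 1 = - alpha - 2) ?mulrA; last lra.
by apply => //; have := ab; have := beta0; lra.
Qed.

(** The Lipschitz constant of [phi] is worse by one power of the distance than that of the force;
    the weight [r] restores the scale [e^(-alpha-2)]. *)
Lemma phi_lip (e r s : R) : 0 < e <= 1 -> e <= r -> r <= s ->
  r * `|phi r - phi s| <= c0 * (alpha + 2) * e `^ (- alpha - 2) * (s - r).
Proof.
move=> e01 er rs; have /andP[e0 e1] := e01; have r0 : 0 < r by exact: lt_le_trans er.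
rewrite (_ : phi r - phi s = alpha * A * (r `^ (- (alpha + 2)) - s `^ (- (alpha + 2)))
   - beta * B * (r `^ (- (beta + 2)) - s `^ (- (beta + 2)))); last first.
  by rewrite /phi !opprD; ring.
rewrite -[X in X * `|_|](gtr0_norm r0) -normrM mulrBr !(mulrCA r).
rewrite -!mulrA mulrA (mulrA c0) -(mulrA c0) -mulrA.
have key (p : R) : 0 < p -> p <= alpha ->
   0 <= r * (r `^ (- (p + 2)) - s `^ (- (p + 2))) <=
   (alpha + 2) * (e `^ (- alpha - 2) * (s - r)).
  move=> p0 pa; have p2 : 0 <= p + 2 by lra.
  have /andP[h1 h2] := powR_lip p2 r0 rs.
  rewrite mulr_ge0 ?(ltW r0)//= (le_trans (ler_wpM2l (ltW r0) h2))//.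
  rewrite !mulrA ler_wpM2r ?subr_ge0// -mulrA mulrCA mul_powR //.
  rewrite ler_pM ?powR_ge0// ?lerD2r//.
  rewrite -opprD (@le_trans _ _ (e `^ (- (p + 2))))//; first by rewrite powRN_le.
  by rewrite powRN_expo_le // lerD2r.
by rewrite (mulrA alpha) (mulrA beta); apply: abs_comb; apply: key => //; exact: ltW.
Qed.

Lemma LJr_mvt (r s : R) : 0 < r -> r <= s ->
  exists2 c, r <= c <= s & LJr s - LJr r = - psi c * (s - r).
Proof.
move=> r0 rs.
have dV (x : R) : 0 < x -> is_derive x 1 LJr (- psi x).
  move=> x0.
  have da := is_derive1_powR (- alpha) x0.
  have db := is_derive1_powR (- beta) x0.
  apply: is_derive_eq; rewrite /psi /GRing.scale /=; ring.
have [||c] := @MVT_segment R LJr (fun x => - psi x) r s rs.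
- move=> x; rewrite in_itv /= => /andP[rx _]; apply: dV; exact: lt_trans rx.
- apply: derivable_within_continuous => x; rewrite in_itv /= => /andP[rx _].
  have x0 : 0 < x by exact: lt_le_trans rx.
  by have [] := dV _ x0.
by rewrite in_itv /= => cc E; exists c.
Qed.

Section force.
Context (d : nat).
Implicit Types (x y : 'rV[R]_d).

Definition force x : 'rV[R]_d := phi (enorm x) *: x.

(** Only the scalar factor is frozen below distance [e]: the force is then linear near the origin,
    hence globally Lipschitz, and it remains odd. *)
Definition trunc_force (e : R) x : 'rV[R]_d := phi (Num.max (enorm x) e) *: x.

Lemma trunc_force_eq e x : e <= enorm x -> trunc_force e x = force x.
Proof. by move=> ex; rewrite /trunc_force max_l. Qed.

(** The segment from [x] to [y] may cross the ball of radius [e]. The mean value theorem is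
    therefore applied to the radius alone, which stays at least [e], and polarization expresses the
    inner product of [x] and [y - x] through [enorm x], [enorm y] and [enorm (y - x)]. *)
Lemma force_taylor (e : R) x y : 0 < e <= 1 -> e <= enorm x -> e <= enorm y ->
  `|LJr (enorm y) - LJr (enorm x) + dot (force x) (y - x)| <=
  force_cst * e `^ (- alpha - 2) * enorm (y - x) ^+ 2.
Proof.
move=> e01 ex ey; have /andP[e0 e1] := e01.
have x0 : 0 < enorm x by exact: lt_le_trans ex.
have y0 : 0 < enorm y by exact: lt_le_trans ey.
set P := e `^ (- alpha - 2); have P0 : 0 <= P by exact: powR_ge0.
set D := enorm (y - x).
have D0 : 0 <= D by exact: enorm_ge0.
have yxD : `|enorm y - enorm x| <= D by exact: ler_enormB.
have [c [ec [xcD cE]]] : exists c, e <= c /\ `|c - enorm x| <= D /\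
    LJr (enorm y) - LJr (enorm x) = - psi c * (enorm y - enorm x).
  have [xy|/ltW yx] := leP (enorm x) (enorm y).
    have [c /andP[xc cy] E] := LJr_mvt x0 xy; exists c; split; first exact: le_trans xc.
    split=> //; rewrite (le_trans _ yxD) // !ger0_norm ?subr_ge0//.
    by rewrite lerD2r.
  have [c /andP[yc cx] E] := LJr_mvt y0 yx; exists c; split; first exact: le_trans yc.
  split; last by rewrite -opprB E; ring.
  rewrite (le_trans _ yxD) // (distrC c) (distrC (enorm y)) !ger0_norm ?subr_ge0//.
  by rewrite lerD2l lerN2.
have h1 := psi_lip e01 ec ex; rewrite -/P in h1.
have h2 := norm_phi e01 ex; rewrite -/P in h2.
rewrite cE /force dotZl.
have -> : dot x (y - x) = (enorm y ^+ 2 - enorm x ^+ 2 - D ^+ 2) / 2.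
  by rewrite /D !sqr_enorm !(dotBl, dotBr) (dotC y x); field.
have psix := psiE x0.
set q := enorm x in x0 ex yxD xcD cE h1 h2 psix *; set s := enorm y in y0 ey yxD cE *.
rewrite (_ : _ + _ = - (psi c - psi q) * (s - q) + phi q * ((s - q) ^+ 2 - D ^+ 2) / 2);
  last by rewrite psix; field.
rewrite (le_trans (ler_normD _ _)) // /force_cst -/P.
have -> : (alpha + 5) * c0 * P * D ^+ 2 = c0 * (alpha + 1) * P * D * D + 4 * (c0 * P * D ^+ 2) by ring.
apply: lerD.
  rewrite normrM normrN ler_pM // (le_trans h1) // ler_wpM2l//.
  by rewrite mulr_ge0 // mulr_ge0 ?(ltW c00)//; have := alpha0; lra.
rewrite -mulrA normrM (_ : 4 * _ = c0 * P * (4 * D ^+ 2)); last by ring.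
rewrite ler_pM //.
have : (s - q) ^+ 2 <= D ^+ 2 by rewrite -[leLHS]real_normK ?num_real// lerXn2r ?nnegrE.
rewrite ler_norml; have := sqr_ge0 (s - q); have := sqr_ge0 D; lra.
Qed.

Lemma enorm_trunc_force e x : 0 < e <= 1 -> enorm (trunc_force e x) <= force_cst * e `^ (- alpha - 1).
Proof.
move=> e01; have /andP[e0 e1] := e01; set m := Num.max (enorm x) e.
have em : e <= m by rewrite le_max lexx orbT.
have m0 : 0 < m by exact: lt_le_trans em.
rewrite enormZ (@le_trans _ _ `|psi m|)//.
  by rewrite psiE // normrM mulrC ler_wpM2r // gtr0_norm // le_max lexx.
rewrite (le_trans (norm_psi e01 em)) // ler_wpM2r ?powR_ge0//.
by rewrite /force_cst ler_peMl ?(ltW c00)//; have := alpha0; lra.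
Qed.

Lemma trunc_force_lip e x y : 0 < e <= 1 ->
  enorm (trunc_force e x - trunc_force e y) <= force_cst * e `^ (- alpha - 2) * enorm (x - y).
Proof.
move=> e01; have /andP[e0 e1] := e01.
wlog yx : x y / enorm y <= enorm x.
  move=> wl; have [/wl//|/ltW/wl] := leP (enorm y) (enorm x).
  by rewrite enormB (enormB y).
set m := Num.max (enorm x) e; set n := Num.max (enorm y) e.
have en : e <= n by rewrite le_max lexx orbT.
have em : e <= m by rewrite le_max lexx orbT.
have nm : n <= m by rewrite ge_max !le_max yx lexx orbT.
have yn : enorm y <= n by rewrite le_max lexx.
have mn : m - n <= enorm (x - y).
  have := ler_enormB x y; rewrite ler_norml => /andP[_ h].
  rewrite lerBlDr ge_max; apply/andP; split; first by lra.
  have := enorm_ge0 (x - y); lra.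
rewrite /trunc_force -/m -/n.
(* The difference of the scalar factors is attached to the shorter vector, of length at most [n], as
   the weight in [phi_lip] requires. *)
have -> : phi m *: x - phi n *: y = phi m *: (x - y) - (phi n - phi m) *: y.
  have {1}-> : phi n = phi m + (phi n - phi m) by rewrite addrC subrK.
  by rewrite scalerDl opprD addrA -scalerBr.
rewrite (le_trans (enormD _ _)) // enormN !enormZ.
set P := e `^ (- alpha - 2); have P0 : 0 <= P by exact: powR_ge0.
have h2 := norm_phi e01 em; rewrite -/P in h2.
have h1 := phi_lip e01 en nm; rewrite -/P in h1.
have -> : force_cst * P * enorm (x - y) = c0 * P * enorm (x - y)
   + (c0 * (alpha + 2) * P * enorm (x - y) + 2 * (c0 * P * enorm (x - y))).
  by rewrite /force_cst; ring.
apply: lerD; first by rewrite ler_wpM2r // enorm_ge0.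
rewrite ler_wpDr ?mulr_ge0 ?enorm_ge0 ?(ltW c00)//.
rewrite mulrC (le_trans (ler_wpM2r (normr_ge0 _) yn)) // (le_trans h1) // ler_wpM2l//.
by rewrite mulr_ge0 // mulr_ge0 ?(ltW c00)//; have := alpha0; lra.
Qed.

Lemma gradient_LJ x : x != 0 -> gradient (LJ A B alpha beta) x = - force x.
Proof.
move=> x0; apply/rowP => k; rewrite !mxE /partial.
have n0 : 0 < enorm x by rewrite enorm_gt0.
(* Half the distance to the origin, so that displacements shorter than [enorm x / 2] stay outside
   the ball of radius [e]. *)
set e := Num.min 1 (enorm x / 2).
have e01 : 0 < e <= 1 by rewrite lt_min ge_min lexx divr_gt0 // ltr01.
have ex : e <= enorm x / 2 by rewrite ge_min lexx orbT.
have n1 : enorm (delta_mx ord0 k : 'rV[R]_d) = 1.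
  rewrite enormE /dot (bigD1 k) //= big1 ?addr0.
    by rewrite !mxE !eqxx mulr1 sqrtr1.
  by move=> j jk; rewrite !mxE (negbTE jk) andbF mulr0.
suff [_ ->] : is_derive x (delta_mx ord0 k) (LJ A B alpha beta) (- force x ord0 k).
  by rewrite /force mxE.
apply: (@is_derive_quadratic _ _ _ _ _ _ (force_cst * e `^ (- alpha - 2)) (enorm x / 2)).
  by rewrite divr_gt0.
move=> h hx; rewrite !LJE.
have := @force_taylor e x (x + h *: delta_mx ord0 k) e01.
have -> : x + h *: delta_mx ord0 k - x = h *: delta_mx ord0 k by rewrite addrC addKr.
rewrite enormZ n1 mulr1 real_normK ?num_real//.
rewrite dotZr (_ : dot _ (delta_mx _ _) = force x ord0 k); last first.
  rewrite /dot (bigD1 k) //= big1 ?addr0 ?mxE ?eqxx ?mulr1// => j jk.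
  by rewrite !mxE (negbTE jk) andbF mulr0.
rewrite mulrN opprK; apply; first lra.
have := ler_enormB x (- (h *: delta_mx ord0 k)).
rewrite opprK enormN enormZ n1 mulr1 ler_norml (addrC x) => /andP[_].
by lra.
Qed.

End force.

End lennard_jones.

Section powR_negative.
Context (R : realType).
Implicit Types (a p x y : R).

Lemma powRN_invK a p : 0 < a -> 0 < p -> (a `^ (- p^-1)) `^ (- p) = a.
Proof.
by move=> a0 p0; rewrite -powRrM mulrNN mulVf ?gt_eqF// powRr1 // ltW.
Qed.

Lemma powRN_lt p x y : 0 < p -> 0 < x -> x < y -> y `^ (- p) < x `^ (- p).
Proof.
move=> p0 x0 xy; have y0 : 0 < y by exact: lt_trans xy.
rewrite !powRN ltf_pV2 ?posrE ?powR_gt0//.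
by apply: gt0_ltr_powR => //; rewrite nnegrE ltW.
Qed.

Lemma powRN_leP p x y : 0 < p -> 0 < x -> 0 < y -> x `^ (- p) <= y `^ (- p) -> y <= x.
Proof.
move=> p0 x0 y0 h; rewrite leNgt; apply/negP => xy.
by have := powRN_lt p0 x0 xy; rewrite ltNge h.
Qed.

End powR_negative.

Section sums.
Context (R : realType).

Lemma sum_ge2 (I : finType) (P : pred I) (f : I -> R) (a b : I) :
  P a -> P b -> a != b -> (forall i, P i -> 0 <= f i) ->
  f a + f b <= \sum_(i | P i) f i.
Proof.
move=> Pa Pb ab f0; rewrite (bigD1 a) //= (bigD1 b) ?Pb 1?eq_sym //= addrA lerDl.
by apply: sumr_ge0 => i /andP[/andP[Pi _] _]; exact: f0.
Qed.

Lemma ler_sum_const (I : finType) (P : pred I) (f : I -> R) (K : R) : 0 <= K ->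
  (forall i, P i -> f i <= K) -> \sum_(i | P i) f i <= #|I|%:R * K.
Proof.
move=> K0 fK; rewrite (le_trans (ler_sum _ fK)) // sumr_const -[leLHS]mulr_natl.
by rewrite ler_wpM2r // ler_nat max_card.
Qed.

End sums.

(** * Absence of blow-up *)

Section virial.
Context (R : realType) (A B alpha beta : R) (N d : nat).
Hypotheses (A0 : 0 < A) (B0 : 0 < B) (beta0 : 0 < beta) (ab : beta < alpha).
Implicit Types (x : 'I_N -> 'rV[R]_d).

Local Notation f := (@force R A B alpha beta d).
Local Notation psi := (psi A B alpha beta).

Definition total_force (g : 'rV[R]_d -> 'rV[R]_d) x i : 'rV[R]_d := \sum_j g (x i - x j).

Lemma forceN (z : 'rV[R]_d) : f (- z) = - f z.
Proof. by rewrite /force enormN scalerN. Qed.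

Lemma force0 : f (0 : 'rV[R]_d) = 0.
Proof. by rewrite /force scaler0. Qed.

Lemma dot_force (z : 'rV[R]_d) : z != 0 ->
  dot (f z) z = alpha * A * enorm z `^ (- alpha) - beta * B * enorm z `^ (- beta).
Proof.
rewrite -enorm_gt0 => z0; rewrite /force dotZl -sqr_enorm expr2 mulrA (mulrC (phi _ _ _ _ _)).
rewrite -psiE // mulrC /psi mulrBr !(mulrCA (enorm z)).
by rewrite mul_powR // mul_powR.
Qed.

(** There are [N] disjoint annuli around [x a] but only [N - 1] particles besides [a], so one
    annulus is empty. If none were, choosing a particle in each would be an injective, hence
    surjective, self-map of ['I_N], and it would reach [a], which is at distance 0. *)
Lemma pigeonhole_scale (L ell : R) x (a : 'I_N) : 1 <= L -> 0 < ell ->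
  exists k : 'I_N, forall j, enorm (x j - x a) <= ell * L ^+ k \/
     ell * L ^+ k.+1 < enorm (x j - x a).
Proof.
move=> L1 ell0; apply: contrapT => /forallNP H.
have {}H (k : 'I_N) : {j : 'I_N | ell * L ^+ k < enorm (x j - x a) <= ell * L ^+ k.+1}.
  apply: cid; have /existsNP[j /not_orP[/negP h1 /negP h2]] := H k.
  by exists j; rewrite ltNge h1 leNgt h2.
pose g k := sval (H k).
have gP (k : 'I_N) : ell * L ^+ k < enorm (x (g k) - x a) <= ell * L ^+ k.+1 by exact: svalP (H k).
have ginj : injective g.
  have lem (k l : 'I_N) : (k < l)%N -> g k = g l -> False.
    move=> kl gkl; have /andP[_ h1] := gP k; have /andP[h2 _] := gP l.
    have := lt_le_trans h2 (_ : _ <= enorm (x (g k) - x a)).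
    rewrite gkl => /(_ (lexx _)); rewrite -gkl => h3.
    have := lt_le_trans h3 h1; rewrite ltNge => /negP; apply.
    by rewrite ler_pM2l // ler_weXn2l.
  move=> k l gkl; apply/val_inj; have [kl|kl|//] := ltngtP k l.
    by case: (lem _ _ kl gkl).
  by case: (lem _ _ kl (esym gkl)).
have /codomP[k ak] := injF_onto ginj a.
have /andP[h _] := gP k; move: h; rewrite -ak subrr enorm0 ltNge => /negP; apply.
by rewrite mulr_ge0 ?(ltW ell0)// exprn_ge0 // (le_trans _ L1).
Qed.

(* At one of the scales [Th r L^k] the particles within that distance of [a] form a cluster far
   away from all the others. Testing the forces of the cluster against [x i - x a], the
   interactions inside the cluster symmetrize to [dot (f z) z], whose repulsive part dominates,
   and the outer ones are damped by the separation factor [L]. *)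
Lemma virial (th Th : R) : 0 < th -> 0 < Th ->
  exists c r0 : R, [/\ 0 < c, 0 < r0 & forall (r : R) x, 0 < r -> r <= r0 ->
    (forall i j, i != j -> th * r <= enorm (x i - x j)) ->
    (exists i j, i != j /\ enorm (x i - x j) <= Th * r) ->
    c * r `^ (- alpha - 1) <= \sum_i enorm (total_force f x i)].
Proof.
move=> th0 Th0; have alpha0 : 0 < alpha by exact: lt_trans ab.
pose N2 : R := N%:R ^+ 2.
have N20 : 0 <= N2 by exact: sqr_ge0.
have N2E : N2 = N%:R * N%:R by rewrite /N2 expr2.
(* Large enough for the at most [N^2] interactions between the cluster and the rest to cost no more
   than [(m + bb) / 8] in total. *)
pose L : R := 1 + 8 * (N2 + 1).
have L1 : 1 < L by rewrite /L; lra.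
have L1E : L - 1 = 8 * (N2 + 1) by rewrite /L; ring.
clearbody L N2.
(* [m0 * r^(-alpha)] is the repulsive part of [dot (f z) z] at distance [Th * r], and
   [b0 * r^(-beta)] below bounds its attractive part at distances at least [th * r]. *)
pose m0 := alpha * A * Th `^ (- alpha).
have m00 : 0 < m0 by rewrite !mulr_gt0 // powR_gt0.
pose b0 := beta * B * th `^ (- beta).
have b00 : 0 < b0 by rewrite !mulr_gt0 // powR_gt0.
pose c := m0 / 2 / (Th * L ^+ N).
have LN0 : 0 < Th * L ^+ N by rewrite mulr_gt0 // exprn_gt0 // (lt_trans _ L1).
(* As [beta < alpha], radii below [q^(-1/(alpha-beta))] make the attractive part at most
   [m / (4 * (N2 + 1))], so that all pairs together cannot offset the close one. *)
pose q := 4 * (N2 + 1) * b0 / m0.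
have N21 : 0 < N2 + 1 by rewrite ltr_wpDl.
have q0 : 0 < q by rewrite divr_gt0 // mulr_gt0 // mulr_gt0.
exists c, (q `^ (- (alpha - beta)^-1)); split.
- by rewrite !divr_gt0.
- by rewrite powR_gt0.
move=> r x r0 rq dmin [a [b [aneb abT]]].
pose m := m0 * r `^ (- alpha); pose bb := b0 * r `^ (- beta).
have bb0 : 0 < bb by rewrite mulr_gt0 ?powR_gt0.
have mm0 : 0 < m by rewrite mulr_gt0 ?powR_gt0.
have mE : m = alpha * A * (Th * r) `^ (- alpha).
  by rewrite /m /m0 powRM ?(ltW Th0) ?(ltW r0)// mulrA.
have bbE : bb = beta * B * (th * r) `^ (- beta).
  by rewrite /bb /b0 powRM ?(ltW th0) ?(ltW r0)// mulrA.
have aA0 : 0 <= alpha * A by rewrite mulr_ge0 ?(ltW alpha0) ?(ltW A0).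
have bB0 : 0 <= beta * B by rewrite mulr_ge0 ?(ltW beta0) ?(ltW B0).
have bm : (N2 + 1) * bb <= m / 4.
  have : q <= r `^ (- (alpha - beta)).
    by rewrite -[leLHS](@powRN_invK _ _ (alpha - beta)) ?subr_gt0// powRN_le // ?subr_ge0 ltW.
  rewrite /q ler_pdivrMr // => h.
  rewrite ler_pdivlMr // /m /bb.
  have -> : r `^ (- alpha) = r `^ (- (alpha - beta)) * r `^ (- beta).
    by rewrite -powRD ?(gt_eqF r0) ?implybT//; congr powR; ring.
  have -> : (N2 + 1) * (b0 * r `^ (- beta)) * 4 = 4 * (N2 + 1) * b0 * r `^ (- beta) by ring.
  have -> : m0 * (r `^ (- (alpha - beta)) * r `^ (- beta)) = r `^ (- (alpha - beta)) * m0 * r `^ (- beta) by ring.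
  by rewrite ler_wpM2r // powR_ge0.
have mE' : m = m0 * r `^ (- alpha) by [].
clearbody m bb.
have [k kP] := @pigeonhole_scale L (Th * r) x a (ltW L1) (mulr_gt0 Th0 r0).
set ell := Th * r * L ^+ k in kP.
have ell0 : 0 < ell by rewrite !mulr_gt0 // exprn_gt0 // (lt_trans _ L1).
have ell_ge : Th * r <= ell by rewrite ler_peMr ?exprn_ege1 ?(ltW L1)// mulr_ge0 ?ltW.
have ell_le : ell <= Th * L ^+ N * r.
  rewrite /ell mulrAC ler_wpM2r ?(ltW r0)// ler_wpM2l ?(ltW Th0)// ler_weXn2l ?(ltW L1)//.
  exact: ltnW.
pose C : pred 'I_N := fun i => enorm (x i - x a) <= ell.
have Ca : C a by rewrite /C subrr enorm0 ltW.
have Cb : C b by rewrite /C enormB (le_trans abT).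
have nz i j : i != j -> x i - x j != 0.
  by move=> /dmin h; rewrite -enorm_gt0 (lt_le_trans _ h) // mulr_gt0.
have w_ge i j : - bb <= dot (f (x i - x j)) (x i - x j).
  have [->|ij] := eqVneq i j.
    by rewrite subrr force0 /dot big1 ?oppr_le0 ?ltW// => l _; rewrite mxE mul0r.
  rewrite dot_force ?nz// -[leLHS]add0r lerD //.
    by rewrite mulr_ge0 ?powR_ge0.
  by rewrite lerN2 bbE ler_wpM2l // powRN_le ?mulr_gt0 ?dmin// ltW.
have w_ab i j : i != j -> enorm (x i - x j) <= Th * r -> m - bb <= dot (f (x i - x j)) (x i - x j).
  move=> ij ijT; rewrite dot_force ?nz// lerB //.
    by rewrite mE ler_wpM2l // powRN_le ?enorm_gt0 ?nz// ltW.
  by rewrite bbE ler_wpM2l // powRN_le ?mulr_gt0 ?dmin// ltW.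
have far i j : C i -> ~~ C j -> - ((m + bb) / (8 * (N2 + 1))) <= dot (f (x i - x j)) (x i - x a).
  move=> Ci Cj; have := kP j; rewrite -/(C j) (negbTE Cj) => -[//|].
  rewrite exprS mulrCA -/ell => jfar.
  have ij : i != j by apply: contraNneq Cj => <-.
  set D := enorm (x i - x j).
  have LD : (L - 1) * ell <= D.
    have := enorm_subD (x j) (x i) (x a); rewrite (enormB (x j) (x i)) -/D.
    by move: Ci; rewrite /C; lra.
  have Dell : ell <= D.
    apply: le_trans LD; rewrite ler_peMl ?(ltW ell0)// L1E; lra.
  have D0 : 0 < D by exact: lt_le_trans Dell.
  rewrite lerNl (le_trans (ler_norm _)) // normrN (le_trans (normr_dot _ _)) //.
  rewrite ler_pdivlMr; last by rewrite mulr_gt0 //; lra.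
  rewrite (@le_trans _ _ (enorm (f (x i - x j)) * D)) //.
    rewrite -mulrA ler_wpM2l ?enorm_ge0// (le_trans _ LD)// mulrC.
    by rewrite L1E ler_wpM2l ?mulr_ge0 ?addr_ge0.
  rewrite /force enormZ -/D -mulrA -[X in _ * (X * _)]gtr0_norm //.
  rewrite -[X in _ * (_ * X)]gtr0_norm // -!normrM.
  have -> : phi A B alpha beta D * (D * D) = alpha * A * D `^ (- alpha) - beta * B * D `^ (- beta).
    by rewrite -(dot_force (nz _ _ ij)) -/D /force dotZl -sqr_enorm expr2.
  rewrite (le_trans (ler_normB _ _)) // lerD //.
    rewrite ger0_norm ?(mulr_ge0 aA0) ?powR_ge0//.
    by rewrite mE ler_wpM2l // powRN_le ?mulr_gt0 ?(le_trans ell_ge)// ltW.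
  rewrite ger0_norm ?(mulr_ge0 bB0) ?powR_ge0//.
  by rewrite bbE ler_wpM2l // powRN_le ?mulr_gt0 ?dmin// ltW.
pose S := \sum_(i | C i) dot (total_force f x i) (x i - x a).
have S_le : S <= Th * L ^+ N * r * \sum_i enorm (total_force f x i).
  rewrite /S mulr_sumr big_mkcond /=; apply: ler_sum => i _.
  case: ifPn => [Ci|_]; last by rewrite mulr_ge0 ?enorm_ge0 // ltW // mulr_gt0.
  rewrite (le_trans (dot_le _ _)) // mulrC ler_wpM2r ?enorm_ge0//.
  exact: le_trans Ci ell_le.
pose T := \sum_(i | C i) \sum_(j | C j) dot (f (x i - x j)) (x i - x a).
pose U := \sum_(i | C i) \sum_(j | ~~ C j) dot (f (x i - x j)) (x i - x a).
have STU : S = T + U.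
  rewrite /S /T /U -big_split /=; apply: eq_bigr => i Ci.
  by rewrite /total_force dot_suml (bigID C).
have T2 : 2 * T = \sum_(i | C i) \sum_(j | C j) dot (f (x i - x j)) (x i - x j).
  rewrite mulr2n mulrDl mul1r {2}/T exchange_big /= /T -big_split /=.
  apply: eq_bigr => i _; rewrite -big_split; apply: eq_bigr => j _ /=.
  rewrite -[x j - x i]opprB forceN dotNl -dotBr.
  by congr dot; rewrite opprB addrA subrK.
(* Adding [bb] to each pair makes every summand nonnegative, so only the two ordered copies of the
   close pair need to be kept. *)
have T_ge : m - (N2 + 1) * bb <= T.
  have : 2 * m <= 2 * T + N2 * bb.
    rewrite T2; have -> : N2 * bb = \sum_(i : 'I_N) \sum_(j : 'I_N) bb.
      by rewrite !sumr_const card_ord -mulrnA -[RHS]mulr_natl natrM N2E.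
    have h2 : \sum_(i | C i) \sum_(j | C j) bb <= \sum_(i < N) \sum_(j < N) bb.
      rewrite big_mkcond /=; apply: ler_sum => i _; case: ifP => _; last first.
        by apply: sumr_ge0 => j _; exact: ltW.
      rewrite big_mkcond /=; apply: ler_sum => j _; case: ifP => // _; exact: ltW.
    rewrite (le_trans _ (lerD (lexx _) h2)) //.
    rewrite -big_split /=.
    under eq_bigr do rewrite -big_split /=.
    rewrite pair_big /=.
    have := @sum_ge2 R _ (fun p : 'I_N * 'I_N => C p.1 && C p.2)
      (fun p => dot (f (x p.1 - x p.2)) (x p.1 - x p.2) + bb) (a, b) (b, a).
    rewrite /= Ca Cb => /(_ isT isT) h.
    apply: le_trans (h _ _); last 2 first.
    - by apply: contra aneb => /eqP[->].
    - by move=> p _; have := w_ge p.1 p.2; lra.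
    have := w_ab _ _ aneb abT; have := w_ab b a.
    rewrite enormB eq_sym => /(_ aneb abT); lra.
  have : 0 <= N2 * bb by rewrite mulr_ge0 // ltW.
  by have := bb0; lra.
have U_ge : - ((m + bb) / 8) <= U.
  rewrite lerNl -sumrN; under eq_bigr do rewrite -sumrN.
  have K0 : 0 <= (m + bb) / (8 * (N2 + 1)).
    by rewrite divr_ge0 ?addr_ge0 ?ltW// mulr_gt0 //; lra.
  apply: (@le_trans _ _ (N%:R * (N%:R * ((m + bb) / (8 * (N2 + 1)))))).
    rewrite -[X in X%:R * _]card_ord; apply: ler_sum_const.
      by rewrite mulr_ge0.
    move=> i Ci; rewrite -[X in X%:R * _]card_ord; apply: ler_sum_const => // j Cj.
    by rewrite lerNl far.
  rewrite mulrA -N2E invfM (_ : _ * _ = (m + bb) / 8 * (N2 / (N2 + 1))); last by ring.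
  by rewrite ler_piMr ?divr_ge0 ?addr_ge0 ?(ltW mm0) ?(ltW bb0)// ler_pdivrMr //; lra.
have : m / 2 <= S.
  rewrite STU; have : bb <= (N2 + 1) * bb by rewrite ler_peMl ?(ltW bb0)// lerDr.
  by move: T_ge U_ge bm; lra.
move=> /le_trans/(_ S_le); rewrite -mulrA -ler_pdivrMl // mulrC => h.
rewrite -(@ler_pM2l _ r) // (le_trans _ h) //.
rewrite /c -[- alpha]opprK opprK mulrCA mul_powR // mE'.
have -> : m0 * r `^ (- alpha) / 2 / (Th * L ^+ N) = m0 / 2 / (Th * L ^+ N) * r `^ (- alpha) by ring.
by [].
Qed.

End virial.

Section crossing.
Context (R : realType).

(** [t1] is the first time at which [f] reaches [2 * M], and [s0] the last time before it at which
    [f] is at most [M]. In between the energy is comparable to [M], as the dissipation estimate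
    requires. *)
Lemma last_crossing (f : R -> R) (M t : R) : continuous f -> 0 <= t ->
  f 0 < M -> 2 * M <= f t -> 0 < M ->
  exists s0 t1, [/\ 0 <= s0, s0 <= t1, t1 <= t, f s0 <= M &
    f t1 = 2 * M /\ forall u, s0 <= u <= t1 -> M <= f u <= 2 * M].
Proof.
move=> cf t0 f0 ft M0.
have M2 : M < 2 * M by lra.
pose S := [set u : R | 0 <= u <= t /\ 2 * M <= f u].
have St : S t by split; rewrite ?t0 ?lexx.
have hS : has_inf S.
  split; first by exists t.
  by exists 0 => u [/andP[]].
pose t1 := inf S.
have t10 : 0 <= t1 by apply: lb_le_inf; [exists t | move=> u [/andP[]]].
have t1t : t1 <= t by apply: ge_inf => //; exact: hS.2.
have fbefore u : 0 <= u -> u < t1 -> f u < 2 * M.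
  move=> u0 ut; rewrite ltNge; apply/negP => fu.
  have : t1 <= u by apply: ge_inf; [exact: hS.2 | split=> //; rewrite u0 (le_trans (ltW ut))].
  by rewrite leNgt ut.
have ft1 : 2 * M <= f t1.
  rewrite leNgt; apply/negP => ft1.
  have : \forall u \near t1, f u < 2 * M by move: (cf t1) => /cvgr_lt/(_ _ ft1).
  move=> /nbhs_ballP[e /= e0 He].
  have [u Su ut1] := inf_adherent e0 hS.
  have : f u < 2 * M.
    apply: He; rewrite /ball /= ltr_distlC; have tu : t1 <= u by apply: ge_inf => //; exact: hS.2.
    by rewrite -/t1 in ut1; rewrite ut1 andbT; lra.
  by case: Su => _ /le_lt_trans h /h; rewrite ltxx.
have ft1E : f t1 = 2 * M.
  have [t1_0|t1n0] := eqVneq t1 0; first by move: ft1 f0; rewrite t1_0; lra.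
  apply/eqP; rewrite eq_le ft1 andbT leNgt; apply/negP => ft1'.
  have : \forall u \near t1, 2 * M < f u by move: (cf t1) => /cvgr_gt/(_ _ ft1').
  move=> /nbhs_ballP[e /= e0 He].
  have t1p : 0 < t1 by rewrite lt_def t1n0.
  pose u := t1 - Num.min e t1 / 2.
  have m0 : 0 < Num.min e t1 by rewrite lt_min e0.
  have me : Num.min e t1 <= e by rewrite ge_min lexx.
  have mt : Num.min e t1 <= t1 by rewrite ge_min lexx orbT.
  have : 2 * M < f u by apply: He; rewrite /ball /= ltr_distlC /u; lra.
  have := fbefore u; rewrite /u => h; rewrite ltNge ltW// h //; lra.
pose S' := [set u : R | 0 <= u <= t1 /\ f u <= M].
have S'0 : S' 0 by split; rewrite ?lexx ?t10 // ltW.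
have hS' : has_sup S'.
  split; first by exists 0.
  by exists t1 => u [/andP[]].
pose s0 := sup S'.
have s00 : 0 <= s0 by apply: ub_le_sup => //; exact: hS'.2.
have s0t1 : s0 <= t1 by apply: ge_sup; [exists 0 | move=> u [/andP[]]].
have fafter u : s0 < u -> u <= t1 -> M < f u.
  move=> u0 ut; rewrite ltNge; apply/negP => fu.
  have : u <= s0 by apply: ub_le_sup; [exact: hS'.2 | split=> //; rewrite ut andbT (le_trans s00) // ltW].
  by rewrite leNgt u0.
have fs0 : f s0 <= M.
  rewrite leNgt; apply/negP => fs0.
  have : \forall u \near s0, M < f u by move: (cf s0) => /cvgr_gt/(_ _ fs0).
  move=> /nbhs_ballP[e /= e0 He].
  have [u Su us0] := sup_adherent e0 hS'.
  have : M < f u.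
    apply: He; rewrite /ball /= ltr_distlC; have tu : u <= s0 by apply: ub_le_sup => //; exact: hS'.2.
    by rewrite -/s0 in us0; apply/andP; split; lra.
  by case: Su => _ /le_lt_trans h /h; rewrite ltxx.
have fs0' : M <= f s0.
  rewrite leNgt; apply/negP => fs0'.
  have s0t1' : s0 < t1.
    by rewrite lt_def s0t1 andbT; apply: contraTneq fs0' => <-; rewrite ft1E -leNgt ltW.
  have : \forall u \near s0, f u < M by move: (cf s0) => /cvgr_lt/(_ _ fs0').
  move=> /nbhs_ballP[e /= e0 He].
  pose m := Num.min e (t1 - s0).
  have m0 : 0 < m by rewrite lt_min e0 subr_gt0.
  have me : m <= e by rewrite ge_min lexx.
  have mt : m <= t1 - s0 by rewrite ge_min lexx orbT.
  have : f (s0 + m / 2) < M by apply: He; rewrite /ball /= ltr_distlC; lra.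
  have := fafter (s0 + m / 2); move=> h; rewrite ltNge ltW// h //; lra.
exists s0, t1; split => //; split => // u /andP[s0u ut1].
apply/andP; split.
  by move: s0u; rewrite le_eqVlt => /predU1P[<-//|s0u]; exact/ltW/fafter.
move: ut1; rewrite le_eqVlt => /predU1P[->|ut1]; first by rewrite ft1E.
by apply/ltW/fbefore => //; exact: le_trans s0u.
Qed.

End crossing.

Section energy_step.
Context (R : realType) (N d : nat) (f : 'rV[R]_d -> 'rV[R]_d) (v : 'rV[R]_d -> R).
Hypothesis fN : forall z, f (- z) = - f z.
Hypothesis f0 : f 0 = 0.

Definition energy (x : 'I_N -> 'rV[R]_d) : R := 2^-1 * \sum_i \sum_(j | j != i) v (x i - x j).

(** Oddness of [f] symmetrizes the double sum: the work of the pair forces on relative displacements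
    is twice the work of the total forces. *)
Lemma total_force_dot x (y : 'I_N -> 'rV[R]_d) :
  \sum_i \sum_j dot (f (x i - x j)) (y i - y j) = 2 * \sum_i dot (total_force f x i) (y i).
Proof.
have E : \sum_i dot (total_force f x i) (y i) = \sum_i \sum_j dot (f (x i - x j)) (y i).
  by apply: eq_bigr => i _; rewrite /total_force dot_suml.
have E2 : \sum_i \sum_j dot (f (x i - x j)) (y j) = - \sum_i dot (total_force f x i) (y i).
  rewrite E exchange_big /= -sumrN; apply: eq_bigr => i _; rewrite -sumrN.
  by apply: eq_bigr => j _; rewrite -[x j - x i]opprB fN dotNl.
under eq_bigr do (under eq_bigr do rewrite dotBr; rewrite sumrB).
by rewrite sumrB E2 -E opprK mulr2n mulrDl mul1r.
Qed.

(** The first summand collects the second order Taylor terms, the second one the work of the total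
    force on the part of the displacement that does not follow it. *)
Definition step_cst (Cf : R) : R :=
  2 * N%:R ^+ 2 * Cf * (N%:R * Cf + 2) ^+ 2 + N%:R ^+ 2 * Cf.

(** One step of length [h] of a perturbed gradient descent, with forces of order [P] at scale [r].
    Cauchy-Schwarz turns the lower bound on the sum of the forces into a dissipation of at least
    [nu c^2 h P^2 / N]; the errors are a small multiple of [h P^2] and the work [P eta] of the
    noise. *)
Lemma energy_step (r P Cf c nu kap kap' h eta : R) (x y : 'I_N -> 'rV[R]_d) :
  0 < r -> 0 < P -> 0 <= Cf -> 0 <= c -> 0 < nu <= 1 -> 0 <= kap <= 1 -> 0 <= kap' <= 1 ->
  0 <= h -> h * P <= kap * r -> 0 <= eta -> eta <= kap * r ->
  (forall i j, enorm (f (x i - x j)) <= Cf * P) ->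
  (forall i j, i != j -> v (y i - y j) - v (x i - x j) <=
      - dot (f (x i - x j)) ((y i - y j) - (x i - x j)) +
      Cf * (P / r) * enorm ((y i - y j) - (x i - x j)) ^+ 2) ->
  (forall i, enorm (y i - x i - (h * nu) *: total_force f x i) <= h * kap' * P + eta) ->
  c * P <= \sum_i enorm (total_force f x i) ->
  energy y - energy x <= - (nu * c ^+ 2 / N%:R) * (h * P ^+ 2)
    + step_cst Cf * (kap + kap') * (h * P ^+ 2) + step_cst Cf * (P * eta).
Proof.
move=> r0 P0 Cf0 c0 /andP[nu0 nu1] /andP[k0 k1] /andP[k0' k1'] h0 hP e0 ek fb tay inc low.
pose n : R := N%:R.
pose C7 := 2 * n ^+ 2 * Cf * (n * Cf + 2) ^+ 2 + n ^+ 2 * Cf.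
rewrite (_ : step_cst Cf = C7) // -/n.
have n0 : 0 <= n by exact: ler0n.
have [N0|N0] := posnP N.
  rewrite /energy !big1 ?mulr0 ?subr0; last 2 first.
  - by move=> [i iN]; exfalso; rewrite N0 in iN.
  - by move=> [i iN]; exfalso; rewrite N0 in iN.
  by rewrite /C7 (_ : n = 0) ?invr0 ?expr0n /= ?(mulr0, mul0r, oppr0, addr0) // /n N0.
have n1 : 0 < n by rewrite ltr0n.
pose Fx := total_force f x.
have Fb i : enorm (Fx i) <= n * (Cf * P).
  rewrite (le_trans (enorm_sum _ _)) // /n -[X in X%:R * _]card_ord.
  by apply: ler_sum_const => //; rewrite mulr_ge0 // ltW.
pose D0 := h * P * (n * Cf + 1) + eta.
have D00 : 0 <= D0.
  by rewrite addr_ge0 // !mulr_ge0 ?(ltW P0)// addr_ge0 // mulr_ge0.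
have dlt i : enorm (y i - x i) <= D0.
  rewrite -[y i - x i](subrK ((h * nu) *: Fx i)) (le_trans (enormD _ _)) //.
  rewrite (le_trans (lerD (inc i) (lexx _))) // enormZ ger0_norm ?mulr_ge0 ?(ltW nu0)//.
  have h1 : h * nu * enorm (Fx i) <= h * P * (n * Cf).
    rewrite (_ : h * P * (n * Cf) = h * (n * (Cf * P))); last by ring.
    by rewrite -mulrA ler_wpM2l // (le_trans _ (Fb i)) // ler_piMl // enorm_ge0.
  have h2 : h * kap' * P <= h * P by rewrite mulrAC ler_piMr // mulr_ge0 // ltW.
  rewrite /D0 mulrDr mulr1; lra.
have D0k : D0 <= kap * r * (n * Cf + 2).
  have : h * P * (n * Cf + 1) <= kap * r * (n * Cf + 1).
    by rewrite ler_wpM2r // addr_ge0 // mulr_ge0.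
  by rewrite /D0; lra.
have pair_le i j : enorm ((y i - y j) - (x i - x j)) <= 2 * D0.
  have -> : (y i - y j) - (x i - x j) = (y i - x i) - (y j - x j).
    by rewrite !opprB addrACA [in RHS]addrACA; congr (_ + _); rewrite addrC.
  rewrite (le_trans (enormD _ _)) // enormN mulr2n mulrDl mul1r.
  by rewrite lerD.
(* Of the two factors in the squared displacement, one is kept as [D0], linear in [h] and [eta], and
   the other is bounded by a multiple of [kap * r], which supplies the small factor [kap]. *)
pose K := 4 * (n * Cf + 2) * (Cf * P * kap * D0).
have second i j : Cf * (P / r) * enorm ((y i - y j) - (x i - x j)) ^+ 2 <= K.
  have : enorm ((y i - y j) - (x i - x j)) ^+ 2 <= 4 * D0 * (kap * r * (n * Cf + 2)).
    rewrite expr2 (_ : 4 * D0 * _ = (2 * D0) * (2 * (kap * r * (n * Cf + 2)))); last by ring.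
    rewrite ler_pM ?enorm_ge0//; rewrite (le_trans (pair_le i j)) // ler_wpM2l //.
  have CP : 0 <= Cf * (P / r) by rewrite mulr_ge0 // divr_ge0 // ltW.
  move=> /(ler_wpM2l CP) /le_trans; apply; rewrite /K le_eqVlt; apply/orP; left; apply/eqP.
  by field; rewrite gt_eqF.
have K0 : 0 <= K.
  by rewrite /K !mulr_ge0 ?(ltW P0)// addr_ge0 // mulr_ge0.
have main : energy y - energy x <= - (\sum_i dot (Fx i) (y i - x i)) + n ^+ 2 * K / 2.
  have E1 : \sum_i \sum_(j | j != i) (v (y i - y j) - v (x i - x j)) <=
     \sum_i \sum_(j : 'I_N) (- dot (f (x i - x j)) ((y i - x i) - (y j - x j)) + K).
    apply: ler_sum => i _; rewrite big_mkcond /=; apply: ler_sum => j _.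
    case: ifPn => [ji|/negPn/eqP ->].
      rewrite (le_trans (tay _ _ _)) 1?eq_sym // lerD //.
      rewrite (_ : y i - y j - (x i - x j) = (y i - x i) - (y j - x j)) //.
      by rewrite !opprB addrACA [in RHS]addrACA; congr (_ + _); rewrite addrC.
    by rewrite !subrr f0 /dot big1 ?oppr0 ?add0r// => k _; rewrite mxE mul0r.
  have E2 : \sum_i \sum_(j : 'I_N) (- dot (f (x i - x j)) ((y i - x i) - (y j - x j)) + K)
     = - (2 * \sum_i dot (Fx i) (y i - x i)) + n ^+ 2 * K.
    under eq_bigr do rewrite big_split /= sumrN.
    rewrite big_split /= sumrN (total_force_dot x (fun i => y i - x i)); congr (_ + _).
    by rewrite !sumr_const card_ord -mulrnA -[LHS]mulr_natl natrM expr2.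
  rewrite /energy -mulrBr -sumrB.
  under eq_bigr do rewrite -sumrB.
  by move: E1; rewrite E2; lra.
(* Summing [|F|^2 >= 2 Q |F| - Q^2] over the particles, with [Q] the lower bound for the mean of
   [|F|], gives the Cauchy-Schwarz bound. *)
pose Q := c * P / n.
have Fdot i : - dot (Fx i) (y i - x i) <= - (h * nu) * (2 * Q * enorm (Fx i) - Q ^+ 2)
    + n * (Cf * P) * (h * kap' * P + eta).
  set e := y i - x i - (h * nu) *: Fx i.
  have -> : y i - x i = (h * nu) *: Fx i + e by rewrite [RHS]addrC subrK.
  rewrite dotDr dotZr opprD -sqr_enorm lerD //.
    rewrite mulNr lerN2 ler_wpM2l ?mulr_ge0 ?(ltW nu0)//.
    by have := sqr_ge0 (enorm (Fx i) - Q); lra.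
  rewrite lerNl (le_trans _ (_ : - (enorm (Fx i) * enorm e) <= _)) //.
    by rewrite lerN2 ler_pM ?enorm_ge0//; exact: inc.
  by have := normr_dot (Fx i) e; rewrite ler_norml => /andP[].
have sumF : - (\sum_i dot (Fx i) (y i - x i)) <=
   - (h * nu) * (c ^+ 2 * P ^+ 2 / n) + n ^+ 2 * Cf * P * (h * kap' * P + eta).
  rewrite -sumrN (le_trans (ler_sum _ (fun i _ => Fdot i))) //.
  rewrite big_split /= -mulr_sumr sumrB -mulr_sumr !sumr_const card_ord -[_ *+ N]mulr_natl -/n.
  rewrite lerD //; last first.
    by rewrite -[_ *+ N]mulr_natl -/n le_eqVlt; apply/orP; left; apply/eqP; ring.
  rewrite !mulNr lerN2 ler_wpM2l ?mulr_ge0 ?(ltW nu0)//.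
  have Q0 : 0 <= 2 * Q by rewrite mulr_ge0 // divr_ge0 // mulr_ge0 // ltW.
  have := ler_wpM2l Q0 low; rewrite -/Fx.
  have -> : 2 * Q * (c * P) = 2 * (c ^+ 2 * P ^+ 2 / n) by rewrite /Q; field; rewrite gt_eqF.
  have -> : n * Q ^+ 2 = c ^+ 2 * P ^+ 2 / n by rewrite /Q; field; rewrite gt_eqF.
  lra.
pose J := h * P ^+ 2; pose I := P * eta.
have J0 : 0 <= J by rewrite mulr_ge0 // exprn_ge0 // ltW.
have I0 : 0 <= I by rewrite mulr_ge0 // ltW.
rewrite (le_trans main) // (le_trans (lerD sumF (lexx _))) //.
pose a := 2 * n ^+ 2 * Cf * (n * Cf + 2) ^+ 2; pose b := n ^+ 2 * Cf.
have b0 : 0 <= b by rewrite mulr_ge0 // exprn_ge0.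
have a0 : 0 <= a by rewrite !mulr_ge0 // ?exprn_ge0// addr_ge0 // mulr_ge0.
have C7E : C7 = a + b by [].
have Kle : n ^+ 2 * K / 2 <= a * kap * J + a * I.
  have -> : n ^+ 2 * K / 2 = 2 * n ^+ 2 * Cf * (n * Cf + 2) * kap * ((n * Cf + 1) * J + I).
    by rewrite /K /D0 /J /I; field.
  have q1 : 0 <= n * Cf by rewrite mulr_ge0.
  rewrite /a expr2 mulrDr; apply: lerD.
    rewrite (_ : 2 * n ^+ 2 * Cf * ((n * Cf + 2) * (n * Cf + 2)) * kap * J =
       2 * n ^+ 2 * Cf * (n * Cf + 2) * kap * ((n * Cf + 2) * J)); last by ring.
    rewrite ler_wpM2l //; first by rewrite !mulr_ge0 ?exprn_ge0// addr_ge0.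
    by rewrite ler_wpM2r //; lra.
  rewrite ler_wpM2r // (_ : _ * (n * Cf + 2) ^+ 2 = 2 * (n * n) * Cf * (n * Cf + 2) * (n * Cf + 2)); last by ring.
  by rewrite ler_wpM2l ?mulr_ge0 ?addr_ge0//; lra.
have -> : - (h * nu) * (c ^+ 2 * P ^+ 2 / n) = - (nu * c ^+ 2 / n) * J by rewrite /J; ring.
have -> : n ^+ 2 * Cf * P * (h * kap' * P + eta) = b * kap' * J + b * I by rewrite /b /J /I; ring.
have -> : C7 * (kap + kap') * (h * P ^+ 2) = a * kap * J + b * kap * J + a * kap' * J + b * kap' * J.
  by rewrite C7E -/J; ring.
have -> : C7 * (P * eta) = a * I + b * I by rewrite C7E -/I; ring.
have p1 : 0 <= b * kap * J by rewrite mulr_ge0 // (mulr_ge0 b0 k0).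
have p2 : 0 <= a * kap' * J by rewrite mulr_ge0 // (mulr_ge0 a0 k0').
rewrite -/J; lra.
Qed.

End energy_step.

Lemma cvg_sumr (R : realType) (T : Type) (F : set_system T) (FF : Filter F) (I : finType)
    (P : pred I) (f : I -> T -> R) (l : I -> R) :
  (forall i, P i -> f i t @[t --> F] --> l i) ->
  \sum_(i | P i) f i t @[t --> F] --> \sum_(i | P i) l i.
Proof. by move=> H; apply: cvg_big => //; exact: add_continuous. Qed.

Lemma powRN_ex (R : realType) (a p : R) : 0 < a -> 0 < p ->
  exists2 x : R, 0 < x & x `^ (- p) = a.
Proof. by move=> a0 p0; exists (a `^ (- p^-1)); [exact: powR_gt0 | exact: powRN_invK]. Qed.

Section no_blowup.
Context (R : realType) (A B alpha beta : R) (N d : nat).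
Hypotheses (A0 : 0 < A) (B0 : 0 < B) (beta0 : 0 < beta) (ab : beta < alpha).

Local Notation f := (@force R A B alpha beta d).
Local Notation LJr := (LJr A B alpha beta).

Let alpha0 : 0 < alpha. Proof. exact: lt_trans beta0 ab. Qed.

(** Below the distance [r1] half of the repulsion absorbs the attraction; beyond it the attraction
    is at most its value at [r1]. *)
Lemma LJr_ge : exists2 b : R, 0 <= b & forall r : R, 0 < r -> A / 2 * r `^ (- alpha) - b <= LJr r.
Proof.
pose q := 2 * B / A; have q0 : 0 < q by rewrite divr_gt0 // mulr_gt0.
pose r1 := q `^ (- (alpha - beta)^-1).
have r10 : 0 < r1 by rewrite powR_gt0.
exists (B * r1 `^ (- beta)); first by rewrite mulr_ge0 ?powR_ge0 // ltW.
move=> r r0; rewrite /LJr; have [rr|rr] := leP r r1.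
  have : q <= r `^ (- (alpha - beta)).
    by rewrite -[leLHS](@powRN_invK _ _ (alpha - beta)) ?subr_gt0// powRN_le // ?subr_ge0 ltW.
  rewrite /q ler_pdivrMr // => h.
  have -> : r `^ (- alpha) = r `^ (- (alpha - beta)) * r `^ (- beta).
    by rewrite -powRD ?(gt_eqF r0) ?implybT//; congr powR; ring.
  have p1 : 0 <= B * r1 `^ (- beta) by rewrite mulr_ge0 ?powR_ge0 // ltW.
  have := ler_wpM2r (powR_ge0 r (- beta)) h; lra.
have h : B * r `^ (- beta) <= B * r1 `^ (- beta).
  by rewrite ler_wpM2l ?(ltW B0)// powRN_le // ltW.
have : 0 <= A * r `^ (- alpha) by rewrite mulr_ge0 ?powR_ge0 // ltW.
lra.
Qed.

Lemma LJr_le (r : R) : LJr r <= A * r `^ (- alpha).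
Proof. by rewrite /LJr lerBlDr lerDl mulr_ge0 ?powR_ge0 // ltW. Qed.

Lemma continuous_LJr (r : R) : 0 < r -> {for r, continuous LJr}.
Proof.
move=> r0; apply: differentiable_continuous; apply/derivable1_diffP.
apply: derivableB; apply: derivableM => //.
  by have [] := is_derive1_powR (- alpha) r0.
by have [] := is_derive1_powR (- beta) r0.
Qed.

Section energy_bounds.
Variables (v : 'rV[R]_d -> R) (b : R).
Hypothesis v_ge : forall z, - b <= v z.
Hypothesis vN : forall z, v (- z) = v z.

(** Every other pair contributes at least [- b], so a bound on the energy bounds each pair
    separately, and hence its distance from below. *)
Lemma energy_ge_pair (x : 'I_N -> 'rV[R]_d) i j : i != j -> 0 <= b ->
  v (x i - x j) - N%:R ^+ 2 * b <= energy v x.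
Proof.
move=> ij b0; rewrite /energy.
have h : \sum_(i : 'I_N) \sum_(j | j != i) (- b) >= - (N%:R ^+ 2 * b).
  have -> : - (N%:R ^+ 2 * b) = \sum_(i : 'I_N) \sum_(j : 'I_N) (- b).
    by rewrite !sumr_const card_ord -mulrnA -[RHS]mulr_natl natrM mulrN expr2.
  apply: ler_sum => k _; rewrite [leRHS]big_mkcond /=; apply: ler_sum => l _.
  by case: ifP => // _; rewrite oppr_le0.
have : \sum_(i : 'I_N) \sum_(j | j != i) (v (x i - x j) - - b) >= 2 * (v (x i - x j) + b).
  rewrite pair_big_dep /=.
  have := @sum_ge2 R _ (fun p : 'I_N * 'I_N => p.2 != p.1)
      (fun p => v (x p.1 - x p.2) - - b) (i, j) (j, i).
  rewrite /= ij eq_sym ij => /(_ isT isT) h'.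
  apply: le_trans (h' _ _).
  - by rewrite -[x j - x i]opprB vN; lra.
  - by apply: contra ij => /eqP[->].
  - by move=> p _; have := v_ge (x p.1 - x p.2); lra.
under eq_bigr do rewrite sumrB; rewrite sumrB.
have : 0 <= N%:R ^+ 2 * b by rewrite mulr_ge0 // exprn_ge0.
lra.
Qed.

Lemma energy_le (x : 'I_N -> 'rV[R]_d) (m : R) : 0 <= m ->
  (forall i j, i != j -> v (x i - x j) <= m) -> energy v x <= N%:R ^+ 2 * m / 2.
Proof.
move=> m0 vm; rewrite /energy mulrC ler_pM2r // expr2 -mulrA -[X in X%:R * _]card_ord.
apply: ler_sum_const; first by rewrite mulr_ge0.
move=> i _; rewrite -[X in X%:R * _]card_ord; apply: ler_sum_const => // j ji.
by rewrite vm // eq_sym.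
Qed.

End energy_bounds.

(** The truncation at [e] makes the energy continuous along every continuous path, even through
    collisions that are not excluded yet; the crossing argument needs this. *)
Lemma continuous_energy (e : R) (X : 'I_N -> R -> 'rV[R]_d) : 0 < e ->
  (forall i k, continuous (fun t => X i t ord0 k)) ->
  continuous (fun t => energy (fun z => LJr (Num.max (enorm z) e)) (X^~ t)).
Proof.
move=> e0 cX t; rewrite /energy; apply: cvgMl_tmp.
apply: cvg_sumr => i _; apply: cvg_sumr => j _.
apply: (continuous_comp (f := fun t => Num.max (enorm (X i t - X j t)) e) (g := LJr)); last first.
  by apply: continuous_LJr; rewrite lt_max e0 orbT.
apply: continuous_max; last exact: cvg_cst.
rewrite /enorm; apply: (continuous_comp (g := Num.sqrt)); last exact: sqrt_continuous.
apply: cvg_sumr => k _.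
have -> : (fun u => (X i u - X j u) ord0 k ^+ 2) =
    (fun u => (X i u ord0 k - X j u ord0 k) * (X i u ord0 k - X j u ord0 k)).
  by apply/funext => u; rewrite !mxE expr2.
rewrite !mxE expr2.
by apply: cvgM; apply: cvgB; exact: cX.
Qed.

End no_blowup.

(* If the energy goes from [M = r^(-alpha)] to [2 M], go back from the latter time by at most
   [kap r^(alpha + 2)]: over that time the drift dissipates an energy of order [kap M], whereas
   the noise, moving by at most [kap1 r], contributes at most a small multiple of [M]. *)
Lemma no_blowup (R : realType) (A B alpha beta : R) (N d : nat) (nu G : R) :
 0 < A -> 0 < B -> 0 < beta -> beta < alpha ->
 (0 < N)%N -> 0 < nu <= 1 -> 0 <= G ->
 exists kap kap1 th K rbar : R,
 [/\ 0 < kap /\ 0 < kap1, 0 < th, 0 < K, 0 < rbar & forall r : R, 0 < r -> r <= rbar -> th * r <= 1 /\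
  forall (T : R) (X h w : 'I_N -> R -> 'rV[R]_d),
  (forall i k, continuous (fun t => X i t ord0 k)) ->
  (forall i j, i != j -> K * r <= enorm (X i 0 - X j 0)) ->
  (forall i k (s t : R), 0 <= s -> s <= t -> t <= T -> t - s <= kap * r `^ (alpha + 2) ->
     `|w i t ord0 k - w i s ord0 k| <= kap1 * r) ->
  (forall i k (s t a b : R), 0 <= s -> s <= t -> t <= T ->
     (forall u, s <= u <= t -> `|h i u ord0 k - a| <= b) ->
     `|X i t ord0 k - X i s ord0 k - (t - s) * a - (w i t ord0 k - w i s ord0 k)| <= (t - s) * b) ->
  (forall i k (s : R), 0 <= s -> s <= T ->
     (forall i j, i != j -> th * r <= enorm (X i s - X j s)) ->
     `|h i s ord0 k - nu * total_force (@force R A B alpha beta d) (X^~ s) i ord0 k| <= G) ->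
  forall t : R, 0 <= t -> t <= T -> forall i j, i != j -> th * r <= enorm (X i t - X j t)].
Proof.
move=> A0 B0 beta0 ab N0 /andP[nu0 nu1] G0.
have alpha0 : 0 < alpha by exact: lt_trans beta0 ab.
set f := @force R A B alpha beta d.
pose n : R := N%:R; have n0 : 0 < n by rewrite ltr0n.
pose D : R := d%:R; have D0 : 0 <= D by exact: ler0n.
have [b1 b10 LJge] := LJr_ge A0 B0 beta0 ab.
(* While the energy is at most [2 M], each pair satisfies [A / 2 * rho^(-alpha) <= 3 M], hence
   [rho >= theta * r]. Halving [theta] to [th] leaves a margin in which the truncation at [th * r]
   is inactive. *)
have [theta theta0 thetaE] : exists2 x : R, 0 < x & x `^ (- alpha) = 6 / A.
  by apply: powRN_ex => //; rewrite divr_gt0.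
pose th := theta / 2; have th0 : 0 < th by rewrite divr_gt0.
have nA0 : 0 < n ^+ 2 * A + 1 by rewrite ltr_wpDl // mulr_ge0 ?exprn_ge0 // ltW.
(* If all pairs are at distance at least [K * r], the energy is below [M]. Energy at least [M]
   therefore provides the close pair that [virial] asks for. *)
have [K K0 KE] : exists2 x : R, 0 < x & x `^ (- alpha) = (n ^+ 2 * A + 1)^-1.
  by apply: powRN_ex => //; rewrite invr_gt0.
have [c [r1 [c0 r10 vir]]] := @virial R A B alpha beta N d A0 B0 beta0 ab theta K theta0 K0.
have CL0 := force_cst_gt0 A0 B0 beta0 ab.
(* Bounds at distances at least [th * r] both the force, in units of [P], and its Lipschitz
   constant, in units of [P / r]. *)
have [Cf Cf0 CfE] : exists2 x : R, 0 < x &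
    x = force_cst A B alpha beta * (th `^ (- alpha - 1) + th `^ (- alpha - 2)).
  by eexists; last reflexivity; rewrite mulr_gt0 // addr_gt0 // powR_gt0.
have [C7 C70 C7E] : exists2 x : R, 0 <= x & x = step_cst N Cf.
  eexists; last reflexivity.
  have nC : 0 <= N%:R * Cf by rewrite mulr_ge0 ?(ltW Cf0).
  rewrite /step_cst addr_ge0 //; last by rewrite mulr_ge0 ?exprn_ge0 ?(ltW Cf0).
  by rewrite mulr_ge0 ?exprn_ge0 ?addr_ge0// mulr_ge0 ?(ltW Cf0)// mulr_ge0 // exprn_ge0.
have [q0 q00 q0E] : exists2 x : R, 0 < x & x = n * Cf + 2.
  by eexists; last reflexivity; rewrite addr_gt0 // mulr_gt0.
have [C8 C80 C8E] : exists2 x : R, 0 < x & x = 1 + 2 * n * Cf * D * q0.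
  by eexists; last reflexivity; rewrite ltr_pwDl // !mulr_ge0 ?(ltW n0) ?(ltW Cf0) ?(ltW q00).
have [c2 c20 c2E] : exists2 x : R, 0 < x & x = nu * c ^+ 2 / n.
  by eexists; last reflexivity; rewrite divr_gt0 // mulr_gt0 // exprn_gt0.
have DC8 : 0 <= D * C8 by rewrite mulr_ge0 // ltW.
have C7D : 0 <= C7 * (1 + D * C8) by rewrite mulr_ge0 // addr_ge0.
pose kap := Num.min (D * C8 + 1)^-1 (c2 / (2 * (C7 * (1 + D * C8) + 1))).
have kap0 : 0 < kap.
  by rewrite lt_min invr_gt0 divr_gt0 ?ltr_wpDl// mulr_gt0 // ltr_wpDl.
have kapA : kap * (D * C8 + 1) <= 1.
  by rewrite -ler_pdivlMr ?ltr_wpDl// div1r ge_min lexx.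
have kapB : C7 * (1 + D * C8) * kap <= c2 / 2.
  have : kap * (2 * (C7 * (1 + D * C8) + 1)) <= c2.
    by rewrite -ler_pdivlMr ?mulr_gt0 ?ltr_wpDl// ge_min lexx orbT.
  by move: kap0; lra.
have kap1 : kap <= 1.
  by apply: le_trans kapA; rewrite ler_peMr ?(ltW kap0)// lerDr.
have C7D1 : 0 < C7 * D + 1 by rewrite ltr_wpDl // mulr_ge0.
clearbody kap.
(* Besides keeping the noise below [kap * r], these bounds make its work at most [M / 2], and at
   most half of the energy [c2 kap M / 2] dissipated over a full window. *)
pose kk := Num.min (kap / (D + 1)) (Num.min (2 * (C7 * D + 1))^-1 (c2 * kap / (4 * (C7 * D + 1)))).
have D1 : 0 < D + 1 by rewrite ltr_wpDl.
have kk0 : 0 < kk.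
  by rewrite !lt_min !divr_gt0 // ?mulr_gt0// invr_gt0 mulr_gt0.
have kkA : kk * (D + 1) <= kap by rewrite -ler_pdivlMr // ge_min lexx.
have kkB : kk * (2 * (C7 * D + 1)) <= 1.
  by rewrite -ler_pdivlMr ?mulr_gt0// div1r !ge_min lexx orbT.
have kkC : kk * (4 * (C7 * D + 1)) <= c2 * kap.
  by rewrite -ler_pdivlMr ?mulr_gt0// !ge_min lexx !orbT.
clearbody kk.
have kkD : 0 <= kk * D by rewrite mulr_ge0 // ltW.
pose qq := (n ^+ 2 + 1) * b1 + 1.
have qq0 : 0 < qq by rewrite ltr_wpDl // mulr_ge0 // addr_ge0 // exprn_ge0 // ltW.
(* In order: powers of [r] can be compared, [virial] applies, [th * r <= 1], the bounded part [G] of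
   the drift is at most [kap * P], and [M] dominates the constants left by the attraction. *)
pose rbar := Num.min (Num.min 1 r1) (Num.min (Num.min th^-1 (kap / (G + 1))) (qq `^ (- alpha^-1))).
have G1 : 0 < G + 1 by rewrite ltr_wpDl.
exists kap, kk, th, K, rbar; split => //.
  by rewrite !lt_min ltr01 r10 invr_gt0 th0 divr_gt0 // powR_gt0.
move=> r r0 rr; have : [/\ r <= 1, r <= r1, r <= th^-1, r <= kap / (G + 1) & r <= qq `^ (- alpha^-1)].
  by move: rr; rewrite !le_min => /andP[/andP[-> ->] /andP[/andP[-> ->] ->]].
move=> [rle1 rler1 rth rG rq].
have e1 : th * r <= 1 by rewrite -ler_pdivlMl // mulr1.
have e0 : 0 < th * r by rewrite mulr_gt0.
have e01 : 0 < th * r <= 1 by rewrite e0.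
split=> // T X h w cX X0 wosc inc drift.
(* [P] is the scale of the forces and [M] that of the energies; [r / P = r^(alpha+2)] is the time in
   which a force [P] moves a particle by [r]. *)
pose P := r `^ (- alpha - 1); have P0 : 0 < P by rewrite powR_gt0.
pose M := P * r.
have ME : M = r `^ (- alpha) by rewrite /M mulrC mul_powR.
have M0 : 0 < M by rewrite mulr_gt0.
have Pr : P / r = r `^ (- alpha - 2).
  apply: (mulfI (lt0r_neq0 r0)); rewrite mulrCA divff ?gt_eqF// mulr1 /P.
  rewrite (_ : - alpha - 2 = - (alpha + 1) - 1); last by ring.
  by rewrite mul_powR //; congr powR; ring.
have delE : kap * r `^ (alpha + 2) = kap * (r / P).
  rewrite /P -powRN; congr (_ * _); rewrite -[X in X * _]powRr1 ?(ltW r0)//.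
  rewrite -powRD ?(gt_eqF r0) ?implybT//; congr powR; ring.
have GP : G <= kap * P.
  have h1 : r^-1 <= P.
    rewrite /P -powR_inv1 ?(ltW r0)//; have -> : - alpha - 1 = - (alpha + 1) by ring.
    by apply: powRN_expo_le => //; rewrite lerDr ltW.
  have h2 : G + 1 <= kap * r^-1.
    by rewrite ler_pdivlMr // mulrC -ler_pdivlMr.
  have := ler_wpM2l (ltW kap0) h1; lra.
have Mq : qq <= M.
  by rewrite ME -[leLHS](@powRN_invK _ _ alpha) // powRN_le // ltW.
have MPr : M = P * r by [].
have PE : P = r `^ (- alpha - 1) by [].
clearbody M P.
pose v (z : 'rV[R]_d) := LJr A B alpha beta (Num.max (enorm z) (th * r)).
have mx0 (z : 'rV[R]_d) : 0 < Num.max (enorm z) (th * r) by rewrite lt_max e0 orbT.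
have v_ge z : - b1 <= v z.
  have := LJge _ (mx0 z); have : 0 <= A / 2 * Num.max (enorm z) (th * r) `^ (- alpha).
    by rewrite mulr_ge0 ?powR_ge0// divr_ge0 // ltW.
  rewrite /v; lra.
have vN z : v (- z) = v z by rewrite /v enormN.
have region (x : 'I_N -> 'rV[R]_d) : energy v x <= 2 * M ->
    forall i j, i != j -> theta * r <= enorm (x i - x j).
  move=> xM i j ij; have h1 := energy_ge_pair v_ge vN x ij b10.
  have h2 := LJge _ (mx0 (x i - x j)); rewrite -/(v _) in h2.
  set rho := Num.max _ _ in h2.
  have h3 : rho `^ (- alpha) <= 6 / A * r `^ (- alpha).
    rewrite -ME mulrAC ler_pdivlMr //; move: Mq h1 h2 xM; rewrite /qq -/n; lra.
  have h4 : theta * r <= rho.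
    apply: (@powRN_leP _ alpha) => //; first exact: mx0.
      by rewrite mulr_gt0.
    by rewrite powRM ?(ltW theta0) ?(ltW r0)// thetaE.
  move: h4; rewrite le_max => /orP[//|]; rewrite /th; have := mulr_gt0 theta0 r0; lra.
have close (x : 'I_N -> 'rV[R]_d) :
    (forall i j, i != j -> K * r <= enorm (x i - x j)) -> energy v x < M.
  move=> xK; have KM : 0 <= A * ((n ^+ 2 * A + 1)^-1 * M).
    by rewrite mulr_ge0 ?(ltW A0)// mulr_ge0 ?invr_ge0 ?(ltW nA0) ?(ltW M0).
  apply: le_lt_trans (energy_le KM _) _.
    move=> i j ij; rewrite (le_trans (@LJr_le R A B alpha beta B0 _)) // ler_wpM2l ?(ltW A0)//.
    have -> : (n ^+ 2 * A + 1)^-1 * M = (K * r) `^ (- alpha).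
      by rewrite powRM ?(ltW K0) ?(ltW r0)// KE ME.
    by rewrite powRN_le ?mulr_gt0 ?(ltW alpha0)// le_max xK.
  rewrite -/n (_ : _ / 2 = n ^+ 2 * A / (n ^+ 2 * A + 1) * (M / 2)); last by ring.
  have : n ^+ 2 * A / (n ^+ 2 * A + 1) <= 1 by rewrite ler_pdivrMr // mul1r lerDl.
  move=> h1; have M20 : 0 <= M / 2 by rewrite divr_ge0 // ltW.
  by move: (ler_wpM2r M20 h1) M0; clear; lra.
pose Psi t := energy v (X^~ t).
have cPsi : continuous Psi by apply: continuous_energy.
suff main t : 0 <= t -> t <= T -> Psi t < 2 * M.
  move=> t t0 tT i j ij; apply: le_trans (region _ (ltW (main _ t0 tT)) _ _ ij).
  by rewrite /th mulrAC ler_pdivrMr // ler_peMr ?mulr_ge0 ?(ltW theta0) ?(ltW r0)// ler1n.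
move=> t0 tT; rewrite ltNge; apply/negP => tM.
have [s0 [t1 [s00 s0t1 t1t fs0 [ft1 bet]]]] := last_crossing cPsi t0 (close _ X0) tM M0.
have t1T := le_trans t1t tT.
have krP : 0 <= kap * (r / P) by rewrite mulr_ge0 ?divr_ge0 ?(ltW kap0) ?(ltW r0) ?(ltW P0).
(* The window ending at [t1] is cut at [s0] when it would start earlier; in both cases the energy
   stays between [M] and [2 M] on it. *)
have [s [s0s st1 t1s scase]] : exists s, [/\ s0 <= s, s <= t1, t1 - s <= kap * (r / P) &
    s = s0 \/ s = t1 - kap * (r / P)].
  have [h1|/ltW h1] := leP (t1 - kap * (r / P)) s0.
    by exists s0; split => //; [rewrite lerBlDr addrC -lerBlDr|left].
  exists (t1 - kap * (r / P)); split => //; last by right.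
    by rewrite lerBlDr lerDl.
  by rewrite opprB addrC subrK.
have s_ge0 := le_trans s00 s0s.
have reg u : s <= u <= t1 -> forall i j, i != j -> theta * r <= enorm (X i u - X j u).
  move=> /andP[su ut]; apply: (region (X^~ u)).
  by have /andP[] : M <= Psi u <= 2 * M by apply: bet; rewrite ut (le_trans s0s su).
have thr z : theta * r <= z -> th * r <= z.
  move=> h1; apply: le_trans h1.
  by rewrite /th mulrAC ler_pdivrMr // ler_peMr ?mulr_ge0 ?(ltW theta0) ?(ltW r0)// ler1n.
have PE2 : force_cst A B alpha beta * (th * r) `^ (- alpha - 2) <= Cf * (P / r).
  rewrite CfE powRM ?(ltW th0) ?(ltW r0)// -Pr mulrA ler_wpM2r ?divr_ge0 ?(ltW P0) ?(ltW r0)//.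
  by rewrite ler_wpM2l ?(ltW CL0)// lerDr powR_ge0.
have PE1 : force_cst A B alpha beta * (th * r) `^ (- alpha - 1) <= Cf * P.
  rewrite CfE powRM ?(ltW th0) ?(ltW r0)// -PE mulrA ler_wpM2r ?(ltW P0)//.
  by rewrite ler_wpM2l ?(ltW CL0)// lerDl powR_ge0.
have fE u i j : s <= u <= t1 -> f (X i u - X j u) = trunc_force A B alpha beta (th * r) (X i u - X j u).
  move=> su; have [->|ij] := eqVneq i j.
    by rewrite subrr /f force0 /trunc_force scaler0.
  by rewrite trunc_force_eq // thr // reg.
have fb u i j : s <= u <= t1 -> enorm (f (X i u - X j u)) <= Cf * P.
  move=> su; rewrite fE // (le_trans (enorm_trunc_force A0 B0 beta0 ab _ e01))//.
have Fb u i : s <= u <= t1 -> enorm (total_force f (X^~ u) i) <= n * (Cf * P).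
  move=> su; rewrite (le_trans (enorm_sum _ _)) // /n -[X in X%:R * _]card_ord.
  by apply: ler_sum_const => [|j _]; [rewrite mulr_ge0 ?ltW | exact: fb].
have uT u : s <= u <= t1 -> 0 <= u /\ u <= T.
  by move=> /andP[su ut]; split; [exact: le_trans su | exact: le_trans t1T].
have drift' u i k : s <= u <= t1 ->
    `|h i u ord0 k - nu * total_force f (X^~ u) i ord0 k| <= kap * P.
  move=> su; apply: le_trans GP; have [u0 uT'] := uT _ su; apply: drift => // i' j' ij.
  by apply: thr; exact: reg.
have osc u i k : s <= u <= t1 -> `|w i u ord0 k - w i s ord0 k| <= kk * r.
  move=> /andP[su ut]; apply: wosc => //; first exact: le_trans t1T.
  by rewrite delE (le_trans _ t1s) // lerB.
have kkr : kk * r <= kap * r.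
  by rewrite ler_wpM2r ?(ltW r0)// (le_trans _ kkA) // ler_peMr ?(ltW kk0)// lerDr.
have hP (x : R) : x <= kap * (r / P) -> x * P <= kap * r.
  by move=> hx; rewrite -ler_pdivlMr // -mulrA.
have move_coord u i k : s <= u <= t1 -> `|X i u ord0 k - X i s ord0 k| <= kap * r * q0.
  move=> /andP[su ut].
  have h2 : `|X i u ord0 k - X i s ord0 k - (w i u ord0 k - w i s ord0 k)| <= (u - s) * ((n * Cf + 1) * P).
    have := @inc i k s u 0 ((n * Cf + 1) * P) s_ge0 su (le_trans ut t1T).
    rewrite mulr0 subr0; apply => x /andP[sx xu]; have sx1 : s <= x <= t1 by rewrite sx (le_trans xu).
    rewrite subr0 -[h i x ord0 k](subrK (nu * total_force f (X^~ x) i ord0 k)).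
    rewrite (le_trans (ler_normD _ _)) // [leRHS]mulrDl mul1r addrC lerD //.
      rewrite normrM gtr0_norm // (le_trans _ (_ : 1 * `|total_force f (X^~ x) i ord0 k| <= _))//.
        by rewrite ler_wpM2r.
      by rewrite mul1r (le_trans (coord_le_enorm _ _)) // -mulrA Fb.
    by rewrite (le_trans (drift' _ _ _ sx1)) // ler_piMl // ltW.
  have h3 := osc u i k _; rewrite su ut in h3; have {}h3 := h3 isT.
  rewrite -[X i u ord0 k - X i s ord0 k](subrK (w i u ord0 k - w i s ord0 k)).
  rewrite (le_trans (ler_normD _ _)) // q0E (_ : n * Cf + 2 = n * Cf + 1 + 1); last by ring.
  rewrite mulrDr mulr1 lerD //; last exact: le_trans kkr.
  rewrite (le_trans h2) // mulrCA mulrC ler_wpM2r ?addr_ge0 ?mulr_ge0 ?(ltW n0) ?(ltW Cf0)//.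
  apply: hP; exact: le_trans (lerB ut (lexx s)) t1s.
have move_vec u i : s <= u <= t1 -> enorm (X i u - X i s) <= D * (kap * r * q0).
  by move=> su; apply: enorm_le_coord => k; rewrite !mxE move_coord.
have ss : s <= s <= t1 by rewrite lexx.
have tt : s <= t1 <= t1 by rewrite lexx st1.
(* Positions change by a multiple of [kap * r] only, so the total force may be replaced by its value
   at the start of the window, up to a multiple of [kap * P]. *)
have Fdiff u i k : s <= u <= t1 ->
    `|total_force f (X^~ u) i ord0 k - total_force f (X^~ s) i ord0 k| <= 2 * n * Cf * D * q0 * (kap * P).
  move=> su.
  have -> : total_force f (X^~ u) i ord0 k - total_force f (X^~ s) i ord0 k =
     (\sum_j (f (X i u - X j u) - f (X i s - X j s))) ord0 k.
    by rewrite sumrB !mxE.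
  rewrite (le_trans (coord_le_enorm _ _)) // (le_trans (enorm_sum _ _)) //.
  rewrite (_ : _ * (kap * P) = n * (Cf * (P / r) * (2 * (D * (kap * r * q0))))); last first.
    by field; rewrite gt_eqF.
  rewrite /n -[X in X%:R * _]card_ord.
  have p1 : 0 <= 2 * (D * (kap * r * q0)).
    by rewrite mulr_ge0 // mulr_ge0 // mulr_ge0 ?(ltW q00)// mulr_ge0 ?(ltW kap0) ?(ltW r0).
  have p2 : 0 <= Cf * (P / r) by rewrite mulr_ge0 ?(ltW Cf0)// divr_ge0 ?(ltW P0) ?(ltW r0).
  apply: ler_sum_const => [|j _]; first by rewrite mulr_ge0.
  rewrite !fE // (le_trans (trunc_force_lip A0 B0 beta0 ab _ _ e01)) // ler_pM ?enorm_ge0//.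
    by rewrite mulr_ge0 ?powR_ge0// (ltW CL0).
  have -> : X i u - X j u - (X i s - X j s) = (X i u - X i s) - (X j u - X j s).
    by rewrite !opprB addrACA [in RHS]addrACA; congr (_ + _); rewrite addrC.
  by rewrite (le_trans (enormD _ _)) // enormN mulr2n mulrDl mul1r lerD // move_vec.
have incr i : enorm (X i t1 - X i s - ((t1 - s) * nu) *: total_force f (X^~ s) i) <=
    (t1 - s) * (D * C8 * kap) * P + D * kk * r.
  rewrite [leRHS](_ : _ = D * ((t1 - s) * (C8 * (kap * P)) + kk * r)); last by ring.
  apply: enorm_le_coord => k; rewrite !mxE.
  have h1 : `|X i t1 ord0 k - X i s ord0 k - (t1 - s) * (nu * total_force f (X^~ s) i ord0 k)
     - (w i t1 ord0 k - w i s ord0 k)| <= (t1 - s) * (C8 * (kap * P)).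
    apply: inc => // u su; rewrite -[h i u ord0 k](subrK (nu * total_force f (X^~ u) i ord0 k)).
    rewrite -addrA -mulrBr (le_trans (ler_normD _ _)) // C8E [leRHS]mulrDl mul1r lerD //.
      exact: drift'.
    by rewrite normrM gtr0_norm // (le_trans _ (Fdiff u i k su)) // ler_piMl.
  rewrite -[X in `|X|](subrK (w i t1 ord0 k - w i s ord0 k)) (le_trans (ler_normD _ _)) //.
  by rewrite lerD // ?osc// -mulrA.
have := @energy_step R N d f v (@forceN _ _ _ _ _ _) (@force0 _ _ _ _ _ _) r P Cf c nu kap
   (D * C8 * kap) (t1 - s) (D * kk * r) (X^~ s) (X^~ t1) r0 P0 (ltW Cf0) (ltW c0).
rewrite nu0 nu1 kap1 (ltW kap0) => /(_ isT isT).
have -> : 0 <= D * C8 * kap <= 1.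
  by rewrite mulr_ge0 ?(ltW kap0)//=; move: kapA kap0; clear; lra.
move=> /(_ isT); rewrite subr_ge0 => /(_ st1 (hP _ t1s)).
have eta0 : 0 <= D * kk * r by rewrite mulr_ge0 ?(ltW r0)// mulrC.
have etak : D * kk * r <= kap * r.
  by rewrite ler_wpM2r ?(ltW r0)//; move: kkA kk0; clear; lra.
move=> /(_ eta0 etak (fun i j => fb _ i j ss)).
have tay i j : i != j -> v (X i t1 - X j t1) - v (X i s - X j s) <=
   - dot (f (X i s - X j s)) (X i t1 - X j t1 - (X i s - X j s)) +
   Cf * (P / r) * enorm (X i t1 - X j t1 - (X i s - X j s)) ^+ 2.
  move=> ij; rewrite /v !max_l; last 2 first.
    by apply: thr; apply: reg.
    by apply: thr; apply: reg.
  have := @force_taylor R A B alpha beta A0 B0 beta0 ab d (th * r) (X i s - X j s) (X i t1 - X j t1) e01.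
  move=> /(_ (thr _ (reg _ ss _ _ ij)) (thr _ (reg _ tt _ _ ij))).
  rewrite ler_norml => /andP[_ h1].
  by rewrite [leRHS]addrC lerBrDr (le_trans h1) // ler_wpM2r ?sqr_ge0.
have low : c * P <= \sum_i enorm (total_force f (X^~ s) i).
  rewrite PE; apply: vir => //; first exact: reg.
  apply: contrapT => /forallNP H.
  have : energy v (X^~ s) < M.
    apply: close => i j ij; rewrite leNgt; apply/negP => h1.
    by apply: (H i); exists j; split => //; exact: ltW.
  have /andP[h1 _] : M <= Psi s <= 2 * M by apply: bet; rewrite s0s st1.
  by rewrite ltNge h1.
move=> /(_ tay incr low); rewrite -/(Psi t1) -/(Psi s) -c2E -C7E ft1.
set J := (t1 - s) * P ^+ 2.
have J0 : 0 <= J by rewrite mulr_ge0 ?subr_ge0// exprn_ge0 // ltW.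
have -> : C7 * (P * (D * kk * r)) = C7 * D * kk * M by rewrite MPr; ring.
have -> : C7 * (kap + D * C8 * kap) = C7 * (1 + D * C8) * kap by ring.
have sPsi : s = s0 -> Psi s <= M by move=> ->.
have /andP[_ sPsi2] : M <= Psi s <= 2 * M by apply: bet; rewrite s0s st1.
move: (Psi s) sPsi sPsi2 => Psis sPsi sPsi2 step.
have step2 : 2 * M - Psis <= - (c2 / 2) * J + C7 * D * kk * M.
  by move: (ler_wpM2r J0 kapB) step; clear; lra.
(* Cut window: the energy has to rise by [M], while the noise supplies at most [M / 2]. Full window:
   the energy is largest at [t1], yet the dissipation exceeds the work of the noise. *)
case: scase => sE.
  have h1 : C7 * D * kk * M <= 2^-1 * M.
    by rewrite ler_wpM2r ?(ltW M0)//; move: kkB kk0; clear; lra.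
  have h2 : 0 <= c2 / 2 * J by rewrite mulr_ge0 // divr_ge0 // ltW.
  by move: h1 h2 step2 (sPsi sE) M0; clear; lra.
have JE : J = kap * M by rewrite /J sE MPr; field; rewrite gt_eqF.
have h1 : C7 * D * kk * M <= c2 * kap / 4 * M.
  by rewrite ler_wpM2r ?(ltW M0)//; move: kkC kk0; clear; lra.
have h2 : 0 < c2 * kap / 4 * M by rewrite mulr_gt0 // divr_gt0 // mulr_gt0.
by move: h1 h2 step2 sPsi2; rewrite JE; clear; lra.
Qed.

(** * Integration and measurability *)

Section bounded_integrals.
Context d (T : measurableType d) (R : realType) (mu : {measure set T -> \bar R}).
Implicit Types (D : set T) (f : T -> R) (M : R).

Lemma integrable_bounded D f M : measurable D -> (mu D < +oo)%E ->
  measurable_fun D f -> (forall x, D x -> `|f x| <= M) -> mu.-integrable D (EFin \o f).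
Proof.
move=> mD Doo mf fM; apply: measurable_bounded_integrable => //.
exists M; split; first exact: num_real.
by move=> y My x Dx /=; rewrite (le_trans (fM _ Dx)) // ltW.
Qed.

Lemma Rintegral_le_bound D f M : measurable D -> (mu D < +oo)%E ->
  measurable_fun D f -> (forall x, D x -> `|f x| <= M) ->
  `|\int[mu]_(x in D) f x| <= M * fine (mu D).
Proof.
move=> mD Doo mf fM; have fi := integrable_bounded mD Doo mf fM.
rewrite (le_trans (le_normr_Rintegral mD fi)) // -Rintegral_cst //.
apply: le_Rintegral => //.
- exact: integrable_norm fi.
- apply: (@integrable_bounded D (cst M) `|M|) => //.
Qed.

End bounded_integrals.

Section interval_integrals.
Context (R : realType).
Notation mu := (@lebesgue_measure R).
Implicit Types (f : R -> R) (s t a b : R).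

Lemma lebesgue_cc s t : s <= t -> mu `[s, t] = (t - s)%:E.
Proof.
rewrite le_eqVlt => /predU1P[->|st]; first by rewrite set_itv1 lebesgue_measure_set1 subrr.
by rewrite lebesgue_measure_itv /= lte_fin st EFinB.
Qed.

Lemma lebesgue_oc s t : s <= t -> mu `]s, t] = (t - s)%:E.
Proof.
move=> st; rewrite lebesgue_measure_itv /= lte_fin; case: ltP => [_|ts]; first by rewrite EFinB.
by rewrite (@le_anti _ _ t s) ?subrr // ts st.
Qed.

Lemma lebesgue_cc_lty s t : (mu `[s, t] < +oo)%E.
Proof. by rewrite lebesgue_measure_itv /=; case: ifP => // _; rewrite -EFinB ltry. Qed.

(** A mean value estimate for integrands without continuity in time. It replaces differentiation
    both in the energy argument and in the field equation. *)
Lemma Rintegral_increment f s t a b : 0 <= s -> s <= t ->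
  mu.-integrable `[0, t] (EFin \o f) ->
  (forall u, s <= u <= t -> `|f u - a| <= b) ->
  `|\int[mu]_(u in `[0, t]) f u - \int[mu]_(u in `[0, s]) f u - (t - s) * a| <= (t - s) * b.
Proof.
move=> s0 st fi fab.
rewrite (Rintegral_itvB (x := s)) ?bnd_simp//.
have fi' : mu.-integrable `]s, t] (EFin \o f).
  apply: integrableS fi => //; apply: subset_itvr; by rewrite bnd_simp.
have stoo : (mu `]s, t] < +oo)%E.
  by rewrite lebesgue_measure_itv /=; case: ifP => // _; rewrite -EFinB ltry.
have mst : fine (mu `]s, t]) = t - s.
  rewrite lebesgue_measure_itv /= lte_fin; case: ltP => //= ts.
  by apply/esym/eqP; rewrite subr_eq0 eq_le ts.
have ca : mu.-integrable `]s, t] (EFin \o cst a).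
  by apply: (@integrable_bounded _ _ _ mu _ (cst a) `|a|).
have -> : (t - s) * a = \int[mu]_(u in `]s, t]) (cst a) u.
  by rewrite Rintegral_cst // mst mulrC.
rewrite -RintegralB // mulrC -mst; apply: Rintegral_le_bound => //.
  apply: measurable_funB => //.
  by have /measurable_int/measurable_EFinP := fi'.
by move=> u /=; rewrite in_itv /= => /andP[su ut]; apply: fab; rewrite ut ltW.
Qed.

End interval_integrals.

Section parametric.
Context d1 d2 (T1 : measurableType d1) (T2 : measurableType d2) (R : realType).
Variable m2 : {sigma_finite_measure set T2 -> \bar R}.

(** Tonelli applies to the positive and to the negative part; their difference is measurable as an
    extended real, and so is its image under [fine]. *)
Lemma measurable_Rintegral (f : T1 * T2 -> R) : measurable_fun setT f ->
  measurable_fun setT (fun x => \int[m2]_y f (x, y)).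
Proof.
move=> mf; rewrite /Rintegral.
apply: (measurableT_comp (fine_measurable (R := R) measurableT)).
have mE : measurable_fun setT (EFin \o f) by exact/measurable_EFinP.
rewrite (_ : (fun x => _) = (fun x => fubini_F m2 (EFin \o f)^\+%E x - fubini_F m2 (EFin \o f)^\-%E x)%E); last first.
  apply/funext => x; rewrite /fubini_F integralE.
  by congr (_ - _)%E; apply: eq_integral => y _; rewrite ?funeposE ?funenegE.
apply: emeasurable_funB; apply: measurable_fun_fubini_tonelli_F => //.
- exact: measurable_funepos.
- exact: measurable_funeneg.
Qed.

End parametric.

Section caratheodory.
Context d (T : measurableType d) (R : realType).

(** Rounding [s] down to the grid of mesh [1 / (n + 1)] leaves countably many measurable pieces, and
    continuity in [s] lets the mesh tend to 0. *)
Lemma measurable_caratheodory (f : R -> T -> R) :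
  (forall s, measurable_fun setT (f s)) -> (forall w, continuous (f^~ w)) ->
  measurable_fun setT (fun p : R * T => f p.1 p.2).
Proof.
move=> mf cf.
pose g (n : nat) (s : R) : R := (Num.floor (s * n.+1%:R))%:~R / n.+1%:R.
have gs n s : `|s - g n s| <= n.+1%:R^-1.
  have n0 : (0 : R) < n.+1%:R by rewrite ltr0n.
  have /andP[h1 h2] := floor_itv (s * n.+1%:R).
  rewrite ger0_norm; last by rewrite subr_ge0 /g ler_pdivrMr.
  rewrite lerBlDr /g -[X in _ <= X + _]mul1r -mulrDl ler_pdivlMr // ltW //.
  by rewrite (lt_le_trans h2) // intrD addrC.
have gcvg s : g n s @[n --> \oo] --> s.
  apply/cvgrPdist_lt => e e0; near=> n.
  rewrite (le_lt_trans (gs n s)) //; near: n; exact: near_infty_natSinv_lt (PosNum e0).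
apply: (@measurable_realfun.measurable_fun_cvg _ _ _ _ (fun n (p : R * T) => f (g n p.1) p.2)); last first.
  move=> [s w] _ /=.
  exact: (@cvg_comp _ _ _ (fun n => g n s) (f^~ w) _ _ _ (gcvg s) (cf w s)).
move=> n _ B mB; rewrite setTI.
have n0 : (0 : R) < n.+1%:R by rewrite ltr0n.
pose k (m : nat) : int := odflt 0 (unpickle m).
rewrite (_ : _ @^-1` B = \bigcup_m ([set s | Num.floor (s * n.+1%:R) = k m] `*`
    (f ((k m)%:~R / n.+1%:R) @^-1` B))); last first.
  apply/seteqP; split => [[s w] /= Bsw|[s w] /= [m _ [/= h1 h2]]]; last by rewrite /g h1.
  exists (pickle (Num.floor (s * n.+1%:R))) => //=.
  by rewrite /k pickleK /=; split.
apply: bigcup_measurable => m _; apply: measurableX; last first.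
  by rewrite -[X in measurable X]setTI; exact: mf.
rewrite (_ : [set s | _] = `[((k m)%:~R / n.+1%:R), ((k m + 1)%:~R / n.+1%:R)[%classic) //.
apply/seteqP; split => s /=; rewrite in_itv /= ler_pdivrMr // ltr_pdivlMr //.
  by move=> <-; exact: floor_itv.
exact: floor_def.
Unshelve. all: by end_near. Qed.

End caratheodory.

Section row_vectors.
Context (R : realType).

Lemma cvg_rowP (T : Type) (F : set_system T) {FF : Filter F} n (f : T -> 'rV[R]_n) (l : 'rV[R]_n) :
  (forall k, f t ord0 k @[t --> F] --> l ord0 k) -> f t @[t --> F] --> l.
Proof.
move=> H; apply/cvg_ballP => e e0.
have : \forall t \near F, forall k, ball (l ord0 k) e (f t ord0 k).
  apply: filter_forall => k; by have /cvg_ballP := H k; apply.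
by apply: filterS => t ht; split => // i j; rewrite ord1.
Qed.

Lemma continuous_row_at (T : topologicalType) n (f : T -> 'rV[R]_n) (x : T) :
  (forall k, {for x, continuous (fun t => f t ord0 k)}) -> {for x, continuous f}.
Proof. move=> H; exact: (@cvg_rowP _ _ (nbhs_filter x) _ f (f x) H). Qed.

Lemma measurable_row (d : measure_display) (T : measurableType d) n (f : T -> 'rV[R]_n) k :
  measurable_fun setT f -> measurable_fun setT (fun t => f t ord0 k).
Proof. by move=> mf; exact: (measurableT_comp (measurable_rV_coord k) mf). Qed.

Definition rV_behead n (v : 'rV[R]_n.+1) : 'rV[R]_n := \row_k v ord0 (lift ord0 k).

Lemma measurable_rV_behead n : measurable_fun setT (@rV_behead n).
Proof.
apply: measurable_fun_rVP => k.
rewrite (_ : _ \o _ = rV_coord (lift ord0 k)); first exact: measurable_rV_coord.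
by apply/funext => v; rewrite /rV_coord /= mxE.
Qed.

Lemma rV_cons_eta n (v : 'rV[R]_n.+1) : rV_cons (v ord0 ord0, rV_behead v) = v.
Proof.
apply/rowP => k; have [j|] := unliftP ord0 k => ->; rewrite ?rV_consS ?rV_cons0//.
by rewrite mxE.
Qed.

(** The sigma-algebra is generated by the coordinates and not by the open sets, so the coordinates
    are split off one at a time with the Caratheodory criterion. *)
Lemma continuous_measurable_rV n (f : 'rV[R]_n -> R) : continuous f -> measurable_fun setT f.
Proof.
elim: n f => [f _|n IH f cf].
  rewrite (_ : f = cst (f 0)); first exact: measurable_cst.
  by apply/funext => x /=; congr f; apply/rowP => -[].
have -> : f = (fun p : R * 'rV[R]_n => f (rV_cons p)) \o (fun v : 'rV[R]_n.+1 => (v ord0 ord0, rV_behead v)).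
  by apply/funext => v /=; rewrite rV_cons_eta.
apply: measurableT_comp; last first.
  apply: measurable_fun_pair; first exact: measurable_rV_coord.
  exact: measurable_rV_behead.
rewrite (_ : (fun p => _) = (fun p : R * 'rV[R]_n => (fun s z => f (rV_cons (s, z))) p.1 p.2)); last first.
  by apply/funext => -[].
apply: (@measurable_caratheodory _ _ _ (fun s z => f (rV_cons (s, z)))) => [s|z].
  apply: IH => z; apply: (continuous_comp (f := fun z => rV_cons (s, z))); last exact: cf.
  apply: continuous_row_at => k; have [j|] := unliftP ord0 k => ->.
    rewrite (_ : (fun t => _) = (fun t : 'rV[R]_n => t ord0 j)); first exact: coord_continuous.
    by apply/funext => t; rewrite rV_consS.
  rewrite (_ : (fun t => _) = cst s); first exact: cst_continuous.
  by apply/funext => t; rewrite rV_cons0.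
move=> s; apply: (continuous_comp (f := fun s => rV_cons (s, z))); last exact: cf.
apply: continuous_row_at => k; have [j|] := unliftP ord0 k => ->.
  rewrite (_ : (fun t => _) = cst (z ord0 j)); first exact: cst_continuous.
  by apply/funext => t; rewrite rV_consS.
rewrite (_ : (fun t => _) = id); first by move=> ?; exact: cvg_id.
by apply/funext => t; rewrite rV_cons0.
Qed.

End row_vectors.

(** * Translation estimates for functions of bounded variation on the line *)

Section shifts.
Context (R : realType).
Notation mu := (@lebesgue_measure R).
Implicit Types (p q : R -> R) (a b c l r : R).

Lemma measurable_shift c : measurable_fun setT (fun s : R => s - c).
Proof. by apply: measurable_funB. Qed.

Lemma lebesgue_measure_shift c (A : set R) : measurable A ->
  pushforward mu (fun s : R => s - c : measurableTypeR R) A = mu A.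
Proof.
move=> mA.
pose m : {measure set (measurableTypeR R) -> \bar R} :=
  pushforward mu (fun s : measurableTypeR R => s - c : measurableTypeR R).
pose m' := m (measurable_shift c).
suff H (X : set R) : ocitv X -> mu X = m' X by rewrite (lebesgue_measure_unique H mA).
move=> [[x y] _ <-].
rewrite /m' /m /= /pushforward (_ : _ @^-1` _ = `]x + c, y + c]%classic).
  rewrite !lebesgue_measure_itv /= !lte_fin ltrD2r; case: ifP => // _.
  by rewrite -!EFinB; congr EFin; ring.
by apply/seteqP; split => s /=; rewrite !in_itv /= ltrBrDr lerBlDr.
Qed.

Lemma ge0_integral_shift q c (D : set R) : measurable D -> measurable_fun setT q ->
  (forall s, 0 <= q s) ->
  (\int[mu]_(s in (fun s : R => (s - c)%R) @^-1` D) (q (s - c))%:E = \int[mu]_(s in D) (q s)%:E)%E.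
Proof.
move=> mD mq q0.
have mE : measurable_fun D (EFin \o q) by apply/measurable_EFinP; exact: measurable_funTS.
have H := @ge0_integral_pushforward _ _ (measurableTypeR R) (measurableTypeR R) R _ (measurable_shift c) mu D (EFin \o q) mD mE.
rewrite -[LHS]H; last by move=> y _; rewrite lee_fin.
apply: eq_measure_integral; first exact: measurable_shift.
by move=> mphi A mA _; exact: lebesgue_measure_shift.
Qed.

(** Monotonicity removes the absolute value: what remains is the integral of [q = p + 1] over
    [[l - a, r - a]] minus that over [[l - b, r - b]]. The first interval exceeds the second by a
    piece of length [b - a], on which [0 <= q <= 2]. *)
Lemma monotone_shift_le p l r a b : a <= b -> {homo p : x y / x <= y} -> (forall s, `|p s| <= 1) ->
  (\int[mu]_(s in `[l, r]) `|p (s - a) - p (s - b)|%:E <= (2 * (b - a))%:E)%E.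
Proof.
move=> ab pm p1.
have mp : measurable_fun setT p by exact: nondecreasing_measurable.
pose q s := p s + 1.
have q0 s : 0 <= q s by have := p1 s; rewrite ler_norml /q => /andP[h _]; lra.
have q2 s : q s <= 2 by have := p1 s; rewrite ler_norml /q => /andP[_ h]; lra.
have mq : measurable_fun setT q by apply: measurable_funD.
have mqc c : measurable_fun setT (fun s : R => q (s - c)).
  by apply: (measurableT_comp mq); exact: measurable_shift.
have mabs : measurable_fun setT (fun s : R => `|p (s - a) - p (s - b)|).
  apply: measurableT_comp => //.
  by apply: measurable_funB; apply: (measurableT_comp mp); exact: measurable_shift.
pose I c := (\int[mu]_(s in `[l, r]) (q (s - c))%:E)%E.
have IE c : I c = (\int[mu]_(s in `[(l - c)%R, (r - c)%R]) (q s)%:E)%E.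
  rewrite -(ge0_integral_shift c) // /I (_ : _ @^-1` _ = `[l, r]%classic) //.
  by apply/seteqP; split => s /=; rewrite !in_itv /= lerD2r lerD2r.
have I0 c : (0 <= I c)%E by apply: integral_ge0 => s _; rewrite lee_fin.
have Ifin c : I c \is a fin_num.
  rewrite ge0_fin_numE //.
  apply: (@le_lt_trans _ _ (\int[mu]_(s in `[l, r]) (cst 2%:E s))%E).
    apply: ge0_le_integral => //.
    - by move=> s _; rewrite lee_fin.
    - by apply/measurable_EFinP; apply: measurable_funTS; exact: mqc.
    - by move=> s _; rewrite lee_fin.
  by rewrite integral_cst // lte_mul_pinfty // ?lee_fin // lebesgue_cc_lty.
have key : (I a <= I b + (2 * (b - a))%:E)%E.
  rewrite !IE.
  apply: (@le_trans _ _ (\int[mu]_(s in `[(l - b)%R, (r - b)%R] `|` `](r - b)%R, (r - a)%R]) (q s)%:E)%E).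
    apply: ge0_subset_integral => //; first exact: measurableU.
    - by apply/measurable_EFinP; apply: measurable_funTS; first [exact: mqc | exact: mq].
    - by move=> s _; rewrite lee_fin.
    - move=> s /=; rewrite !in_itv /= => /andP[h1 h2].
      have [h3|h3] := leP s (r - b); [left|right]; last by rewrite h2.
      by rewrite andbT (le_trans _ h1) // lerB.
  rewrite ge0_integral_setU //; last 3 first.
  - by apply/measurable_EFinP; apply: measurable_funTS; first [exact: mqc | exact: mq].
  - by move=> s _; rewrite lee_fin.
  - apply/disj_setPS => s [] /=; rewrite !in_itv /= => /andP[_ h1] /andP[h2 _].
    by move: h1; rewrite leNgt h2.
  apply: leeD2l.
  apply: (@le_trans _ _ (\int[mu]_(s in `](r - b)%R, (r - a)%R]) (cst 2%:E s))%E).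
    apply: ge0_le_integral => //.
    - by move=> s _; rewrite lee_fin.
    - by apply/measurable_EFinP; apply: measurable_funTS; first [exact: mqc | exact: mq].
    - by move=> s _; rewrite lee_fin.
  rewrite integral_cst // [X in (_ * X)%E](@lebesgue_oc _ (r - b) (r - a)) ?lerB//.
  rewrite -EFinM lee_fin; lra.
rewrite -(leeD2rE _ _ (Ifin b)) addeC [leRHS]addeC (le_trans _ key) //.
rewrite /I -ge0_integralD //; last 3 first.
- by move=> s _; rewrite lee_fin.
- by apply/measurable_EFinP; apply: measurable_funTS; first [exact: mqc | exact: mq].
- by apply/measurable_EFinP; apply: measurable_funTS; exact: mabs.
apply: ge0_le_integral => //.
- by move=> s _; rewrite -EFinD lee_fin addr_ge0.
- by apply/measurable_EFinP; apply: measurable_funTS; apply: measurable_funD; [exact: mqc | exact: mabs].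
- by apply/measurable_EFinP; apply: measurable_funTS; first [exact: mqc | exact: mq].
- move=> s _; rewrite -EFinD lee_fin /q ger0_norm; first by lra.
  by rewrite subr_ge0; apply: pm; rewrite lerB.
Qed.

Lemma monotone_shift p l r a b : {homo p : x y / x <= y} -> (forall s, `|p s| <= 1) ->
  (\int[mu]_(s in `[l, r]) `|p (s - a) - p (s - b)|%:E <= (2 * `|a - b|)%:E)%E.
Proof.
move=> pm p1; have [ab|/ltW ba] := leP a b.
  by rewrite distrC ger0_norm ?subr_ge0//; exact: monotone_shift_le.
rewrite ger0_norm ?subr_ge0//; under eq_integral do rewrite distrC.
exact: monotone_shift_le.
Qed.

(* Three monotone functions are enough for the restriction of the kernel to a line: two for its
   even radial factor and one for the direction. *)
Definition dominated_variation (g : R -> R) := exists p1 p2 p3 : R -> R,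
  (forall p, p = p1 \/ p = p2 \/ p = p3 -> {homo p : x y / x <= y} /\ forall s, `|p s| <= 1) /\
  forall s t, `|g s - g t| <= `|p1 s - p1 t| + (`|p2 s - p2 t| + `|p3 s - p3 t|).

(** Each of the three dominating monotone functions contributes [2 * |a - b|]. *)
Lemma dominated_variation_shift g l r a b : dominated_variation g -> measurable_fun setT g ->
  (\int[mu]_(s in `[l, r]) `|g (s - a) - g (s - b)|%:E <= (6 * `|a - b|)%:E)%E.
Proof.
move=> [p1 [p2 [p3 [H gp]]]] mg.
have [m1 b1] := H p1 (or_introl erefl).
have [m2 b2] := H p2 (or_intror (or_introl erefl)).
have [m3 b3] := H p3 (or_intror (or_intror erefl)).
have md (p : R -> R) : measurable_fun setT p ->
    measurable_fun `[l, r] (fun s => `|p (s - a) - p (s - b)|%:E).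
  move=> mp; apply/measurable_EFinP; apply: measurable_funTS; apply: measurableT_comp => //.
  by apply: measurable_funB; apply: (measurableT_comp mp); exact: measurable_shift.
have mm (p : R -> R) : {homo p : x y / x <= y} -> measurable_fun setT p.
  by move=> h; exact: nondecreasing_measurable.
apply: (@le_trans _ _ (\int[mu]_(s in `[l, r]) (`|p1 (s - a) - p1 (s - b)|%:E +
   (`|p2 (s - a) - p2 (s - b)|%:E + `|p3 (s - a) - p3 (s - b)|%:E))))%E.
  apply: ge0_le_integral => //.
  - exact: md.
  - by apply: emeasurable_funD; [|apply: emeasurable_funD]; apply: md; exact: mm.
  - by move=> s _; rewrite -!EFinD lee_fin.
rewrite ge0_integralD //; last 3 first.
- by apply: md; exact: mm.
- by move=> s _; rewrite -EFinD lee_fin addr_ge0.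
- by apply: emeasurable_funD; apply: md; exact: mm.
rewrite ge0_integralD //; last 2 first.
- by apply: md; exact: mm.
- by apply: md; exact: mm.
rewrite (_ : 6 * _ = 2 * `|a - b| + (2 * `|a - b| + 2 * `|a - b|)); last by ring.
by rewrite !EFinD; apply: leeD; [|apply: leeD]; exact: monotone_shift.
Qed.

(* [h] differs by a constant from the sum of the monotone functions [h (max s 0)] and
   [h (max (- s) 0)]. *)
Lemma even_dominated (h : R -> R) : (forall s, h (- s) = h s) -> (forall s, 0 <= h s <= 1) ->
  (forall s t, 0 <= s -> s <= t -> h t <= h s) ->
  exists p1 p2 : R -> R,
  [/\ {homo p1 : x y / x <= y}, {homo p2 : x y / x <= y}, (forall s, `|p1 s| <= 1),
      (forall s, `|p2 s| <= 1) & forall s t, `|h s - h t| <= `|p1 s - p1 t| + `|p2 s - p2 t|].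
Proof.
move=> hN h01 hd.
have hb s : `|h s| <= 1 by have /andP[h0 h1] := h01 s; rewrite ger0_norm.
have hE s : h s = h (Num.max s 0) + h (Num.max (- s) 0) - h 0.
  have [s0|/ltW s0] := leP 0 s.
    by rewrite max_r ?oppr_le0// addrK.
  by rewrite max_l ?oppr_ge0// hN [h 0 + _]addrC addrK.
exists (fun s => - h (Num.max s 0)), (fun s => h (Num.max (- s) 0)); split.
- move=> x y xy /=; rewrite lerN2; apply: hd; first by rewrite le_max lexx orbT.
  by rewrite ge_max !le_max xy lexx orbT.
- move=> x y xy /=; apply: hd; first by rewrite le_max lexx orbT.
  by rewrite ge_max !le_max lerN2 xy lexx orbT.
- by move=> s; rewrite normrN.
- by [].
- move=> s t; rewrite {1}(hE s) {1}(hE t).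
  rewrite [X in `|X|](_ : _ = (h (Num.max s 0) - h (Num.max t 0)) + (h (Num.max (- s) 0) - h (Num.max (- t) 0))); last by ring.
  rewrite (le_trans (ler_normD _ _)) // lerD2r.
  by rewrite -opprD normrN.
Qed.

End shifts.

(** * Slicing integrals along coordinate lines *)

Section slicing.
Local Open Scope ereal_scope.
Context (R : realType).

Definition rV_upd n (z : 'rV[R]_n) (m : 'I_n) (s : R) : 'rV[R]_n :=
  \row_j (if j == m then s else z ord0 j).

Section integral_rV_cons.
Context n (f : 'rV[R]_n.+1 -> \bar R).
Hypotheses (mf : measurable_fun setT f) (f0 : forall z, 0 <= f z).

Let m : {measure set _ -> \bar R} := lebesgue_measure \x @lebesgue_rV R n.

Let mfc : measurable_fun setT (fun p : measurableTypeR R * 'rV[R]_n => f (rV_cons p)).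
Proof. by apply: (measurableT_comp mf); exact: measurable_rV_cons. Qed.

Let integral_rV_consE : \int[@lebesgue_rV R n.+1]_z f z = \int[m]_p f (rV_cons p).
Proof.
have H := @ge0_integral_pushforward _ _ (measurableTypeR R * 'rV[R]_n)%type 'rV[R]_n.+1 R _ (@measurable_rV_cons R n) m setT f measurableT mf (fun y _ => f0 y).
rewrite preimage_setT in H.
rewrite -[RHS]H; apply: eq_measure_integral; first exact: measurable_rV_cons.
by [].
Qed.

Lemma ge0_integral_rV_cons1 : \int[@lebesgue_rV R n.+1]_z f z =
  \int[lebesgue_measure]_s \int[@lebesgue_rV R n]_z f (rV_cons (s, z)).
Proof.
rewrite integral_rV_consE.
exact: (@fubini_tonelli1 _ _ (measurableTypeR R) 'rV[R]_n R lebesgue_measure (@lebesgue_rV R n) _ mfc).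
Qed.

Lemma ge0_integral_rV_cons2 : \int[@lebesgue_rV R n.+1]_z f z =
  \int[@lebesgue_rV R n]_z \int[lebesgue_measure]_s f (rV_cons (s, z)).
Proof.
rewrite integral_rV_consE.
exact: (@fubini_tonelli2 _ _ (measurableTypeR R) 'rV[R]_n R lebesgue_measure (@lebesgue_rV R n) _ mfc).
Qed.

Lemma measurable_integral_rV_cons1 :
  measurable_fun setT (fun s : R => \int[@lebesgue_rV R n]_z f (rV_cons (s, z))).
Proof.
exact: (@measurable_fun_fubini_tonelli_F _ _ (measurableTypeR R) 'rV[R]_n R (@lebesgue_rV R n) _ mfc).
Qed.

Lemma measurable_integral_rV_cons2 :
  measurable_fun setT (fun z => \int[lebesgue_measure]_s f (rV_cons (s, z))).
Proof.
exact: (@measurable_fun_fubini_tonelli_G _ _ (measurableTypeR R) 'rV[R]_n R lebesgue_measure _ mfc).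
Qed.

End integral_rV_cons.

(** Tonelli with the coordinate [m] innermost: that integral is at most [c], and each of the other
    [n - 1] coordinates is confined to a set of measure at most [v]. The induction splits off the
    first coordinate, which is either [m] itself or one of the confined ones. *)
Lemma slice_bound n (f : 'rV[R]_n -> \bar R) (m : 'I_n) (E : 'I_n -> set R) (c v : R) :
  measurable_fun setT f -> (forall z, 0 <= f z) -> (0 <= c)%R -> (0 <= v)%R ->
  (forall j, measurable (E j)) -> (forall j, lebesgue_measure (E j) <= v%:E) ->
  (forall (z : 'rV[R]_n) (j : 'I_n), j != m -> ~ E j (z ord0 j) -> f z = 0) ->
  (forall z, \int[lebesgue_measure]_s f (rV_upd z m s) <= c%:E) ->
  \int[@lebesgue_rV R n]_z f z <= (c * v ^+ n.-1)%:E.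
Proof.
elim: n f m E => [f []//|n IH] f m E mf f0 c0 v0 mE vE fE fc.
have mfc : measurable_fun setT (fun p : R * 'rV[R]_n => f (rV_cons p)).
  by apply: (measurableT_comp mf); exact: measurable_rV_cons.
have [m' mE'|mE'] := unliftP ord0 m; last first.
  rewrite ge0_integral_rV_cons2 //.
  pose Bx := [set z : 'rV[R]_n | forall k, E (lift ord0 k) (z ord0 k)].
  have mB : measurable Bx.
    rewrite (_ : Bx = \bigcap_(k in [set: 'I_n]) (rV_coord k @^-1` E (lift ord0 k))).
      apply: fin_bigcap_measurable => // k _.
      by rewrite -[X in measurable X]setTI; exact: measurable_rV_coord.
    by apply/seteqP; split => [x Bx' k _|x Bx' k]; exact: Bx'.
  apply: (@le_trans _ _ (\int[@lebesgue_rV R n]_z (c%:E * (\1_Bx z)%:E))).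
    apply: ge0_le_integral => //.
    - by move=> z _; apply: integral_ge0.
    - exact: measurable_integral_rV_cons2.
    - by apply: emeasurable_funM; [exact: measurable_cst | apply/measurable_EFinP; apply: measurable_indic].
    - move=> z _; have [zB|zB] := pselect (Bx z).
        rewrite indicE mem_set //= mule1.
        apply: le_trans (fc (rV_cons (0%R, z))); apply: ge0_le_integral => //.
        + exact: (measurable_fun_pair1 z mfc).
        + apply: (measurableT_comp mf); apply: measurable_fun_rVP => k.
          rewrite (_ : _ \o _ = fun s => if k == m then s else rV_cons (0%R, z) ord0 k).
            by case: (k == m).
          by apply/funext => s; rewrite /rV_coord /= mxE.
        + move=> s _; rewrite le_eqVlt; apply/orP; left; apply/eqP; congr f.
          apply/rowP => k; rewrite [RHS]mxE mE'; have [j|] := unliftP ord0 k => ->.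
            by rewrite !rV_consS.
          by rewrite eqxx; exact: rV_cons0.
      rewrite indicE memNset // mule0.
      have /existsNP[k Hk] := zB.
      rewrite integral0_eq // => s _; apply: (fE _ (lift ord0 k)); first by rewrite mE'.
      by rewrite rV_consS.
  rewrite ge0_integralZl_EFin //; last by apply/measurable_EFinP.
  rewrite integral_indic // setIT EFinM lee_wpmul2l ?lee_fin //.
  rewrite [leLHS](_ : _ = \prod_(k < n) lebesgue_measure (E (lift ord0 k))); last first.
    exact: (lebesgue_rV_box (fun k => mE (lift ord0 k))).
  rewrite (_ : (v ^+ n)%:E = \prod_(k < n) v%:E); last first.
    by rewrite prodEFin prodr_const card_ord.
  suff [//] : 0 <= \prod_(k < n) lebesgue_measure (E (lift ord0 k)) /\
      \prod_(k < n) lebesgue_measure (E (lift ord0 k)) <= \prod_(k < n) v%:E.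
  elim/big_rec2 : _ => [|k x y _ [y0 yx]]; first by [].
  by split; [exact: mule_ge0 | exact: lee_pmul].
rewrite ge0_integral_rV_cons1 //.
have n0 : (0 < n)%N by case: n m' {mE' IH f m E mf f0 mE vE fE fc mfc} => [[]|].
apply: (@le_trans _ _ (\int[lebesgue_measure]_s ((c * v ^+ n.-1)%:E * (\1_(E ord0) s)%:E))).
  apply: ge0_le_integral => //.
  - by move=> s _; apply: integral_ge0.
  - exact: measurable_integral_rV_cons1.
  - by apply: emeasurable_funM; [exact: measurable_cst | apply/measurable_EFinP; exact: (measurable_indic (mE ord0))].
  - move=> s _; have [sE|sE] := pselect (E ord0 s); last first.
      rewrite indicE memNset // mule0 integral0_eq // => z _.
      by apply: (fE _ ord0); rewrite ?mE' // rV_cons0.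
    rewrite indicE mem_set //= mule1.
    apply: (IH (fun z => f (rV_cons (s, z))) m' (fun k => E (lift ord0 k))) => //.
    + exact: (measurable_fun_pair2 s mfc).
    + move=> z j jm Ej; apply: (fE _ (lift ord0 j)); last by rewrite rV_consS.
      by rewrite mE' (inj_eq (@lift_inj _ _)).
    + move=> z; apply: le_trans (fc (rV_cons (s, z))).
      rewrite le_eqVlt; apply/orP; left; apply/eqP; apply: eq_integral => u _; congr f.
      apply/rowP => k; rewrite mE'; have [j|] := unliftP ord0 k => ->.
        rewrite [RHS]mxE (inj_eq (@lift_inj _ _)) rV_consS.
        by apply: etrans (rV_consS _ j) _; rewrite mxE.
      rewrite [RHS]mxE rV_cons0; exact: (rV_cons0 (s, rV_upd z m' u)).
rewrite ge0_integralZl_EFin //; last 2 first.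
- apply/measurable_EFinP; exact: (measurable_indic (mE ord0)).
- by rewrite mulr_ge0 // exprn_ge0.
rewrite (integral_indic lebesgue_measure measurableT (mE ord0)) setIT.
rewrite (_ : (c * v ^+ n.+1.-1)%:E = (c * v ^+ n.-1)%:E * v%:E); last first.
  by rewrite -EFinM; congr EFin; rewrite -mulrA -exprSr prednK.
apply: lee_wpmul2l; last exact: vE.
by rewrite lee_fin mulr_ge0 // exprn_ge0.
Qed.

End slicing.

Section coordinate_path.
Context (R : realType) (n : nat).

(** The point [x] is moved to [y] by changing one coordinate at a time. Used with the L^1 distance
    between translated kernels and with the increments of [K]. *)
Lemma coordinate_path (D : 'rV[R]_n -> 'rV[R]_n -> R) (C : R) :
  (forall x, D x x = 0) -> (forall x y z : 'rV[R]_n, D x z <= D x y + D y z) ->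
  (forall (x y : 'rV[R]_n) (m : 'I_n), (forall j, j != m -> x ord0 j = y ord0 j) ->
     D x y <= C * `|x ord0 m - y ord0 m|) ->
  forall x y : 'rV[R]_n, D x y <= C * \sum_(m < n) `|x ord0 m - y ord0 m|.
Proof.
move=> D0 Dt Dm x y.
pose mix (k : nat) : 'rV[R]_n := \row_j (if (j < k)%N then y ord0 j else x ord0 j).
suff H k : (k <= n)%N -> D x (mix k) <= C * \sum_(m < n | (m < k)%N) `|x ord0 m - y ord0 m|.
  have := H n (leqnn n); rewrite (_ : mix n = y); last first.
    by apply/rowP => j; rewrite mxE ltn_ord.
  by under eq_bigl do rewrite ltn_ord.
elim: k => [_|k IH kn].
  rewrite big_pred0 // mulr0 (_ : mix 0%N = x) ?D0//.
  by apply/rowP => j; rewrite mxE.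
rewrite (le_trans (Dt _ (mix k) _)) //.
rewrite (bigD1 (Ordinal kn)) //= mulrDr addrC lerD //.
  rewrite (le_trans (Dm (mix k) (mix k.+1) (Ordinal kn) _)) //.
    move=> j jk; rewrite !mxE ltnS [in RHS]leq_eqVlt.
    suff -> : (nat_of_ord j == k) = false by [].
    by apply/eqP => e; move/eqP: jk; apply; apply/val_inj.
  by rewrite !mxE /= ltnn ltnSn.
rewrite (le_trans (IH (ltnW kn))) // le_eqVlt; apply/orP; left; apply/eqP; congr (_ * _).
apply: eq_bigl => j; rewrite -(inj_eq val_inj) /= ltnS.
by case: (ltngtP j k).
Qed.

End coordinate_path.

Section measurable_norm.
Context (R : realType).

Lemma measurable_enorm n : measurable_fun setT (@enorm R n).
Proof.
rewrite /enorm; apply: (measurableT_comp (continuous_measurable_fun (@sqrt_continuous R))).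
apply: measurable_sum => k; apply: measurable_funX; exact: measurable_rV_coord.
Qed.

Lemma measurable_inv_enorm n : measurable_fun setT (fun z : 'rV[R]_n => (enorm z)^-1).
Proof.
rewrite (_ : (fun _ => _) = (fun z => enorm z `^ (-1))); last first.
  by apply/funext => z; rewrite powR_inv1 ?enorm_ge0.
exact: (measurableT_comp (measurable_powR (R := R) (-1)) (@measurable_enorm n)).
Qed.

Lemma measurable_subr d (T : measurableType d) n (f g : T -> 'rV[R]_n) :
  measurable_fun [set: T] f -> measurable_fun [set: T] g ->
  measurable_fun [set: T] (fun t => f t - g t : 'rV[R]_n).
Proof.
move=> mf mg; apply: measurable_fun_rVP => k.
rewrite (_ : _ \o _ = (fun t => f t ord0 k - g t ord0 k)); last first.
  by apply/funext => t; rewrite /rV_coord /= !mxE.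
by apply: measurable_funB; exact: measurable_row.
Qed.

Lemma enorm_upd n (w : 'rV[R]_n) (m : 'I_n) (u : R) :
  enorm (rV_upd w m u) = Num.sqrt (u ^+ 2 + \sum_(j | j != m) w ord0 j ^+ 2).
Proof.
rewrite /enorm (bigD1 m) //= mxE eqxx; congr (Num.sqrt (_ + _)).
by apply: eq_bigr => j jm; rewrite mxE (negbTE jm).
Qed.

End measurable_norm.

(** * The environmental drift *)

Section kernel.
Context (R : realType) (d : nat) (Rad : R).
Hypothesis Rad0 : 0 < Rad.
Implicit Types (x y z w : 'rV[R]_d) (k m : 'I_d).
Notation leb := (@lebesgue_rV R d).

(** The kernel of the environmental drift, extended by 0 outside the ball: the drift becomes an
    integral over the whole space in which the position enters only as a translation. *)
Definition kern k z : R :=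
  if enorm z < Rad then z ord0 k / enorm z * expR (- enorm z) else 0.

Lemma coord_div_enorm k z : `|z ord0 k / enorm z| <= 1.
Proof.
rewrite normrM normfV (ger0_norm (enorm_ge0 z)).
have [->|z0] := eqVneq (enorm z) 0; first by rewrite invr0 mulr0.
by rewrite ler_pdivrMr ?lt_def ?z0 ?enorm_ge0// mul1r coord_le_enorm.
Qed.

Lemma norm_kern k z : `|kern k z| <= 1.
Proof.
rewrite /kern; case: ifP => _; last by rewrite normr0.
rewrite normrM (ger0_norm (expR_ge0 _)) mulr_ile1 ?expR_ge0 ?coord_div_enorm//.
by rewrite -expR0 ler_expR oppr_le0 enorm_ge0.
Qed.

Lemma measurable_kern k : measurable_fun setT (kern k).
Proof.
apply: measurable_fun_ifT => //.
- apply: measurable_fun_ltr => //; exact: measurable_enorm.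
- apply: measurable_funM; first apply: measurable_funM.
  + exact: measurable_rV_coord.
  + exact: measurable_inv_enorm.
  + apply: (measurableT_comp (@measurable_expR R)); apply: measurable_funN; exact: measurable_enorm.
Qed.

Lemma env_driftE (m0 v : 'rV[R]_d -> R) x k :
  env_drift Rad m0 v x ord0 k = \int[leb]_z (kern k (z - x) * (1 - v z / m0 z)).
Proof.
rewrite mxE Rintegral_mkcond; apply: eq_Rintegral => z _.
rewrite patchE /kern; have [h|h] := boolP (enorm (z - x) < Rad).
  by rewrite mem_set //=; ring.
by rewrite memNset ?mul0r //=; exact/negP.
Qed.

Lemma kern_out k z j : Rad <= `|z ord0 j| -> kern k z = 0.
Proof.
by move=> h; rewrite /kern ltNge (le_trans h (coord_le_enorm _ _)).
Qed.

Let box x : set 'rV[R]_d := [set z | forall k, `[x ord0 k - Rad, x ord0 k + Rad]%classic (z ord0 k)].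

Let mbox x : measurable (box x).
Proof.
rewrite (_ : box x = \bigcap_(k in [set: 'I_d]) (rV_coord k @^-1` `[x ord0 k - Rad, x ord0 k + Rad]%classic)).
  apply: fin_bigcap_measurable => // k _.
  by rewrite -[X in measurable X]setTI; exact: measurable_rV_coord.
by apply/seteqP; split => [z h k _|z h k]; exact: h.
Qed.

Let vol : R := (2 * Rad) ^+ d.

Let box_vol x : leb (box x) = vol%:E.
Proof.
rewrite (lebesgue_rV_box (E := fun k => `[x ord0 k - Rad, x ord0 k + Rad]%classic)) //.
rewrite (eq_bigr (fun=> (2 * Rad)%:E)); first by rewrite prodEFin prodr_const card_ord.
move=> k _; rewrite lebesgue_cc; last by have := Rad0; lra.
by congr EFin; ring.
Qed.

(** The support lies in the cube of side [2 * Rad] centred at [x]; its volume is the factor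
    [(2 * Rad)^d] in all the bounds on the drift. *)
Lemma kern_shift_integrable x (f : 'rV[R]_d -> R) (M : R) : measurable_fun setT f ->
  (forall z, `|f z| <= M) -> (forall z j, Rad <= `|(z - x) ord0 j| -> f z = 0) ->
  leb.-integrable setT (EFin \o f) /\ `|\int[leb]_z f z| <= M * (2 * Rad) ^+ d.
Proof.
move=> mf fM f0.
have fE : f \_ (box x) = f.
  apply/funext => z; rewrite patchE; case: ifPn => // /negP zx.
  have /existsNP[k /= zk] : ~ box x z by move=> h; apply: zx; rewrite inE.
  rewrite (f0 z k) // !mxE leNgt; apply/negP; rewrite ltr_norml => /andP[h1 h2].
  by apply: zk; rewrite in_itv /=; apply/andP; split; lra.
have Boo : (leb (box x) < +oo)%E by rewrite box_vol ltry.
have mfB : measurable_fun (box x) f by exact: measurable_funTS.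
split.
  have -> : EFin \o f = (EFin \o f) \_ (box x).
    by rewrite -[in LHS]fE; apply/funext => z /=; rewrite !patchE; case: ifP.
  by apply/(integrable_mkcond _ (mbox x)); exact: (integrable_bounded (M := M)).
rewrite -fE -Rintegral_mkcond; apply: le_trans (Rintegral_le_bound (M := M) _ Boo mfB _) _ => //.
by rewrite -[X in fine X]/(leb (box x)) box_vol.
Qed.

Section line.
Variables (w : 'rV[R]_d) (m : 'I_d).
Let a : R := \sum_(j | j != m) w ord0 j ^+ 2.
Let a0 : 0 <= a. Proof. by apply: sumr_ge0 => j _; exact: sqr_ge0. Qed.
Let rho (u : R) : R := Num.sqrt (u ^+ 2 + a).
Let rho0 u : 0 <= rho u. Proof. exact: sqrtr_ge0. Qed.
Let rhoN u : rho (- u) = rho u. Proof. by rewrite /rho sqrrN. Qed.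
Let rho_le s t : 0 <= s -> s <= t -> rho s <= rho t.
Proof.
move=> s0 st; rewrite ler_wsqrtr // lerD2r lerXn2r ?nnegrE//; exact: le_trans st.
Qed.
Let sqr_rho u : rho u ^+ 2 = u ^+ 2 + a.
Proof. by rewrite sqr_sqrtr // addr_ge0 // sqr_ge0. Qed.
Let norm_le_rho u : `|u| <= rho u.
Proof. by rewrite -sqrtr_sqr ler_wsqrtr // lerDl. Qed.

(** The radial factor of the kernel along the line. It is even and nonincreasing in [|u|], including
    the jump at the boundary of the ball. *)
Let h1 (u : R) : R := if rho u < Rad then expR (- rho u) else 0.
Let h1N u : h1 (- u) = h1 u. Proof. by rewrite /h1 rhoN. Qed.
Let h1b u : 0 <= h1 u <= 1.
Proof.
rewrite /h1; case: ifP => _; last by rewrite lexx ler01.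
by rewrite expR_ge0 /= -expR0 ler_expR oppr_le0.
Qed.
Let h1d s t : 0 <= s -> s <= t -> h1 t <= h1 s.
Proof.
move=> s0 st; rewrite /h1; have h := rho_le s0 st; case: ifPn => [tR|_].
  by rewrite (le_lt_trans h tR) ler_expR lerN2.
by case: ifP => // _; exact: expR_ge0.
Qed.

(** For [0 <= s <= t] the claim squares to [s^2 (t^2 + a) <= t^2 (s^2 + a)]; negative arguments
    follow by oddness. *)
Let ratio_homo : {homo (fun u => u / rho u) : s t / s <= t}.
Proof.
have pos s t : 0 <= s -> s <= t -> s / rho s <= t / rho t.
  move=> s0 st; have [->|sn0] := eqVneq s 0.
    by rewrite mul0r divr_ge0 // (le_trans s0).
  have sp : 0 < s by rewrite lt_def sn0.
  have tp : 0 < t by exact: lt_le_trans st.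
  have rs : 0 < rho s by apply: lt_le_trans (norm_le_rho s); rewrite normr_gt0.
  have rt : 0 < rho t by apply: lt_le_trans (norm_le_rho t); rewrite normr_gt0 gt_eqF.
  rewrite ler_pdivrMr // mulrAC ler_pdivlMr //.
  rewrite -(@ler_pXn2r _ 2) ?nnegrE ?mulr_ge0// ?(ltW tp)//.
  rewrite !exprMn !sqr_rho !mulrDr [t ^+ 2 * s ^+ 2]mulrC lerD2l ler_wpM2r // lerXn2r ?nnegrE//.
  exact: ltW.
move=> s t st /=; have [s0|s0] := leP 0 s; first exact: pos.
have [t0|t0] := leP 0 t.
  by rewrite (@le_trans _ _ 0) ?divr_ge0// mulr_le0_ge0 ?invr_ge0 ?(ltW s0).
have : - t / rho (- t) <= - s / rho (- s) by apply: pos; [rewrite oppr_ge0 ltW | rewrite lerN2].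
by rewrite !rhoN !mulNr lerN2.
Qed.

Let ratio_le1 (b u : R) : b ^+ 2 <= u ^+ 2 + a -> `|b / rho u| <= 1.
Proof.
move=> ba; rewrite normrM normfV (ger0_norm (rho0 u)).
have [->|r0] := eqVneq (rho u) 0; first by rewrite invr0 mulr0.
rewrite ler_pdivrMr ?lt_def ?r0 ?rho0// mul1r -sqrtr_sqr ler_wsqrtr //.
Qed.

Let kernE k u : kern k (rV_upd w m u) = h1 u * ((if k == m then u else w ord0 k) / rho u).
Proof.
rewrite /kern enorm_upd -/a -/(rho u) /h1 mxE; case: ifP => _; last by rewrite mul0r.
by rewrite mulrC.
Qed.

(** For [k = m] the kernel is the even factor times the monotone ratio [u / rho u], both bounded by
    1, so their variations add up. For [k != m] the numerator is constant along the line; up to its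
    sign the whole product is again even and nonincreasing in [|u|], and the third function is 0. *)
Lemma kern_dominated k : dominated_variation (fun u => kern k (rV_upd w m u)).
Proof.
have [km|km] := eqVneq k m.
  have [p1 [p2 [m1 m2 b1 b2 H]]] := even_dominated h1N h1b h1d.
  exists p1, p2, (fun u => u / rho u); split.
    move=> p [->|[->|->]]; split; [exact: m1|exact: b1|exact: m2|exact: b2|exact: ratio_homo|].
    by move=> s; apply: ratio_le1; rewrite lerDl.
  move=> s t; rewrite !kernE km eqxx.
  rewrite [X in `|X|](_ : _ = (h1 s - h1 t) * (s / rho s) + h1 t * (s / rho s - t / rho t)); last by ring.
  rewrite (le_trans (ler_normD _ _)) // addrA lerD //.
    by rewrite normrM (le_trans _ (H s t)) // ler_piMr // ratio_le1 // lerDl.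
  by have /andP[h0 h1'] := h1b t; rewrite normrM ler_piMl // ger0_norm.
have ab : w ord0 k ^+ 2 <= a.
  by rewrite /a (bigD1 k) //= lerDl; apply: sumr_ge0 => j _; exact: sqr_ge0.
pose h (u : R) := h1 u * (`|w ord0 k| / rho u).
have hq u : 0 <= `|w ord0 k| / rho u <= 1.
  rewrite divr_ge0 //=; have := @ratio_le1 (w ord0 k) u.
  rewrite normrM normfV (ger0_norm (rho0 u)); apply.
  by rewrite (le_trans ab) // lerDr sqr_ge0.
have hN u : h (- u) = h u by rewrite /h h1N rhoN.
have hb u : 0 <= h u <= 1.
  have /andP[x0 x1] := h1b u; have /andP[y0 y1] := hq u.
  by rewrite /h mulr_ge0 //= mulr_ile1.
have hd s t : 0 <= s -> s <= t -> h t <= h s.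
  move=> s0 st; have /andP[x0 _] := h1b t; have /andP[y0 _] := hq t.
  rewrite /h; have [->|wk0] := eqVneq (w ord0 k) 0; first by rewrite normr0 !mul0r !mulr0.
  rewrite ler_pM ?h1d// ler_wpM2l //.
  have rs : 0 < rho s.
    rewrite sqrtr_gt0 ltr_wpDl ?sqr_ge0// (lt_le_trans _ ab) // exprn_even_gt0 //.
  by rewrite lef_pV2 ?posrE ?rho_le// (lt_le_trans rs) // rho_le.
have [p1 [p2 [m1 m2 b1 b2 H]]] := even_dominated hN hb hd.
exists p1, p2, (cst 0); split.
  by move=> p [->|[->|->]]; split => // s /=; rewrite normr0.
move=> s t; rewrite !kernE (negbTE km) subrr normr0 addr0 (le_trans _ (H s t)) //.
rewrite /h le_eqVlt; apply/orP; left; apply/eqP.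
have [w0|w0] := leP 0 (w ord0 k); first by rewrite (ger0_norm w0).
rewrite (ltr0_norm w0) -normrN; congr `|_|; ring.
Qed.

End line.

Lemma kern_shift_coord k x y m : (forall j, j != m -> x ord0 j = y ord0 j) ->
  (\int[leb]_z `|kern k (z - x) - kern k (z - y)|%:E <=
   (6 * `|x ord0 m - y ord0 m| * (2 * Rad) ^+ d.-1)%:E)%E.
Proof.
move=> xy.
have mk x' : measurable_fun setT (fun z => kern k (z - x')).
  by apply: (measurableT_comp (measurable_kern k)); apply: measurable_subr.
have mkk : measurable_fun setT (fun z => `|kern k (z - x) - kern k (z - y)|).
  by apply: measurableT_comp => //; apply: measurable_funB.
apply: (slice_bound (m := m) (E := fun j => `]x ord0 j - Rad, x ord0 j + Rad[%classic)) => //.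
- exact/measurable_EFinP.
- by rewrite mulr_ge0 // ltW.
- move=> j; rewrite lebesgue_measure_itv /= lte_fin; case: ifP => _; last by rewrite lee_fin mulr_ge0 // ltW.
  by rewrite -EFinB lee_fin; lra.
- move=> z j jm zE.
  have h : Rad <= `|(z - x) ord0 j|.
    rewrite !mxE leNgt; apply/negP; rewrite ltr_norml => /andP[e1 e2].
    by apply: zE; rewrite /= in_itv /=; apply/andP; split; lra.
  have h' : Rad <= `|(z - y) ord0 j| by move: h; rewrite !mxE xy.
  by rewrite (kern_out k h) (kern_out k h') subrr normr0.
move=> z; pose g u := kern k (rV_upd (z - x) m u).
have gx s : kern k (rV_upd z m s - x) = g (s - x ord0 m).
  by congr kern; apply/rowP => j; rewrite !mxE; case: eqP => // ->.
have gy s : kern k (rV_upd z m s - y) = g (s - y ord0 m).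
  congr kern; apply/rowP => j; rewrite !mxE; case: eqP => [->//|/eqP jm].
  by rewrite xy.
under eq_integral do rewrite gx gy.
have g0 u : Rad <= `|u| -> g u = 0.
  by move=> h; apply: (@kern_out _ _ m); rewrite mxE eqxx.
have mg : measurable_fun setT g.
  apply: (measurableT_comp (measurable_kern k)); apply: measurable_fun_rVP => j.
  rewrite (_ : _ \o _ = fun s => if j == m then s else (z - x) ord0 j).
    by case: (j == m).
  by apply/funext => s; rewrite /rV_coord /= mxE.
(* Outside [[l, r]] both translated kernels vanish, so the integral over the line reduces to this
   interval. *)
pose l := Num.min (x ord0 m) (y ord0 m) - Rad.
pose r := Num.max (x ord0 m) (y ord0 m) + Rad.
apply: le_trans (dominated_variation_shift l r (x ord0 m) (y ord0 m) (kern_dominated (z - x) m k) mg).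
rewrite [leRHS]integral_mkcond le_eqVlt; apply/orP; left; apply/eqP; apply: eq_integral => s _.
rewrite patchE; case: ifPn => // /negP sN.
have [hx hy] : Rad <= `|s - x ord0 m| /\ Rad <= `|s - y ord0 m|.
  have : ~ (l <= s <= r) by move=> h; apply: sN; rewrite inE /= in_itv.
  move=> /negP; rewrite negb_and -!ltNge /l /r => /orP[h|h].
    have [h2 h3] : s < x ord0 m - Rad /\ s < y ord0 m - Rad.
      by split; apply: lt_le_trans h _; rewrite lerD2r ge_min lexx ?orbT.
    by rewrite !(distrC s) !ler_normr; split; apply/orP; left; lra.
  have [h2 h3] : x ord0 m + Rad < s /\ y ord0 m + Rad < s.
    by split; apply: le_lt_trans h; rewrite lerD2r le_max lexx ?orbT.
  by rewrite !ler_normr; split; apply/orP; left; lra.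
by rewrite -/(g _) !g0 // subrr normr0.
Qed.

Lemma kern_diff_integrable k x y :
  leb.-integrable setT (EFin \o (fun z => `|kern k (z - x) - kern k (z - y)|)).
Proof.
have i x' : leb.-integrable setT (EFin \o (fun z => kern k (z - x'))).
  suff [] : leb.-integrable setT (EFin \o (fun z => kern k (z - x'))) /\
    `|\int[leb]_z kern k (z - x')| <= 1 * (2 * Rad) ^+ d by [].
  apply: (@kern_shift_integrable x').
  - by apply: (measurableT_comp (measurable_kern k)); apply: measurable_subr.
  - by move=> z; exact: norm_kern.
  - by move=> z j; exact: kern_out.
have := integrable_norm (integrableB measurableT (i x) (i y)).
by apply: eq_integrable => // z _.
Qed.

(* The direction field [z / |z|] is not Lipschitz, but it has bounded variation along every
   coordinate line, whence an L^1 modulus of continuity for translations. *)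
Lemma kern_shift k x y :
  \int[leb]_z `|kern k (z - x) - kern k (z - y)| <=
  6 * (2 * Rad) ^+ d.-1 * \sum_(m < d) `|x ord0 m - y ord0 m|.
Proof.
apply: (coordinate_path (D := fun x y => \int[leb]_z `|kern k (z - x) - kern k (z - y)|)).
- move=> {}x; under eq_Rintegral do rewrite subrr normr0.
  by rewrite Rintegral_cst // mul0r.
- move=> {}x {}y z; rewrite -RintegralD //; try exact: kern_diff_integrable.
  apply: le_Rintegral => //; first exact: kern_diff_integrable.
    have := integrableD measurableT (kern_diff_integrable k x y) (kern_diff_integrable k y z).
    by apply: eq_integrable => // u _.
  move=> u _; rewrite -{1}(subrK (kern k (u - y)) (kern k (u - x))) -addrA ler_normD //.
- move=> {}x {}y m xy; have := kern_shift_coord k xy.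
  rewrite /Rintegral; move=> h.
  have h0 : (0 <= \int[leb]_z `|kern k (z - x) - kern k (z - y)|%:E)%E by apply: integral_ge0.
  rewrite -lee_fin fineK; last by rewrite ge0_fin_numE // (le_lt_trans h) // ltry.
  by rewrite mulrAC.
Qed.

End kernel.

Section environment.
Context (R : realType) (d : nat) (Rad : R) (m0 : 'rV[R]_d -> R) (Mlow Cv : R).
Hypothesis Rad0 : 0 < Rad.
Hypothesis mm0 : measurable_fun setT m0.
Hypothesis Mlow0 : 0 < Mlow.
Hypothesis m0_ge : forall x, Mlow <= m0 x.
Hypothesis Cv0 : 0 <= Cv.
Implicit Types (x y z w : 'rV[R]_d) (k m : 'I_d) (v : 'rV[R]_d -> R).
Notation leb := (@lebesgue_rV R d).

Lemma measurable_invm0 : measurable_fun setT (fun z => (m0 z)^-1).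
Proof.
rewrite (_ : (fun _ => _) = (fun z => m0 z `^ (-1))); last first.
  by apply/funext => z; rewrite powR_inv1 // (le_trans (ltW Mlow0)).
exact: (measurableT_comp (measurable_powR (R := R) (-1)) mm0).
Qed.

Let inv_m0 z : 0 <= (m0 z)^-1 <= Mlow^-1.
Proof.
have m0p : 0 < m0 z by exact: lt_le_trans (m0_ge z).
by rewrite invr_ge0 (ltW m0p) /= lef_pV2 ?posrE.
Qed.

Let phi v z := 1 - v z / m0 z.

Let mphi v : measurable_fun setT v -> measurable_fun setT (phi v).
Proof.
move=> mv; apply: measurable_funB => //; apply: measurable_funM => //.
exact: measurable_invm0.
Qed.

Let phi_bound v z : (forall z, 0 <= v z <= Cv) -> `|phi v z| <= 1 + Cv / Mlow.
Proof.
move=> /(_ z)/andP[v0 vC]; have /andP[i0 i1] := inv_m0 z.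
rewrite (le_trans (ler_normB _ _)) // normr1 lerD2l normrM !ger0_norm //.
exact: ler_pM.
Qed.

Let mkern x k : measurable_fun setT (fun z => kern Rad k (z - x)).
Proof. by apply: (measurableT_comp (measurable_kern Rad k)); apply: measurable_subr. Qed.

Let envi v x k : measurable_fun setT v -> (forall z, 0 <= v z <= Cv) ->
  leb.-integrable setT (EFin \o (fun z => kern Rad k (z - x) * phi v z)) /\
  `|\int[leb]_z (kern Rad k (z - x) * phi v z)| <= (1 + Cv / Mlow) * (2 * Rad) ^+ d.
Proof.
move=> mv vC; apply: (kern_shift_integrable Rad0 (x := x)).
- by apply: measurable_funM => //; exact: mphi.
- move=> z; rewrite normrM -[leRHS]mul1r ler_pM //; [exact: norm_kern | exact: phi_bound].
- by move=> z j h; rewrite (kern_out k h) mul0r.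
Qed.

Lemma env_drift_bound v x k : measurable_fun setT v -> (forall z, 0 <= v z <= Cv) ->
  `|env_drift Rad m0 v x ord0 k| <= (1 + Cv / Mlow) * (2 * Rad) ^+ d.
Proof. by move=> mv vC; rewrite env_driftE; have [] := envi x k mv vC. Qed.

(** All the regularity in the position comes from the kernel, since the field is only bounded and
    measurable in space. *)
Lemma env_drift_lip v x y k : measurable_fun setT v -> (forall z, 0 <= v z <= Cv) ->
  `|env_drift Rad m0 v x ord0 k - env_drift Rad m0 v y ord0 k| <=
    (1 + Cv / Mlow) * (6 * (2 * Rad) ^+ d.-1) * \sum_(m < d) `|x ord0 m - y ord0 m|.
Proof.
move=> mv vC; have [ix _] := envi x k mv vC; have [iy _] := envi y k mv vC.
have -> : env_drift Rad m0 v x ord0 k - env_drift Rad m0 v y ord0 k =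
    \int[leb]_z (kern Rad k (z - x) * phi v z - kern Rad k (z - y) * phi v z).
  by rewrite (RintegralB measurableT ix iy); congr (_ - _); exact: env_driftE.
have iB := integrableB measurableT ix iy.
apply: le_trans (le_normr_Rintegral _ _) _ => //.
have id := kern_diff_integrable Rad0 k x y.
have M0 : 0 <= 1 + Cv / Mlow by rewrite addr_ge0 // divr_ge0 // ltW.
apply: (@le_trans _ _ (\int[leb]_z ((1 + Cv / Mlow) * `|kern Rad k (z - x) - kern Rad k (z - y)|))).
  apply: le_Rintegral => //.
  - exact: integrable_norm iB.
  - have := integrableZl measurableT (1 + Cv / Mlow) id.
    by apply: eq_integrable => // z _.
  - move=> z _; rewrite -mulrBl normrM mulrC ler_wpM2r //; exact: phi_bound.
by rewrite RintegralZl // -!mulrA ler_wpM2l // mulrA; exact: kern_shift.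
Qed.

Lemma env_drift_field_lip v v' x k e : measurable_fun setT v -> (forall z, 0 <= v z <= Cv) ->
  measurable_fun setT v' -> (forall z, 0 <= v' z <= Cv) -> (forall z, `|v z - v' z| <= e) ->
  `|env_drift Rad m0 v x ord0 k - env_drift Rad m0 v' x ord0 k| <=
    e / Mlow * (2 * Rad) ^+ d.
Proof.
move=> mv vC mv' vC' ve; have [ix _] := envi x k mv vC; have [iy _] := envi x k mv' vC'.
rewrite !env_driftE -(RintegralB measurableT ix iy).
refine (proj2 (kern_shift_integrable Rad0 (x := x) (M := e / Mlow) _ _ _)).
- by apply: measurable_funB; apply: measurable_funM => //; exact: mphi.
- move=> z; rewrite -mulrBr normrM -[leRHS]mul1r ler_pM ?norm_kern//.
  have /andP[i0 i1] := inv_m0 z.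
  rewrite /phi [X in `|X|](_ : _ = - ((v z - v' z) / m0 z)); last by ring.
  by rewrite normrN normrM (ger0_norm i0) ler_pM.
- by move=> z j h; rewrite (kern_out k h) !mul0r subrr.
Qed.

End environment.

Section smooth_lip.
Context (R : realType) (d : nat) (K : 'rV[R]_d -> R).
Hypothesis Ks : Cb_smooth K.

Lemma Cb_smooth_continuous : continuous K. Proof. by have [] := Ks [::]. Qed.

Lemma Cb_smooth_bounded : exists2 M : R, 0 <= M & forall x, `|K x| <= M.
Proof.
have [_ _ [M KM]] := Ks [::]; exists M => //.
exact: le_trans (KM 0).
Qed.

Lemma is_derive_line x (k : 'I_d) (u : R) :
  is_derive u 1 (fun s : R => K (x + s *: delta_mx ord0 k)) (partial k K (x + u *: delta_mx ord0 k)).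
Proof.
have [/(_ (x + u *: delta_mx ord0 k) k) dK _ _] := Ks [::].
have E : (fun h : R => h^-1 *: (K (x + (h *: 1 + u) *: delta_mx ord0 k) - K (x + u *: delta_mx ord0 k))) =
   (fun h : R => h^-1 *: (K (h *: delta_mx ord0 k + (x + u *: delta_mx ord0 k)) - K (x + u *: delta_mx ord0 k))).
  apply/funext => h; rewrite scalerDl addrCA; congr (_ *: (K (_ + _) - _)).
  by rewrite /GRing.scale /= mulr1.
apply: DeriveDef; first by rewrite /derivable E.
by rewrite /partial /derive E.
Qed.

(** Smoothness is expressed by partial derivatives, so the mean value theorem is applied along
    coordinate lines, which leads to the sum of the coordinate distances. *)
Lemma Cb_smooth_lip : exists2 L : R, 0 <= L &
  forall x y, `|K x - K y| <= L * \sum_(m < d) `|x ord0 m - y ord0 m|.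
Proof.
have : exists2 L : R, 0 <= L & forall k x, `|partial k K x| <= L.
  have H k : exists M : R, forall x, `|partial k K x| <= M by have [] := Ks [:: k].
  have /choice[M HM] := H; exists (\sum_k `|M k|); first exact: sumr_ge0.
  move=> k x; rewrite (le_trans (HM k x)) // (le_trans (ler_norm _)) //.
  by rewrite (bigD1 k) //= lerDl sumr_ge0.
move=> [L L0 HL]; exists L => // x y.
apply: (coordinate_path (D := fun x y => `|K x - K y|)) => {x y}.
- by move=> x; rewrite subrr normr0.
- by move=> x y z; rewrite -{1}(subrK (K y) (K x)) -addrA ler_normD.
move=> x y m xy.
pose g (s : R) := K (x + s *: delta_mx ord0 m).
pose u := y ord0 m - x ord0 m.
have gx : g 0 = K x by rewrite /g scale0r addr0.
have gy : g u = K y.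
  congr K; apply/rowP => j; rewrite !mxE eqxx /=; have [->|jm] := eqVneq j m.
    by rewrite mulr1 /u addrC subrK.
  by rewrite mulr0 addr0 xy.
have dg s := is_derive_line x m s.
have cg : continuous g.
  by move=> s; apply: differentiable_continuous; apply/derivable1_diffP; exact: (@ex_derive _ _ _ _ _ _ _ (dg s)).
have MV a b : a < b -> `|g b - g a| <= L * `|b - a|.
  move=> ab; have [c _ ->] := @MVT _ g (fun s => partial m K (x + s *: delta_mx ord0 m)) a b ab (fun s _ => dg s) (continuous_subspaceT cg).
  by rewrite normrM ler_wpM2r.
rewrite -gx -gy (_ : x ord0 m - y ord0 m = 0 - u); last by rewrite /u; ring.
have [u0|u0|<-] := ltgtP u 0.
- exact: MV.
- by rewrite distrC [`|0 - u|]distrC; exact: MV.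
- by rewrite !subrr normr0 mulr0.
Qed.

End smooth_lip.

(** * Exponential bounds and increments of second order *)

Section exponential_bounds.
Context (R : realType).
Implicit Types a b M : R.

Lemma expR_lip a b M : a <= M -> b <= M -> `|expR a - expR b| <= expR M * `|a - b|.
Proof.
wlog ba : a b / b <= a => [H aM bM|aM bM].
  have [ba|/ltW ab] := leP b a; first exact: H.
  by rewrite distrC [`|a - b|]distrC; exact: H.
rewrite !ger0_norm ?subr_ge0 ?ler_expR//.
have := expR_ge1Dx (b - a); rewrite expRB => h.
apply: (@le_trans _ _ (expR a * (a - b))); last by rewrite ler_wpM2r ?subr_ge0 ?ler_expR.
have ea := expR_gt0 a; rewrite -(ler_pM2l ea) in h.
have e : expR a * (expR b / expR a) = expR b by rewrite mulrCA divff ?gt_eqF// mulr1.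
rewrite e in h.
by move: h; clear; lra.
Qed.

(** Convexity, used at 0 and at [a], gives [0 <= expR a - 1 - a <= a * (expR a - 1)], and [expR_lip]
    bounds the last factor. *)
Lemma expR_taylor1 a M : `|a| <= M -> `|expR a - 1 - a| <= expR M * a ^+ 2.
Proof.
move=> aM; have aM' : a <= M by rewrite (le_trans (ler_norm _)).
have M0 : 0 <= M by exact: le_trans aM.
have h1 := expR_ge1Dx a.
rewrite ger0_norm; last by move: h1; clear; lra.
have h2 := expR_ge1Dx (- a); have ea := expR_gt0 a.
rewrite -(ler_pM2l ea) -expRD subrr expR0 in h2.
have h3 := expR_lip aM' M0; rewrite expR0 subr0 in h3.
apply: (@le_trans _ _ (a * (expR a - 1))); first by move: h2; clear; lra.
rewrite (le_trans (ler_norm _)) // normrM -(real_normK (num_real a)) expr2 mulrCA.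
exact: ler_wpM2l.
Qed.

End exponential_bounds.

Section small.
Context (R : realType) (T : R).
Hypothesis T0 : 0 <= T.
Implicit Types D E : R -> R -> R.

(* An increment of order [(t - s)^2] vanishes. This solves the integrated equations without
   differentiating integrals of functions that are merely measurable in time. *)
Definition small p D := exists2 C : R, 0 <= C &
  forall s t, 0 <= s -> s <= t -> t <= T -> `|D s t| <= C * (t - s) ^+ p.

Lemma smallD p D E : small p D -> small p E -> small p (fun s t => D s t + E s t).
Proof.
move=> [C C0 HC] [C' C'0 HC']; exists (C + C'); first exact: addr_ge0.
move=> s t s0 st tT; rewrite (le_trans (ler_normD _ _)) // mulrDl lerD //; [exact: HC|exact: HC'].
Qed.

Lemma smallM p q D E : small p D -> small q E -> small (p + q) (fun s t => D s t * E s t).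
Proof.
move=> [C C0 HC] [C' C'0 HC']; exists (C * C'); first exact: mulr_ge0.
move=> s t s0 st tT; rewrite normrM exprD mulrACA ler_pM //; [exact: HC|exact: HC'].
Qed.

Lemma small0 D M : (forall s t, 0 <= s -> s <= t -> t <= T -> `|D s t| <= M) -> small 0 D.
Proof.
move=> DM; exists M; first exact: le_trans (DM 0 0 _ _ _).
by move=> s t s0 st tT; rewrite expr0 mulr1; exact: DM.
Qed.

Lemma small_cst c : small 0 (fun _ _ => c).
Proof. exact: (small0 (M := `|c|)). Qed.

Lemma small_exp D : small 1 D -> small 2 (fun s t => expR (D s t) - 1 - D s t).
Proof.
move=> [C C0 HC]; exists (expR (C * T) * C ^+ 2); first by rewrite mulr_ge0 ?expR_ge0 ?sqr_ge0.
move=> s t s0 st tT; have h := HC s t s0 st tT; rewrite expr1 in h.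
have hT : `|D s t| <= C * T.
  apply: (le_trans h); apply: ler_wpM2l => //; move: s0 st tT; clear; lra.
rewrite (le_trans (expR_taylor1 hT)) // -mulrA -exprMn ler_wpM2l ?expR_ge0//.
by rewrite -(real_normK (num_real (D s t))) lerXn2r ?nnegrE// (le_trans _ h).
Qed.

(** The integrand may depend on the left end [s], as in [(f r - f s) * u r]; integration over a
    short interval gains one order. *)
Lemma small_integral p (h : R -> R -> R) (C : R) : 0 <= C ->
  (forall s t, 0 <= s -> s <= t -> t <= T -> lebesgue_measure.-integrable `[0, t] (EFin \o h s)) ->
  (forall s t r, 0 <= s -> s <= t -> t <= T -> s <= r <= t -> `|h s r| <= C * (t - s) ^+ p) ->
  small p.+1 (fun s t => \int[lebesgue_measure]_(r in `[0, t]) h s r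
                       - \int[lebesgue_measure]_(r in `[0, s]) h s r).
Proof.
move=> C0 hi hb; exists C => // s t s0 st tT.
have h0 r : s <= r <= t -> `|h s r - 0| <= C * (t - s) ^+ p.
  by rewrite subr0; exact: hb.
have := Rintegral_increment s0 st (hi s t s0 st tT) h0.
have -> : C * (t - s) ^+ p.+1 = (t - s) * (C * (t - s) ^+ p) by rewrite exprS mulrCA.
by rewrite mulr0 subr0.
Qed.

(** Over a subdivision of [[0, t]] into [n + 1] equal pieces the increments add up to at most
    [C t^2 / (n + 1)]. *)
Lemma small2_const (D : R -> R) : small 2 (fun s t => D t - D s) -> forall t, 0 <= t <= T -> D t = D 0.
Proof.
move=> [C C0 HC] t /andP[t0 tT].
suff H n : `|D t - D 0| <= C * t ^+ 2 / n.+1%:R.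
  apply/eqP; rewrite -subr_eq0 -normr_le0; apply/ler_addgt0Pr => e e0; rewrite add0r.
  have E0 : 0 <= C * t ^+ 2 by rewrite mulr_ge0 ?sqr_ge0.
  have := H (Num.truncn (C * t ^+ 2 / e)).
  move=> /le_trans; apply; rewrite ler_pdivrMr ?ltr0n// [e * _]mulrC -ler_pdivrMr //.
  by rewrite ltW // truncnS_gt.
pose a (i : nat) : R := t * i%:R / n.+1%:R.
have n0 : (0 : R) < n.+1%:R by rewrite ltr0n.
have aE i : a i.+1 - a i = t / n.+1%:R by rewrite /a -mulrBl -mulrBr -natrB // subSnn mulr1.
have ai i : (i <= n.+1)%N -> 0 <= a i <= t.
  move=> i_n; rewrite divr_ge0 ?mulr_ge0 //= ler_pdivrMr // ler_wpM2l // ler_nat //.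
have H i : (i <= n.+1)%N -> `|D (a i) - D (a 0%N)| <= i%:R * (C * (t / n.+1%:R) ^+ 2).
  elim: i => [_|i IH iN]; first by rewrite subrr normr0 mul0r.
  rewrite -(subrK (D (a i)) (D (a i.+1))) -addrA (le_trans (ler_normD _ _)) //.
  rewrite -natr1 mulrDl mul1r [leRHS]addrC lerD ?(IH (ltnW iN))// -(aE i).
  have /andP[h1 h2] := ai _ iN; have /andP[h3 h4] := ai _ (ltnW iN).
  apply: HC => //; last exact: le_trans tT.
  by rewrite -subr_ge0 aE divr_ge0.
have := H n.+1 (leqnn _); rewrite (_ : a n.+1 = t); last by rewrite /a mulfK // gt_eqF.
rewrite (_ : a 0%N = 0); last by rewrite /a mulr0 mul0r.
by move=> /le_trans; apply; rewrite le_eqVlt; apply/orP; left; apply/eqP; field; rewrite gt_eqF.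
Qed.

End small.

Section primitive.
Context d (E : measurableType d) (R : realType).

Lemma measurable_primitive (g : E -> R -> R) :
  measurable_fun [set: (E * R)%type] (fun p => g p.1 p.2) ->
  measurable_fun [set: (E * R)%type]
    (fun p => \int[lebesgue_measure]_(s in `[0, p.2]) g p.1 s).
Proof.
move=> mg.
pose G (q : ((E * R) * R)%type) := if (0 <= q.2) && (q.2 <= q.1.2) then g q.1.1 q.2 else 0.
rewrite (_ : (fun _ => _) = (fun p : (E * R)%type => \int[lebesgue_measure]_s G (p, s))); last first.
  apply/funext => -[x t] /=; rewrite Rintegral_mkcond; apply: eq_Rintegral => s _.
  rewrite patchE /G /=; have [h|h] := boolP ((0 <= s) && (s <= t)); first by rewrite mem_set.
  by rewrite memNset // => h'; move/negP: h.
apply: (@measurable_Rintegral _ _ _ _ _ lebesgue_measure G).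
apply: measurable_fun_ifT => //.
- apply: measurable_and; apply: measurable_fun_ler => //.
  exact: (measurableT_comp measurable_snd measurable_fst).
- suff H : measurable_fun setT (fun q : ((E * R) * R)%type => g q.1.1 q.2) by exact: H.
  apply: (measurableT_comp mg (g := fun p : ((E * R) * R)%type => (p.1.1, p.2))).
  by apply: measurable_fun_pair => //; exact: (measurableT_comp measurable_fst measurable_fst).
Qed.

End primitive.

Lemma measurable_primitive1 (R : realType) (u : R -> R) : measurable_fun [set: R] u ->
  measurable_fun [set: R] (fun t : R => \int[lebesgue_measure]_(s in `[0, t]) u s).
Proof.
move=> mu; have := @measurable_primitive _ R R (fun _ => u).
move=> /(_ (measurableT_comp mu measurable_snd)) h.
exact: (measurable_fun_pair2 (0 : R) h).
Qed.

(** * The field equation *)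

Section linear_equation.
Context (R : realType) (T lam M : R) (u : R -> R).
Hypothesis T0 : 0 <= T.
Hypothesis mu : measurable_fun setT u.
Hypothesis uM : forall s, `|u s| <= M.
Notation mul := (@lebesgue_measure R).

Definition prim (t : R) := \int[mul]_(s in `[0, t]) u s.

Let M0 : 0 <= M. Proof. exact: le_trans (uM 0). Qed.

Lemma prim_integrable t : mul.-integrable `[0, t] (EFin \o u).
Proof.
apply: (integrable_bounded (M := M)) => //; first exact: lebesgue_cc_lty.
exact: measurable_funTS.
Qed.

Lemma prim_lip s t : 0 <= s -> s <= t -> `|prim t - prim s| <= M * (t - s).
Proof.
move=> s0 st; have := @Rintegral_increment _ u s t 0 M s0 st (prim_integrable t).
by rewrite mulr0 subr0 mulrC; apply => r _; rewrite subr0.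
Qed.

Lemma prim0 : prim 0 = 0.
Proof. by rewrite /prim set_itv1 Rintegral_set1. Qed.

Lemma prim_bound t : 0 <= t -> `|prim t| <= M * t.
Proof. by move=> t0; have := prim_lip (lexx 0) t0; rewrite prim0 !subr0. Qed.

Lemma prim_sub (f : R -> R) (c t : R) :
  mul.-integrable `[0, t] (EFin \o (fun s => f s * u s)) ->
  mul.-integrable `[0, t] (EFin \o (fun s => (f s - c) * u s)) /\
  \int[mul]_(s in `[0, t]) ((f s - c) * u s) =
    \int[mul]_(s in `[0, t]) (f s * u s) - c * prim t.
Proof.
move=> i1.
have i2 : mul.-integrable `[0, t] (EFin \o (fun s => c * u s)).
  have := integrableZl _ c (prim_integrable t) => /(_ (measurable_itv _)).
  by apply: eq_integrable.
have E : (fun s => (f s - c) * u s) = (fun s => f s * u s - c * u s).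
  by apply/funext => s; rewrite mulrBl.
rewrite E; split.
  have := integrableB _ i1 i2 => /(_ (measurable_itv _)).
  by apply: eq_integrable.
rewrite RintegralB // RintegralZl //; exact: prim_integrable.
Qed.

Let smallP : small T 1 (fun s t => lam * (prim t - prim s)).
Proof.
apply: (@smallM _ T 0 1 (fun _ _ => lam)); first exact: small_cst.
by exists M => // s t s0 st _; rewrite expr1; exact: prim_lip.
Qed.

Lemma linear_bound t : 0 <= t -> t <= T -> lam * prim t <= `|lam| * M * T /\ - lam * prim t <= `|lam| * M * T.
Proof.
move=> t0 tT.
have : `|lam * prim t| <= `|lam| * M * T.
  rewrite normrM -mulrA ler_wpM2l // (le_trans (prim_bound t0)) // ler_wpM2l //.
by rewrite ler_norml mulNr => /andP[h1 h2]; split => //; rewrite lerNl.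
Qed.

(** The defect [D] of the equation is constant because its increments are of second order: to first
    order [f t - f s] is [- lam * f s * (prim t - prim s)], which the increment of the integral term
    cancels. *)
Lemma linear_exists (f0 : R) (f := fun t : R => f0 * expR (- lam * prim t)) :
  mul.-integrable `[0, T] (EFin \o (fun s => f s * u s)) /\
  forall t, 0 <= t <= T -> f t = f0 - lam * \int[mul]_(s in `[0, t]) (f s * u s).
Proof.
have mf : measurable_fun setT f.
  apply: measurable_funM => //; apply: (measurableT_comp (@measurable_expR R)).
  by apply: measurable_funM => //; exact: measurable_primitive1.
pose EM := expR (`|lam| * M * T); have EM0 : 0 < EM by exact: expR_gt0.
have fb s : 0 <= s -> s <= T -> `|f s| <= `|f0| * EM.
  move=> s0 sT; rewrite normrM ler_wpM2l // (ger0_norm (expR_ge0 _)) ler_expR.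
  by have [_] := linear_bound s0 sT.
have mfu : measurable_fun setT (fun s => f s * u s) by exact: measurable_funM.
have ifu t : t <= T -> mul.-integrable `[0, t] (EFin \o (fun s => f s * u s)).
  move=> tT; apply: (integrable_bounded (M := `|f0| * EM * M)) => //; first exact: lebesgue_cc_lty.
    exact: measurable_funTS.
  move=> s /=; rewrite in_itv /= => /andP[s0 st]; rewrite normrM ler_pM //.
  by apply: fb => //; exact: le_trans tT.
split; first exact: ifu.
have smallf : small T 1 (fun s t => f t - f s).
  exists (`|f0| * EM * `|lam| * M); first by rewrite !mulr_ge0 // ltW.
  move=> s t s0 st tT; rewrite /f -mulrBr normrM expr1 -!mulrA ler_wpM2l //.
  have t0 := le_trans s0 st.
  have [_ h1] := linear_bound t0 tT; have [_ h2] := linear_bound s0 (le_trans st tT).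
  rewrite (le_trans (expR_lip h1 h2)) // ler_wpM2l ?expR_ge0//.
  by rewrite -mulrBr normrM normrN ler_wpM2l // prim_lip.
pose D t := f t - f0 + lam * \int[mul]_(s in `[0, t]) (f s * u s).
suff H : small T 2 (fun s t => D t - D s).
  move=> t tT; have := small2_const H tT; rewrite /D set_itv1 Rintegral_set1.
  have -> : f 0 = f0 by rewrite /f prim0 mulr0 expR0 mulr1.
  rewrite subrr mulr0 addr0 => h; apply/eqP; rewrite -subr_eq0; apply/eqP; rewrite -[RHS]h; ring.
have H1 : small T 2 (fun s t => f s * (expR (- (lam * (prim t - prim s))) - 1 - - (lam * (prim t - prim s)))).
  apply: (@smallM _ T 0 2 (fun s _ => f s)).
    apply: (small0 T0 (M := `|f0| * EM)) => s t s0 st tT; apply: fb => //; exact: le_trans tT.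
  apply: small_exp => //; have [C C0 HC] := smallP; exists C => // s t s0 st tT.
  by rewrite normrN; exact: HC.
have H2 : small T 2 (fun s t => lam * (\int[mul]_(r in `[0, t]) ((f r - f s) * u r)
      - \int[mul]_(r in `[0, s]) ((f r - f s) * u r))).
  apply: (@smallM _ T 0 2 (fun _ _ => lam)); first exact: small_cst.
  have [C C0 HC] := smallf.
  apply: (@small_integral _ T 1 (fun s r => (f r - f s) * u r) (C * M)); first exact: mulr_ge0.
    by move=> s t s0 st tT; have [] := prim_sub (f s) (ifu t tT).
  move=> s t r s0 st tT /andP[sr rt]; rewrite normrM expr1 mulrAC ler_pM //.
  have := HC s r s0 sr (le_trans rt tT); rewrite expr1 => /le_trans; apply.
  by rewrite ler_wpM2l // lerD2r.
have := smallD H1 H2; move=> [C C0 HC]; exists C => // s t s0 st tT.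
have := HC s t s0 st tT; congr (`|_| <= _).
have I r : r <= T -> \int[mul]_(q in `[0, r]) ((f q - f s) * u q) =
    \int[mul]_(q in `[0, r]) (f q * u q) - f s * prim r.
  by move=> rT; have [] := prim_sub (f s) (ifu r rT).
rewrite (I t tT) (I s (le_trans st tT)) /D.
have -> : f t = f s * expR (- (lam * (prim t - prim s))).
  by rewrite /f -mulrA -expRD; congr (_ * expR _); ring.
ring.
Qed.

(** Integrability of [f * u] bounds [f] through the equation, and the bound makes [f] Lipschitz in
    time. The product [E] with the integrating factor then has increments of second order, hence is
    constant. *)
Lemma linear_unique (f0 : R) (f : R -> R) :
  mul.-integrable `[0, T] (EFin \o (fun s => f s * u s)) ->
  (forall t, 0 <= t <= T -> f t = f0 - lam * \int[mul]_(s in `[0, t]) (f s * u s)) ->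
  forall t, 0 <= t <= T -> f t = f0 * expR (- lam * prim t).
Proof.
move=> ifu fE.
have ifut t : t <= T -> mul.-integrable `[0, t] (EFin \o (fun s => f s * u s)).
  move=> tT; apply: integrableS ifu => //; apply: subset_itvl; by rewrite bnd_simp.
pose Mf := `|f0| + `|lam| * \int[mul]_(s in `[0, T]) `|f s * u s|.
have I0 : 0 <= \int[mul]_(s in `[0, T]) `|f s * u s| by apply: Rintegral_ge0.
have Mf0 : 0 <= Mf by rewrite addr_ge0 // mulr_ge0.
have fb s : 0 <= s -> s <= T -> `|f s| <= Mf.
  move=> s0 sT; rewrite fE ?s0 // (le_trans (ler_normB _ _)) // lerD2l normrM ler_wpM2l //.
  apply: le_trans (le_normr_Rintegral _ (ifut s sT)) _ => //.
  rewrite /Rintegral; apply: fine_le.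
  - have /integrable_norm/integrable_fin_num := ifut s sT; exact.
  - have /integrable_norm/integrable_fin_num := ifut T (lexx _); exact.
  apply: ge0_subset_integral => //.
    by have /integrable_norm/measurable_int := ifut T (lexx _).
  by apply: subset_itvl; rewrite bnd_simp.
have smallf : small T 1 (fun s t => f t - f s).
  suff [C C0 HC] : small T 1 (fun s t => \int[mul]_(r in `[0, t]) (f r * u r)
      - \int[mul]_(r in `[0, s]) (f r * u r)).
    exists (`|lam| * C); first exact: mulr_ge0.
    move=> s t s0 st tT; rewrite (fE t) ?tT ?(le_trans s0 st)// (fE s) ?s0 ?(le_trans st)//.
    rewrite [X in `|X|](_ : _ = - (lam * (\int[mul]_(r in `[0, t]) (f r * u r) - \int[mul]_(r in `[0, s]) (f r * u r)))); last by ring.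
    by rewrite normrN normrM -mulrA ler_wpM2l //; exact: HC.
  apply: (@small_integral _ T 0 (fun _ r => f r * u r) (Mf * M)); first exact: mulr_ge0.
  - by move=> s t s0 st tT; exact: ifut.
  - move=> s t r s0 st tT /andP[sr rt]; rewrite expr0 mulr1 normrM ler_pM // fb //.
      exact: le_trans sr.
    exact: le_trans tT.
have [C C0 HC] := smallf.
have H2 : small T 2 (fun s t => - lam * (\int[mul]_(r in `[0, t]) ((f r - f s) * u r)
      - \int[mul]_(r in `[0, s]) ((f r - f s) * u r))).
  apply: (@smallM _ T 0 2 (fun _ _ => - lam)); first exact: small_cst.
  apply: (@small_integral _ T 1 (fun s r => (f r - f s) * u r) (C * M)); first exact: mulr_ge0.
    by move=> s t s0 st tT; have [] := prim_sub (f s) (ifut t tT).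
  move=> s t r s0 st tT /andP[sr rt]; rewrite normrM expr1 mulrAC ler_pM //.
  have := HC s r s0 sr (le_trans rt tT); rewrite expr1 => /le_trans; apply.
  by rewrite ler_wpM2l // lerD2r.
have H1 : small T 2 (fun s t => f t * (expR (lam * (prim t - prim s)) - 1 - lam * (prim t - prim s))).
  apply: (@smallM _ T 0 2 (fun _ t => f t)); last exact: small_exp.
  by apply: (small0 T0 (M := Mf)) => s t s0 st tT; apply: fb => //; exact: le_trans st.
have H3 : small T 2 (fun s t => (lam * (prim t - prim s)) * (f t - f s)) by exact: (smallM smallP smallf).
pose E t := f t * expR (lam * prim t).
have H4 : small T 2 (fun s t => E t - E s).
  have H0 : small T 0 (fun s _ => expR (lam * prim s)).
    apply: (small0 T0 (M := expR (`|lam| * M * T))) => s t s0 st tT.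
    rewrite ger0_norm ?expR_ge0// ler_expR.
    by have [] := linear_bound s0 (le_trans st tT).
  have [C' C'0 HC'] := smallM H0 (smallD (smallD H1 H2) H3); exists C' => // s t s0 st tT.
  have := HC' s t s0 st tT; congr (`|_| <= _).
  have I r : r <= T -> \int[mul]_(q in `[0, r]) ((f q - f s) * u q) =
      \int[mul]_(q in `[0, r]) (f q * u q) - f s * prim r.
    by move=> rT; have [] := prim_sub (f s) (ifut r rT).
  rewrite (I t tT) (I s (le_trans st tT)) /E.
  have -> : expR (lam * prim t) = expR (lam * prim s) * expR (lam * (prim t - prim s)).
    by rewrite -expRD; congr expR; ring.
  have e1 : lam * \int[mul]_(q in `[0, t]) (f q * u q) = f0 - f t.
    by rewrite (fE t) ?tT ?(le_trans s0 st)//; ring.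
  have e2 : lam * \int[mul]_(q in `[0, s]) (f q * u q) = f0 - f s.
    by rewrite (fE s) ?s0 ?(le_trans st)//; ring.
  set I1 := \int[mul]_(q in `[0, t]) _ in e1 *; set I2 := \int[mul]_(q in `[0, s]) _ in e2 *.
  have -> : - lam * (I1 - f s * prim t - (I2 - f s * prim s)) =
     f t - f s + f s * (lam * (prim t - prim s)).
    have -> : - lam * (I1 - f s * prim t - (I2 - f s * prim s)) = - (lam * I1) + lam * I2 + f s * (lam * (prim t - prim s)) by ring.
    by rewrite e1 e2; ring.
  ring.
move=> t tT; have := small2_const H4 tT; rewrite /E prim0 mulr0 expR0 mulr1.
have f00 : f 0 = f0 by rewrite fE ?lexx ?T0// set_itv1 Rintegral_set1 mulr0 subr0.
by rewrite f00 => <-; rewrite mulNr expRN mulfK // gt_eqF // expR_gt0.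
Qed.

End linear_equation.

Lemma measurable_row_eq (R : realType) d2 (E2 : measurableType d2) n (f g : E2 -> 'rV[R]_n) :
  measurable_fun [set: E2] f -> measurable_fun [set: E2] g ->
  measurable_fun [set: E2] (fun x : E2 => f x == g x).
Proof.
move=> mf mg; rewrite (_ : (fun _ => _) = (fun x : E2 => enorm (f x - g x) == 0)); last first.
  by apply/funext => x; rewrite enorm_eq0 subr_eq0.
apply: measurable_fun_eqr => //.
by apply: (measurableT_comp (@measurable_enorm R n)); apply: measurable_subr.
Qed.

(** * Fields and truncated drift generated by particle paths *)

Section particle_fields.
Context (R : realType) (d N Nt : nat) (A B alpha beta Rad lam T Mlow Cc MK LK : R).
Context (m0 K c0 : 'rV[R]_d -> R).
Hypotheses (A0 : 0 < A) (B0 : 0 < B) (beta0 : 0 < beta) (ab : beta < alpha).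
Hypothesis Nt_ge : (N <= Nt)%N.
Hypothesis Rad0 : 0 < Rad.
Hypothesis T0 : 0 <= T.
Hypothesis mm0 : measurable_fun setT m0.
Hypothesis Mlow0 : 0 < Mlow.
Hypothesis m0_ge : forall x, Mlow <= m0 x.
Hypothesis mK : measurable_fun setT K.
Hypothesis KM : forall x, `|K x| <= MK.
Hypothesis LK0 : 0 <= LK.
Hypothesis Klip : forall x y, `|K x - K y| <= LK * \sum_(m < d) `|x ord0 m - y ord0 m|.
Hypothesis mc0 : measurable_fun setT c0.
Hypothesis c0_range : forall x, 0 <= c0 x <= Cc.
Implicit Types (X Y : 'I_N -> R -> 'rV[R]_d) (x y z : 'rV[R]_d) (s t e : R) (i : 'I_N) (k : 'I_d).
Notation leb := (@lebesgue_rV R d).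
Notation mul := (@lebesgue_measure R).
Let nu : R := Nt%:R^-1.

(* [self_field] is the field generated by the density [self_density], which includes the
   self-interaction; it coincides with the field [excl_field] of the system for almost every [z],
   hence in the drift. *)
Definition self_density X z s := nu * \sum_i K (z - X i s).
Definition self_field X t z := c0 z * expR (- lam * prim (self_density X z) t).
Definition excl_field X t z := c0 z * expR (- lam * prim (fun s => reg_density K Nt (X^~ s) z) t).
Definition tdrift e X s i : 'rV[R]_d :=
  nu *: total_force (trunc_force A B alpha beta e) (X^~ s) i + env_drift Rad m0 (self_field X s) (X i s).

Lemma tdriftE e X s i k : tdrift e X s i ord0 k =
  nu * (\sum_j trunc_force A B alpha beta e (X i s - X j s) ord0 k) +
  env_drift Rad m0 (self_field X s) (X i s) ord0 k.
Proof. by rewrite mxE mxE summxE. Qed.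

(** The kernel [K] has no prescribed sign, so the density may be negative and the field may grow, at
    exponential rate at most [|lam| * MK]. *)
Definition field_max := Cc * expR (`|lam| * MK * T).

Let MK0 : 0 <= MK. Proof. exact: le_trans (KM 0). Qed.
Let Cc0 : 0 <= Cc. Proof. by have /andP[h1 h2] := c0_range 0; exact: le_trans h2. Qed.
Let nu0 : 0 <= nu. Proof. by rewrite invr_ge0. Qed.
Let nuN : nu * N%:R <= 1.
Proof.
rewrite /nu; case: (posnP Nt) => [->|Nt0]; first by rewrite invr0 mul0r.
by rewrite mulrC ler_pdivrMr ?ltr0n// mul1r ler_nat.
Qed.

Let sum_le (P : pred 'I_N) (f : 'I_N -> R) M : 0 <= M -> (forall i, `|f i| <= M) ->
  `|nu * \sum_(i | P i) f i| <= M.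
Proof.
move=> M0 fM; rewrite normrM (ger0_norm nu0) (@le_trans _ _ (nu * (N%:R * M))) //.
  rewrite ler_wpM2l // (le_trans (ler_norm_sum _ _ _)) //.
  rewrite (@le_trans _ _ (\sum_(i < N) M)) //; last by rewrite sumr_const card_ord mulr_natl.
  rewrite big_mkcond /= ler_sum // => i _; case: (P i) => //.
by rewrite mulrA ler_piMl // nuN.
Qed.

Lemma field_max_ge0 : 0 <= field_max. Proof. by rewrite mulr_ge0 ?expR_ge0. Qed.

Lemma self_density_bound X z s : `|self_density X z s| <= MK.
Proof. exact: sum_le. Qed.

Lemma reg_density_bound (x : 'I_N -> 'rV[R]_d) z : `|reg_density K Nt x z| <= MK.
Proof. exact: sum_le. Qed.

Lemma self_density_lip X Y z s e : 0 <= e -> (forall i k, `|X i s ord0 k - Y i s ord0 k| <= e) ->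
  `|self_density X z s - self_density Y z s| <= LK * (d%:R * e).
Proof.
move=> e0 XY; rewrite /self_density -mulrBr -sumrB; apply: sum_le.
  by rewrite mulr_ge0 // mulr_ge0.
move=> i; rewrite (le_trans (Klip _ _)) // ler_wpM2l //.
rewrite (@le_trans _ _ (\sum_(m < d) e)) //; last by rewrite sumr_const card_ord mulr_natl.
apply: ler_sum => m _; rewrite !mxE [X in `|X|](_ : _ = - (X i s ord0 m - Y i s ord0 m)); last by ring.
by rewrite normrN.
Qed.

Section measurability.
Context d' (E : measurableType d').

(** The parameter space [E] will be the probability space with one of several sigma-algebras; taking
    that of time [t] turns statements about families into adaptedness. *)
Definition mfamily (X : E -> 'I_N -> R -> 'rV[R]_d) :=
  forall i, measurable_fun [set: (E * R)%type] (fun p : (E * R)%type => X p.1 i p.2).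

Variable X : E -> 'I_N -> R -> 'rV[R]_d.
Hypothesis mX : mfamily X.

Let Q := ((E * 'rV[R]_d) * R)%type.

Let mXQ i : measurable_fun [set: Q] (fun q : Q => X q.1.1 i q.2).
Proof.
apply: (measurableT_comp (mX i) (g := fun q : Q => (q.1.1, q.2))).
by apply: measurable_fun_pair => //; exact: (measurableT_comp measurable_fst measurable_fst).
Qed.

Let mzQ : measurable_fun [set: Q] (fun q : Q => q.1.2).
Proof. exact: (measurableT_comp measurable_snd measurable_fst). Qed.

Lemma measurable_self_density : measurable_fun [set: Q] (fun q : Q => self_density (X q.1.1) q.1.2 q.2).
Proof.
apply: measurable_funM => //; apply: measurable_sum => i.
by apply: (measurableT_comp mK); apply: measurable_subr.
Qed.

Lemma measurable_reg_density :
  measurable_fun [set: Q] (fun q : Q => reg_density K Nt ((X q.1.1)^~ q.2) q.1.2).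
Proof.
apply: measurable_funM => //.
rewrite (_ : (fun _ => _) = (fun q : Q => \sum_(i < N) if q.1.2 != X q.1.1 i q.2 then K (q.1.2 - X q.1.1 i q.2) else 0)); last first.
  by apply/funext => q; rewrite big_mkcond.
apply: measurable_sum => i; apply: measurable_fun_ifT => //.
- by apply: measurable_neg; apply: measurable_row_eq.
- by apply: (measurableT_comp mK); apply: measurable_subr.
Qed.

Let expo (g : E * 'rV[R]_d -> R -> R) : measurable_fun [set: Q] (fun q : Q => g q.1 q.2) ->
  measurable_fun [set: Q] (fun q : Q => c0 q.1.2 * expR (- lam * prim (g q.1) q.2)).
Proof.
move=> mg; apply: measurable_funM; first exact: (measurableT_comp mc0).
apply: (measurableT_comp (@measurable_expR R)); apply: measurable_funM => //.
exact: measurable_primitive.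
Qed.

Lemma measurable_self_field : measurable_fun [set: Q] (fun q : Q => self_field (X q.1.1) q.2 q.1.2).
Proof. exact: (expo (g := fun p s => self_density (X p.1) p.2 s) measurable_self_density). Qed.

Lemma measurable_excl_field : measurable_fun [set: Q] (fun q : Q => excl_field (X q.1.1) q.2 q.1.2).
Proof. exact: (expo (g := fun p s => reg_density K Nt ((X p.1)^~ s) p.2) measurable_reg_density). Qed.

Lemma measurable_env_drift i k : measurable_fun [set: (E * R)%type]
  (fun p : (E * R)%type => env_drift Rad m0 (self_field (X p.1) p.2) (X p.1 i p.2) ord0 k).
Proof.
pose G (q : ((E * R) * 'rV[R]_d)%type) :=
  kern Rad k (q.2 - X q.1.1 i q.1.2) * (1 - self_field (X q.1.1) q.1.2 q.2 / m0 q.2).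
rewrite (_ : (fun _ => _) = (fun p : (E * R)%type => \int[leb]_z G (p, z))); last first.
  by apply/funext => p; rewrite env_driftE.
apply: (@measurable_Rintegral _ _ _ _ _ leb G); apply: measurable_funM.
  apply: (measurableT_comp (measurable_kern Rad k)); apply: measurable_subr => //.
  exact: (measurableT_comp (mX i) measurable_fst).
apply: measurable_funB => //; apply: measurable_funM; last first.
  exact: (measurableT_comp (measurable_invm0 mm0 Mlow0 m0_ge) measurable_snd).
apply: (measurableT_comp measurable_self_field (g := fun q : ((E * R) * 'rV[R]_d)%type => (q.1.1, q.2, q.1.2))).
have m1 : measurable_fun [set: ((E * R) * 'rV[R]_d)%type] (fun q => q.1.1).
  exact: (measurableT_comp measurable_fst measurable_fst).
have m2 : measurable_fun [set: ((E * R) * 'rV[R]_d)%type] (fun q => q.1.2).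
  exact: (measurableT_comp measurable_snd measurable_fst).
apply: measurable_fun_pair => //; exact: measurable_fun_pair.
Qed.

Lemma measurable_trunc_force e k : measurable_fun setT (fun z => trunc_force A B alpha beta e z ord0 k).
Proof.
rewrite (_ : (fun _ => _) = (fun z => phi A B alpha beta (Num.max (enorm z) e) * z ord0 k)); last first.
  by apply/funext => z; rewrite mxE.
apply: measurable_funM; last exact: (measurable_rV_coord k).
have mm : measurable_fun setT (fun z : 'rV[R]_d => Num.max (enorm z) e).
  by apply: measurable_maxr => //; exact: measurable_enorm.
by apply: measurable_funB; apply: measurable_funM => //;
  exact: (measurableT_comp (measurable_powR (R := R) _) mm).
Qed.

Lemma measurable_tdrift e i k : measurable_fun [set: (E * R)%type]
  (fun p : (E * R)%type => tdrift e (X p.1) p.2 i ord0 k).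
Proof.
rewrite (_ : (fun _ => _) = (fun p : (E * R)%type =>
   nu * (\sum_j trunc_force A B alpha beta e (X p.1 i p.2 - X p.1 j p.2) ord0 k) +
   env_drift Rad m0 (self_field (X p.1) p.2) (X p.1 i p.2) ord0 k)); last first.
  by apply/funext => p; rewrite tdriftE.
apply: measurable_funD; last exact: measurable_env_drift.
apply: measurable_funM => //; apply: measurable_sum => j.
by apply: (measurableT_comp (measurable_trunc_force e k)); apply: measurable_subr; exact: mX.
Qed.

End measurability.

Definition mpath X := forall i, measurable_fun [set: R] (X i).

(** A single path is viewed as a constant family over a dummy parameter, so that results on families
    specialize to it. *)
Lemma mpath_family X : mpath X -> mfamily (fun _ : R => X).
Proof. by move=> mX i; exact: (measurableT_comp (mX i) measurable_snd). Qed.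

Lemma measurable_self_density1 X z : mpath X -> measurable_fun setT (self_density X z).
Proof. by move=> mX; exact: (measurable_fun_pair2 (0 : R, z) (measurable_self_density (mpath_family mX))). Qed.

Lemma measurable_reg_density1 X z : mpath X ->
  measurable_fun setT (fun s => reg_density K Nt (X^~ s) z).
Proof. by move=> mX; exact: (measurable_fun_pair2 (0 : R, z) (measurable_reg_density (mpath_family mX))). Qed.

Lemma measurable_self_field1 X s : mpath X -> measurable_fun setT (self_field X s).
Proof.
move=> mX; have h := measurable_fun_pair1 s (measurable_self_field (mpath_family mX)).
exact: (measurable_fun_pair2 (0 : R) h).
Qed.

Lemma measurable_excl_field1 X s : mpath X -> measurable_fun setT (excl_field X s).
Proof.
move=> mX; have h := measurable_fun_pair1 s (measurable_excl_field (mpath_family mX)).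
exact: (measurable_fun_pair2 (0 : R) h).
Qed.

Let field_range (u : R -> R) t z : measurable_fun setT u -> (forall s, `|u s| <= MK) -> 0 <= t <= T ->
  0 <= c0 z * expR (- lam * prim u t) <= field_max.
Proof.
move=> mu uM /andP[t0 tT]; have /andP[h0 h1] := c0_range z.
rewrite mulr_ge0 ?expR_ge0 //= ler_pM ?expR_ge0 // ler_expR.
by have [] := linear_bound (T := T) lam mu uM t0 tT.
Qed.

Lemma self_field_range X t z : mpath X -> 0 <= t <= T -> 0 <= self_field X t z <= field_max.
Proof. by move=> mX; apply: field_range; [exact: measurable_self_density1 | exact: self_density_bound]. Qed.

Lemma excl_field_range X t z : mpath X -> 0 <= t <= T -> 0 <= excl_field X t z <= field_max.
Proof.
by move=> mX; apply: field_range; [exact: measurable_reg_density1 | move=> s; exact: reg_density_bound].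
Qed.

Definition field_lipc := field_max * (`|lam| * (T * (LK * d%:R))).

Lemma field_lipc_ge0 : 0 <= field_lipc. Proof. by rewrite !mulr_ge0 ?expR_ge0. Qed.

(** The field at time [t] depends on the whole past of the particles, so the paths have to be close
    on all of [[0, t]]. *)
Lemma self_field_lip X Y t z e : mpath X -> mpath Y -> 0 <= t <= T -> 0 <= e ->
  (forall s i k, 0 <= s <= t -> `|X i s ord0 k - Y i s ord0 k| <= e) ->
  `|self_field X t z - self_field Y t z| <= field_lipc * e.
Proof.
move=> mX mY /andP[t0 tT] e0 XY; have /andP[h0 h1] := c0_range z.
have mdX := measurable_self_density1 z mX; have mdY := measurable_self_density1 z mY.
have [_ bX] := linear_bound (T := T) lam mdX (self_density_bound X z) t0 tT.
have [_ bY] := linear_bound (T := T) lam mdY (self_density_bound Y z) t0 tT.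
have -> : field_lipc * e = Cc * (expR (`|lam| * MK * T) * (`|lam| * (T * (LK * (d%:R * e))))) by rewrite /field_lipc /field_max; ring.
rewrite /self_field -mulrBr normrM (ger0_norm h0) ler_pM //.
rewrite (le_trans (expR_lip bX bY)) // ler_wpM2l ?expR_ge0//.
rewrite -mulrBr normrM normrN ler_wpM2l //.
rewrite /prim -RintegralB //; try by apply: prim_integrable => //; exact: self_density_bound.
have := @Rintegral_le_bound _ _ _ mul `[0, t]%classic (fun s => self_density X z s - self_density Y z s) (LK * (d%:R * e)).
move=> H; apply: (le_trans (H _ _ _ _)) => //.
- exact: lebesgue_cc_lty.
- by apply: measurable_funTS; apply: measurable_funB.
- by move=> s; rewrite /= in_itv /= => /andP[s0 st]; apply: self_density_lip => // i k; apply: XY; rewrite s0.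
rewrite -[X in fine X]/(lebesgue_measure `[0, t]) lebesgue_cc // subr0 /= mulrC ler_wpM2r //.
by rewrite mulr_ge0 // mulr_ge0.
Qed.

Section truncated.
Variable e : R.
Hypothesis e01 : 0 < e <= 1.

Let Fb := force_cst A B alpha beta * e `^ (- alpha - 1).
Let Fl := force_cst A B alpha beta * e `^ (- alpha - 2).
Let Fb0 : 0 <= Fb. Proof. by rewrite mulr_ge0 ?powR_ge0 // ltW // force_cst_gt0 // (lt_trans beta0). Qed.
Let Fl0 : 0 <= Fl. Proof. by rewrite mulr_ge0 ?powR_ge0 // ltW // force_cst_gt0 // (lt_trans beta0). Qed.

Definition tdrift_max := force_cst A B alpha beta * e `^ (- alpha - 1) + (1 + field_max / Mlow) * (2 * Rad) ^+ d.

Lemma tdrift_bound X s i k : mpath X -> 0 <= s <= T -> `|tdrift e X s i ord0 k| <= tdrift_max.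
Proof.
move=> mX sT; rewrite tdriftE (le_trans (ler_normD _ _)) // lerD //.
  apply: sum_le => // j.
  by rewrite (le_trans (coord_le_enorm _ _)) // enorm_trunc_force.
apply: env_drift_bound => //; first exact: measurable_self_field1.
by move=> z; exact: self_field_range.
Qed.

Definition tdrift_lipc := force_cst A B alpha beta * e `^ (- alpha - 2) * (d%:R * 2)
   + ((1 + field_max / Mlow) * (6 * (2 * Rad) ^+ d.-1) * d%:R + field_lipc / Mlow * (2 * Rad) ^+ d).

Lemma tdrift_lipc_ge0 : 0 <= tdrift_lipc.
Proof.
have Cv0 := field_max_ge0; have Lf0 := field_lipc_ge0.
have R2 : 0 <= 2 * Rad by rewrite mulr_ge0 // ltW.
have i0 : 0 <= Mlow^-1 by rewrite invr_ge0 ltW.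
have M1 : 0 <= 1 + field_max / Mlow by rewrite addr_ge0 // mulr_ge0.
have e6 : 0 <= (2 * Rad) ^+ d.-1 by exact: exprn_ge0.
have e7 : 0 <= (2 * Rad) ^+ d by exact: exprn_ge0.
have e8 : (0 : R) <= d%:R * 2 by rewrite mulr_ge0.
have e9 : 0 <= field_lipc / Mlow by exact: mulr_ge0.
rewrite /tdrift_lipc -/Fl; apply: addr_ge0; first exact: mulr_ge0.
by apply: addr_ge0; rewrite ?(mulr_ge0 e9)// mulr_ge0 // mulr_ge0 // mulr_ge0.
Qed.

Lemma tdrift_lip X Y s i k a : mpath X -> mpath Y -> 0 <= s <= T -> 0 <= a ->
  (forall r j m, 0 <= r <= s -> `|X j r ord0 m - Y j r ord0 m| <= a) ->
  `|tdrift e X s i ord0 k - tdrift e Y s i ord0 k| <= tdrift_lipc * a.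
Proof.
move=> mX mY sT a0 XY; have /andP[s0 _] := sT.
have XYs j m : `|X j s ord0 m - Y j s ord0 m| <= a by apply: XY; rewrite s0 lexx.
pose S1 := \sum_j trunc_force A B alpha beta e (X i s - X j s) ord0 k.
pose S2 := \sum_j trunc_force A B alpha beta e (Y i s - Y j s) ord0 k.
pose E1 := env_drift Rad m0 (self_field X s) (X i s) ord0 k.
pose E2 := env_drift Rad m0 (self_field Y s) (Y i s) ord0 k.
pose E3 := env_drift Rad m0 (self_field X s) (Y i s) ord0 k.
(* [E3], with the field of [X] and the position of [Y], separates the change of position from the
   change of field. *)
have -> : tdrift e X s i ord0 k - tdrift e Y s i ord0 k = nu * (S1 - S2) + ((E1 - E3) + (E3 - E2)).
  transitivity (nu * S1 + E1 - (nu * S2 + E2)); last by ring.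
  by congr (_ - _); exact: tdriftE.
rewrite /S1 /S2 -sumrB.
rewrite /tdrift_lipc (mulrDl _ _ a) (mulrDl _ _ a) (le_trans (ler_normD _ _)) // lerD //.
  apply: sum_le; first by rewrite mulr_ge0 // mulr_ge0 // mulr_ge0.
  move=> j; have := coord_le_enorm (trunc_force A B alpha beta e (X i s - X j s) - trunc_force A B alpha beta e (Y i s - Y j s)) k.
  rewrite mxE [X in _ + X]mxE => /le_trans; apply.
  apply: (le_trans (trunc_force_lip A0 B0 beta0 ab _ _ e01)); rewrite -[leRHS]mulrA ler_wpM2l // -mulrA.
  apply: enorm_le_coord => m; rewrite !mxE.
  rewrite [X in `|X|](_ : _ = (X i s ord0 m - Y i s ord0 m) - (X j s ord0 m - Y j s ord0 m)); last by ring.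
  by rewrite (le_trans (ler_normB _ _)) // mulr2n mulrDl !mul1r lerD.
have mfX := measurable_self_field1 s mX; have mfY := measurable_self_field1 s mY.
have rX z : 0 <= self_field X s z <= field_max by exact: self_field_range.
have rY z : 0 <= self_field Y s z <= field_max by exact: self_field_range.
have Cv0 := field_max_ge0.
rewrite (le_trans (ler_normD _ _)) // lerD //.
  apply: (le_trans (env_drift_lip Rad0 mm0 Mlow0 m0_ge Cv0 _ _ _ mfX rX)); rewrite -[leRHS]mulrA ler_wpM2l //.
    rewrite mulr_ge0 ?addr_ge0 ?divr_ge0 ?(ltW Mlow0) // mulr_ge0 // exprn_ge0 // mulr_ge0 // ltW //.
  rewrite (@le_trans _ _ (\sum_(m < d) a)) //; last by rewrite sumr_const card_ord mulr_natl.
  by apply: ler_sum.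
have H := env_drift_field_lip Rad0 mm0 Mlow0 m0_ge (Y i s) k mfX rX mfY rY (e := field_lipc * a).
apply: (le_trans (H _)); first by move=> z; apply: self_field_lip.
rewrite le_eqVlt; apply/orP; left; apply/eqP; ring.
Qed.

End truncated.

End particle_fields.

(** * Removing the self-interaction on a null set *)

Section exclusion.
Context (R : realType).
Notation mul := (@lebesgue_measure R).

Lemma lebesgue_rV_point d (x : 'rV[R]_d) : (0 < d)%N -> (lebesgue_rV [set x] = 0)%E.
Proof.
move=> d0; rewrite (_ : [set x] = [set z : 'rV[R]_d | forall k, [set x ord0 k] (z ord0 k)]); last first.
  apply/seteqP; split => [z -> //|z /= zx]; apply/rowP => k; exact: zx.
rewrite (lebesgue_rV_box (E := fun k => [set x ord0 k])) //.
by rewrite (bigD1 (Ordinal d0)) //= lebesgue_measure_set1 mul0e.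
Qed.

Lemma measurable_set1_rV d (x : 'rV[R]_d) : measurable [set x].
Proof.
rewrite (_ : [set x] = (fun z => z == x) @^-1` [set true]); last first.
  by apply/seteqP; split => [z /= ->|z /= /eqP //]; rewrite eqxx.
by rewrite -[X in measurable X]setTI; apply: measurable_row_eq.
Qed.

Lemma ae_neq_points d n (x : 'I_n -> 'rV[R]_d) : (0 < d)%N ->
  {ae @lebesgue_rV R d, forall z, forall i, z != x i}.
Proof.
move=> d0; apply: filter_forall => i; exists [set x i]; split.
- exact: measurable_set1_rV.
- exact: lebesgue_rV_point.
- by move=> z /= /negP; rewrite negbK => /eqP.
Qed.

(** Tonelli exchanges the quantifiers: agreement for almost every [z] at each time becomes, for
    almost every [z], agreement at almost every time. The exceptional set of points does not depend
    on the domain [D]. *)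
Lemma ae_fubini_eq d (T : measurableType d) (m : {sigma_finite_measure set T -> \bar R})
    (u v : T -> R -> R) :
  measurable_fun [set: (T * R)%type] (fun p => u p.1 p.2) ->
  measurable_fun [set: (T * R)%type] (fun p => v p.1 p.2) ->
  (forall s, {ae m, forall z, u z s = v z s}) ->
  {ae m, forall z, forall D, measurable D ->
    \int[mul]_(s in D) u z s = \int[mul]_(s in D) v z s}.
Proof.
move=> mU mV uv.
pose f (p : (T * measurableTypeR R)%type) : \bar R := `|u p.1 p.2 - v p.1 p.2|%:E.
have mf : measurable_fun setT f.
  by apply/measurable_EFinP; apply: measurableT_comp => //; exact: measurable_funB.
have f0 p : (0 <= f p)%E by rewrite lee_fin.
have H : (\int[m]_z \int[mul]_s f (z, s) = 0)%E.
  rewrite (fubini_tonelli f mf f0) integral0_eq // => s _.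
  rewrite (ge0_ae_eq_integral (g := cst 0%E)) //.
  - by rewrite integral0.
  - exact: (measurable_fun_pair1 s mf).
  - by apply: filterS (uv s) => z zE _; rewrite /f /= zE subrr normr0.
have mF : measurable_fun setT (fun z => (\int[mul]_s f (z, s))%E).
  exact: measurable_fun_fubini_tonelli_F.
have /(ae_eq_integral_abs m measurableT mF) : (\int[m]_z `|\int[mul]_s f (z, s)| = 0)%E.
  by rewrite -[RHS]H; apply: eq_integral => z _; rewrite gee0_abs // integral_ge0.
apply: filterS => z /(_ Logic.I) fz D mD.
have mfz : measurable_fun setT (fun s => f (z, s)) by exact: (measurable_fun_pair2 z mf).
have : (\int[mul]_s `|f (z, s)| = 0)%E.
  by rewrite -[RHS]fz; apply: eq_integral => s _; rewrite gee0_abs.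
move=> /(ae_eq_integral_abs mul measurableT mfz) fz0.
rewrite /Rintegral; congr fine; apply: ae_eq_integral => //.
- apply/measurable_funTS/measurable_EFinP; exact: (measurable_fun_pair2 z mU).
- apply/measurable_funTS/measurable_EFinP; exact: (measurable_fun_pair2 z mV).
- apply: filterS fz0 => s /(_ Logic.I) /= [h] _; congr EFin.
  by apply/eqP; rewrite -subr_eq0 -normr_eq0 h.
Qed.

Lemma env_drift_ae d (Rad Mlow : R) (m0 v v' : 'rV[R]_d -> R) x : measurable_fun setT m0 ->
  0 < Mlow -> (forall z, Mlow <= m0 z) ->
  measurable_fun setT v -> measurable_fun setT v' -> {ae @lebesgue_rV R d, forall z, v z = v' z} ->
  env_drift Rad m0 v x = env_drift Rad m0 v' x.
Proof.
move=> mm0 Mlow0 m0_ge mv mv' vv'; apply/rowP => k; rewrite !env_driftE.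
have mk (w : 'rV[R]_d -> R) : measurable_fun setT w -> measurable_fun setT (fun z : 'rV[R]_d => kern Rad k (z - x) * (1 - w z / m0 z)).
  move=> mw; apply: measurable_funM.
    by apply: (measurableT_comp (measurable_kern Rad k)); apply: measurable_subr.
  apply: measurable_funB => //; apply: measurable_funM => //; exact: measurable_invm0 Mlow0 m0_ge.
rewrite /Rintegral; congr fine; apply: ae_eq_integral => //.
- by apply/measurable_EFinP; exact: mk.
- by apply/measurable_EFinP; exact: mk.
- by apply: filterS vv' => z -> _.
Qed.

(** At a given time the two densities differ at the particle positions only, finitely many points.
    The field accumulates the density over the past, along which these points move, and
    [ae_fubini_eq] keeps the exceptional set null. *)
Lemma env_drift_excl_field d N Nt (Rad lam Mlow : R) (m0 K c0 : 'rV[R]_d -> R) (X : 'I_N -> R -> 'rV[R]_d) s x :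
  (0 < d)%N -> measurable_fun setT m0 -> 0 < Mlow -> (forall z, Mlow <= m0 z) ->
  measurable_fun setT K -> measurable_fun setT c0 -> mpath X ->
  env_drift Rad m0 (excl_field Nt lam K c0 X s) x = env_drift Rad m0 (self_field Nt lam K c0 X s) x.
Proof.
move=> d0 mm0 Mlow0 m0_ge mK mc0 mX; apply: (@env_drift_ae _ _ Mlow) => //.
- exact: measurable_excl_field1.
- exact: measurable_self_field1.
have H r : {ae @lebesgue_rV R d, forall z, reg_density K Nt (X^~ r) z = self_density Nt K X z r}.
  apply: filterS (ae_neq_points (X^~ r) d0) => z zX; rewrite /reg_density /self_density; congr (_ * _).
  by apply: eq_bigl => i; rewrite zX.
have g : measurable_fun [set: ('rV[R]_d * R)%type] (fun p => ((0 : R), p.1, p.2)).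
  by apply: measurable_fun_pair => //; exact: measurable_fun_pair.
have mr := measurableT_comp (measurable_reg_density Nt mK (mpath_family mX)) g.
have md := measurableT_comp (measurable_self_density Nt mK (mpath_family mX)) g.
have := ae_fubini_eq mr md H; apply: filterS => z Hz.
by rewrite /excl_field /self_field /prim /= (Hz _ (measurable_itv _)).
Qed.

End exclusion.

Section sequences.
Context (R : realType).
Implicit Types u : nat -> R.

Lemma geometric_small (C e : R) : 0 < e -> exists n : nat, C * 2^-1 ^+ n <= e.
Proof.
move=> e0; exists (Num.truncn (`|C| / e)); set n := Num.truncn _.
have p0 : (0 : R) < 2 ^+ n by rewrite exprn_gt0.
rewrite exprVn ler_pdivrMr // mulrC -ler_pdivrMr // (le_trans (y := `|C| / e)) //.
  by rewrite ler_wpM2r ?invr_ge0 ?(ltW e0)// ler_norm.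
have h : `|C| / e < n.+1%:R by exact: truncnS_gt.
rewrite (le_trans (ltW h)) // -natrX ler_nat; exact: ltn_expl.
Qed.

Lemma geometric_eq0 (x C : R) : (forall n, `|x| <= C * 2^-1 ^+ n) -> x = 0.
Proof.
move=> H; apply/eqP; rewrite -normr_le0; apply/ler_addgt0Pr => e e0; rewrite add0r.
by have [n] := geometric_small C e0; exact: le_trans.
Qed.

(** With [g n] the tail of the geometric series, [u - g] increases and [u + g] decreases. They
    enclose [u] and deliver the limit together with the rate. *)
Lemma geometric_cauchy u (C : R) : (forall n, `|u n.+1 - u n| <= C * 2^-1 ^+ n) ->
  u @ \oo --> lim (u @ \oo) /\ forall n, `|u n - lim (u @ \oo)| <= 2 * C * 2^-1 ^+ n.
Proof.
move=> H; pose g n : R := 2 * C * 2^-1 ^+ n.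
have gS n : g n.+1 = g n - C * 2^-1 ^+ n by rewrite /g exprS; field.
have H2 n : u n - C * 2^-1 ^+ n <= u n.+1 <= u n + C * 2^-1 ^+ n.
  by have := H n; rewrite ler_norml => /andP[h1 h2]; apply/andP; split; lra.
have g0 n : 0 <= g n.
  have C0 : 0 <= C by have := H 0%N; rewrite expr0 mulr1; exact: le_trans.
  by rewrite /g !mulr_ge0 // exprn_ge0 // invr_ge0.
pose a n := u n - g n; pose b n := u n + g n.
have ai : nondecreasing_seq a.
  apply/nondecreasing_seqP => n; rewrite /a gS; have /andP[h1 _] := H2 n; lra.
have bd : nonincreasing_seq b.
  apply/nonincreasing_seqP => n; rewrite /b gS; have /andP[_ h2] := H2 n; lra.
have ab n m : a n <= b m.
  apply: (@le_trans _ _ (a (maxn n m))); first by apply: ai; exact: leq_maxl.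
  apply: (@le_trans _ _ (b (maxn n m))); last by apply: bd; exact: leq_maxr.
  rewrite /a /b; have := g0 (maxn n m); lra.
have ca : cvgn a.
  by apply: nondecreasing_is_cvgn => //; exists (b 0%N) => _ [n _ <-]; exact: ab.
pose l := limn a.
have al n : a n <= l by exact: nondecreasing_cvgn_le.
have lb n : l <= b n by apply: limr_le => //; near=> m; exact: ab.
have ul n : `|u n - l| <= g n.
  have := al n; have := lb n; rewrite /a /b => h1 h2.
  by rewrite ler_norml; apply/andP; split; lra.
have ucv : u @ \oo --> l.
  apply/cvgrPdist_le => e e0; have [n0 gn] := geometric_small (2 * C) e0.
  exists n0 => // n /= n0n; rewrite distrC (le_trans (ul n)) // (le_trans _ gn) //.
  have C0 : 0 <= 2 * C by have := g0 0%N; rewrite /g expr0 mulr1.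
  by rewrite ler_wpM2l // ler_wiXn2l // invf_le1 // ler1n.
by rewrite (cvg_lim _ ucv).
Unshelve. all: by end_near. Qed.

End sequences.

(** * Picard iteration *)

Section picard_iteration.
Context (R : realType) (d N : nat) (T G L : R).
Notation path := ('I_N -> R -> 'rV[R]_d).
Variable b : path -> R -> 'I_N -> 'rV[R]_d.
Hypothesis T0 : 0 <= T.
Hypothesis L0 : 0 <= L.
Hypothesis bM : forall X s i k, mpath X -> 0 <= s <= T -> `|b X s i ord0 k| <= G.
Hypothesis bL : forall X Y s i k a, mpath X -> mpath Y -> 0 <= s <= T -> 0 <= a ->
  (forall r j m, 0 <= r <= s -> `|X j r ord0 m - Y j r ord0 m| <= a) ->
  `|b X s i ord0 k - b Y s i ord0 k| <= L * a.
Hypothesis bmeas : forall d' (E : measurableType d') (X : E -> path) i k, mfamily X ->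
  measurable_fun [set: (E * R)%type] (fun p : (E * R)%type => b (X p.1) p.2 i ord0 k).
Implicit Types (X Y Z : path) (s t : R).
Notation mul := (@lebesgue_measure R).

(** The projection onto [[0, T]]. Paths are total functions of time, and composing with it turns
    continuity within [[0, T]] into continuity on the whole line. *)
Definition clamp t : R := Num.max 0 (Num.min t T).

Lemma clamp_range t : 0 <= clamp t <= T.
Proof. by rewrite /clamp le_max lexx /= ge_max T0 ge_min lexx orbT. Qed.

Lemma clamp_id t : 0 <= t <= T -> clamp t = t.
Proof. by move=> /andP[t0 tT]; rewrite /clamp min_l // max_r. Qed.

Lemma clampK t : clamp (clamp t) = clamp t.
Proof. exact/clamp_id/clamp_range. Qed.

Lemma clamp_lip s t : s <= t -> clamp s <= clamp t <= clamp s + (t - s).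
Proof. by move=> st; rewrite /clamp /Num.max /Num.min; do !case: ifP; lra. Qed.

Definition picard_map Z X i t : 'rV[R]_d :=
  Z i (clamp t) + \row_k \int[mul]_(s in `[0, clamp t]) b X s i ord0 k.

Definition cpath X := forall i k, continuous (fun t => X i t ord0 k).

Lemma cpath_mpath X : cpath X -> mpath X.
Proof.
move=> cX i; apply: measurable_fun_rVP => k.
exact: (continuous_measurable_fun (cX i k)).
Qed.

Lemma measurable_b1 X i k : mpath X -> measurable_fun setT (fun s => b X s i ord0 k).
Proof.
by move=> mX; exact: (measurable_fun_pair2 (0 : R) (bmeas i k (mpath_family mX))).
Qed.

Lemma b_integrable X i k t : mpath X -> t <= T ->
  mul.-integrable `[0, t] (EFin \o (fun s => b X s i ord0 k)).
Proof.
move=> mX tT; apply: (integrable_bounded (M := G)) => //; first exact: lebesgue_cc_lty.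
  by apply: measurable_funTS; exact: measurable_b1.
by move=> s; rewrite /= in_itv /= => /andP[s0 st]; apply: bM => //; rewrite s0 (le_trans st).
Qed.

Lemma b_increment X i k s t a c : mpath X -> 0 <= s -> s <= t -> t <= T ->
  (forall r, s <= r <= t -> `|b X r i ord0 k - a| <= c) ->
  `|\int[mul]_(r in `[0, t]) b X r i ord0 k - \int[mul]_(r in `[0, s]) b X r i ord0 k - (t - s) * a|
    <= (t - s) * c.
Proof. by move=> mX s0 st tT; apply: Rintegral_increment => //; exact: b_integrable. Qed.

Lemma b_int_lip X i k s t : mpath X -> 0 <= s -> s <= t -> t <= T ->
  `|\int[mul]_(r in `[0, t]) b X r i ord0 k - \int[mul]_(r in `[0, s]) b X r i ord0 k| <= (t - s) * G.
Proof.
move=> mX s0 st tT; have := @b_increment X i k s t 0 G mX s0 st tT.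
rewrite mulr0 subr0; apply => r /andP[sr rt]; rewrite subr0 bM //.
by rewrite (le_trans s0 sr) (le_trans rt tT).
Qed.

Lemma picard_map_continuous Z X : cpath (fun i t => Z i (clamp t)) -> mpath X -> cpath (picard_map Z X).
Proof.
move=> cZ mX i k.
rewrite (_ : (fun t => _) = (fun t => Z i (clamp t) ord0 k + \int[mul]_(s in `[0, clamp t]) b X s i ord0 k)); last first.
  by apply/funext => t; rewrite !mxE.
move=> t; apply: cvgD; first exact: cZ.
have lip s r : `|\int[mul]_(u in `[0, clamp s]) b X u i ord0 k - \int[mul]_(u in `[0, clamp r]) b X u i ord0 k| <= `|s - r| * `|G|.
  wlog rs : s r / r <= s => [H|].
    have [/H//|/ltW/H] := leP r s; by rewrite distrC [`|r - s|]distrC.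
  have /andP[c1 c2] := clamp_lip rs; have /andP[c3 c4] := clamp_range s; have /andP[c5 c6] := clamp_range r.
  rewrite (le_trans (b_int_lip i k mX c5 c1 c4)) // (le_trans (ler_wpM2l _ (ler_norm G))) ?subr_ge0//.
  by rewrite ler_wpM2r // (ger0_norm (_ : 0 <= s - r)) ?subr_ge0//; lra.
apply/cvgrPdist_le => e e0; exists (e / (`|G| + 1)) => /=; first by rewrite divr_gt0 // ltr_wpDl.
move=> s /= ts; rewrite (le_trans (lip _ _)) //.
have G1 : 0 < `|G| + 1 by rewrite ltr_wpDl.
move/ltW: ts; rewrite ler_pdivlMr // => /(le_trans _); apply; rewrite ler_wpM2l //; lra.
Qed.

(** The exponential solves the field equation with density 1 and rate [- Lam], which supplies its
    primitive. *)
Lemma integral_expR (Lam t : R) : 0 <= t <= T -> 0 < Lam ->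
  mul.-integrable `[0, t] (EFin \o (fun s => expR (Lam * s))) /\
  \int[mul]_(s in `[0, t]) expR (Lam * s) <= expR (Lam * t) / Lam.
Proof.
move=> /andP[t0 tT] L1.
have pE s : 0 <= s -> prim (fun=> 1) s = s.
  by move=> s0; rewrite /prim Rintegral_cst // -[X in fine X]/(lebesgue_measure `[0, s]) lebesgue_cc // subr0 mul1r.
have m1 : measurable_fun [set: R] (fun=> 1 : R) by [].
have b1 (s : R) : `|1 : R| <= 1 by rewrite normr1.
have [ii H] := linear_exists (- Lam) t0 m1 b1 1.
have E s : 0 <= s -> 1 * expR (- - Lam * prim (fun=> 1) s) * 1 = expR (Lam * s).
  by move=> s0; rewrite opprK pE // mul1r mulr1.
have iE : mul.-integrable `[0, t] (EFin \o (fun s => expR (Lam * s))).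
  by apply: eq_integrable ii => // s; rewrite inE /= in_itv /= => /andP[s0 _]; rewrite E.
split=> //; have := H t; rewrite t0 lexx => /(_ isT).
rewrite opprK pE // mul1r mulNr opprK => e1.
have -> : \int[mul]_(s in `[0, t]) expR (Lam * s) =
   \int[mul]_(s in `[0, t]) (1 * expR (Lam * prim (fun=> 1) s) * 1).
  by apply: eq_Rintegral => s; rewrite inE /= in_itv /= => /andP[s0 _]; rewrite -E // opprK.
by rewrite ler_pdivlMr // mulrC e1 lerDr.
Qed.

(* The exponential weight makes the Picard map a contraction by 1/2. *)
Lemma contraction X Y Lam D T' : mpath X -> mpath Y -> 0 <= D -> 0 < Lam -> 2 * L <= Lam -> T' <= T ->
  (forall r j m, 0 <= r <= T' -> `|X j r ord0 m - Y j r ord0 m| <= D * expR (Lam * r)) ->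
  forall t i k, 0 <= t <= T' ->
  `|\int[mul]_(s in `[0, t]) b X s i ord0 k - \int[mul]_(s in `[0, t]) b Y s i ord0 k|
    <= D * 2^-1 * expR (Lam * t).
Proof.
move=> mX mY D0 Lam0 LL T'T XY t i k /andP[t0 tT'].
have tT : t <= T by exact: le_trans T'T.
have [iE HE] := @integral_expR Lam t (introT andP (conj t0 tT)) Lam0.
have iX := b_integrable i k mX tT; have iY := b_integrable i k mY tT.
rewrite -(RintegralB _ iX iY) //.
have iB := integrableB _ iX iY; move/(_ (measurable_itv _)) : iB => iB.
apply: le_trans (le_normr_Rintegral _ _) _ => //.
apply: (@le_trans _ _ (\int[mul]_(s in `[0, t]) (L * D * expR (Lam * s)))).
  apply: le_Rintegral => //.
  - exact: integrable_norm iB.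
  - have := integrableZl _ (L * D) iE => /(_ (measurable_itv _)).
    by apply: eq_integrable.
  - move=> s; rewrite /= in_itv /= => /andP[s0 st]; rewrite -mulrA; apply: bL => //.
    + by rewrite s0 (le_trans st).
    + by rewrite mulr_ge0 // expR_ge0.
    move=> r j m /andP[r0 rs]; rewrite (le_trans (XY _ _ _ _)) ?r0 ?(le_trans rs) ?(le_trans st)//.
    by rewrite ler_wpM2l // ler_expR ler_wpM2l // ltW.
rewrite RintegralZl // (le_trans (ler_wpM2l _ HE)) ?mulr_ge0//.
rewrite [leLHS](_ : _ = D * (L / Lam) * expR (Lam * t)); last by ring.
by rewrite ler_wpM2r ?expR_ge0// ler_wpM2l // ler_pdivrMr //; lra.
Qed.

(** The summand 1 keeps the weight positive when [L = 0]. *)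
Let Lam := 2 * L + 1.
Let Lam0 : 0 < Lam. Proof. by rewrite /Lam ltr_wpDl // mulr_ge0. Qed.
Let LLam : 2 * L <= Lam. Proof. by rewrite /Lam lerDl. Qed.

Definition solves Z X T' := forall i t, 0 <= t <= T' ->
  X i t = Z i t + \row_k \int[mul]_(s in `[0, t]) b X s i ord0 k.

(** Each application of the contraction halves the weighted distance, which starts from the bound
    [T * G] on each of the two integrals. The horizon [T'] is left free in order to compare
    solutions up to an intermediate time. *)
Lemma solves_unique Z X Y T' : mpath X -> mpath Y -> T' <= T ->
  solves Z X T' -> solves Z Y T' -> forall i t, 0 <= t <= T' -> X i t = Y i t.
Proof.
move=> mX mY T'T sX sY i t tT; apply/rowP => k; apply/eqP; rewrite -subr_eq0; apply/eqP.
have eqB j r m : 0 <= r <= T' -> X j r ord0 m - Y j r ord0 m =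
   \int[mul]_(s in `[0, r]) b X s j ord0 m - \int[mul]_(s in `[0, r]) b Y s j ord0 m.
  by move=> rT; rewrite sX // sY // !mxE; ring.
have G0 : 0 <= G.
  by have := bM i k mX (_ : 0 <= 0 <= T); rewrite lexx => /(_ T0); exact: le_trans.
have H n : forall r j m, 0 <= r <= T' ->
    `|X j r ord0 m - Y j r ord0 m| <= (2 * (T * G) * 2^-1 ^+ n) * expR (Lam * r).
  elim: n => [|n IH] r j m rT.
    have /andP[r0 rT'] := rT; have rT2 := le_trans rT' T'T.
    have bnd W : mpath W -> `|\int[mul]_(s in `[0, r]) b W s j ord0 m| <= T * G.
      move=> mW; have := b_int_lip j m mW (lexx 0) r0 rT2.
      rewrite set_itv1 Rintegral_set1 !subr0 => /le_trans; apply; exact: ler_wpM2r.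
    rewrite eqB // expr0 mulr1 (le_trans (ler_normB _ _)) //.
    apply: (@le_trans _ _ (2 * (T * G) * 1)).
      by rewrite mulr1 mulr_natl mulr2n lerD // bnd.
    by rewrite ler_wpM2l ?mulr_ge0// -expR0 ler_expR mulr_ge0 // ltW.
  rewrite eqB // (_ : 2 * (T * G) * 2^-1 ^+ n.+1 = 2 * (T * G) * 2^-1 ^+ n * 2^-1); last by rewrite exprSr [LHS]mulrA.
    apply: (contraction mX mY _ Lam0 LLam T'T IH) => //.
  by rewrite !mulr_ge0 // exprn_ge0 // invr_ge0.
apply: (@geometric_eq0 _ _ (2 * (T * G) * expR (Lam * t))) => n.
by rewrite mulrAC; exact: H.
Qed.

Definition picard Z n : path := iter n (picard_map Z) (fun i t => Z i (clamp t)).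
Definition picard_sol Z : path := fun i t => \row_k limn (fun n => picard Z n i t ord0 k).

Lemma picard_clamp Z n i t : picard Z n i (clamp t) = picard Z n i t.
Proof. by case: n => [|n] /=; rewrite ?/picard_map !clampK. Qed.

Section one_path.
Variable Z : path.
Hypothesis cZ : cpath (fun i t => Z i (clamp t)).

Lemma picard_cpath n : cpath (picard Z n).
Proof. by elim: n => [//|n IH] /=; apply: picard_map_continuous => //; exact: cpath_mpath. Qed.

Arguments picard_cpath : clear implicits.

Let G0 (i : 'I_N) (k : 'I_d) : 0 <= G.
Proof.
have := bM i k (cpath_mpath (picard_cpath 0)) (_ : 0 <= 0 <= T).
by rewrite lexx => /(_ T0); exact: le_trans.
Qed.

Let C0 := T * G.

Lemma picard_step n : forall r j m, 0 <= r <= T ->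
  `|picard Z n.+1 j r ord0 m - picard Z n j r ord0 m| <= (C0 * 2^-1 ^+ n) * expR (Lam * r).
Proof.
have m_ n' := cpath_mpath (picard_cpath n').
elim: n => [|n IH] r j m rT.
  have /andP[r0 rT'] := rT; rewrite /= /picard_map clamp_id // !mxE addrAC subrr add0r expr0 mulr1.
  have := b_int_lip j m (m_ 0%N) (lexx 0) r0 rT'.
  rewrite set_itv1 Rintegral_set1 !subr0 => /le_trans; apply.
  have g0 := G0 j m.
  apply: (@le_trans _ _ (C0 * 1)); first by rewrite mulr1 ler_wpM2r.
  by rewrite ler_wpM2l ?mulr_ge0// -expR0 ler_expR mulr_ge0 // ltW.
have E W : picard_map Z W j r ord0 m = Z j r ord0 m + \int[mul]_(s in `[0, r]) b W s j ord0 m.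
  by rewrite /picard_map clamp_id // !mxE.
rewrite -[picard Z n.+2]/(picard_map Z (picard Z n.+1)) -[picard Z n.+1]/(picard_map Z (picard Z n)) !E.
rewrite [X in `|X|](_ : _ = \int[mul]_(s in `[0, r]) b (picard Z n.+1) s j ord0 m -
   \int[mul]_(s in `[0, r]) b (picard Z n) s j ord0 m); last by ring.
rewrite (_ : C0 * 2^-1 ^+ n.+1 = C0 * 2^-1 ^+ n * 2^-1); last by rewrite exprSr mulrA.
apply: (contraction (m_ _) (m_ _) _ Lam0 LLam (lexx _) IH) => //.
by rewrite !mulr_ge0 ?(G0 j m)// exprn_ge0 // invr_ge0.
Qed.

Let C1 := C0 * expR (Lam * T).

Lemma picard_cvg i t k : (fun n => picard Z n i t ord0 k) @ \oo --> picard_sol Z i t ord0 k /\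
  forall n, `|picard Z n i t ord0 k - picard_sol Z i t ord0 k| <= 2 * C1 * 2^-1 ^+ n.
Proof.
rewrite mxE; apply: geometric_cauchy => n; rewrite -picard_clamp -(picard_clamp Z n).
have /andP[c0 c1] := clamp_range t.
rewrite (le_trans (picard_step n i k (clamp_range t))) // /C1 mulrAC ler_wpM2r ?exprn_ge0 ?invr_ge0//.
by rewrite ler_wpM2l ?mulr_ge0 ?(G0 i k)// ler_expR ler_wpM2l // ltW.
Qed.

Lemma picard_sol_mpath : mpath (picard_sol Z).
Proof.
move=> i; apply: measurable_fun_rVP => k.
apply: (@measurable_realfun.measurable_fun_cvg _ _ _ _ (fun n t => picard Z n i t ord0 k)).
  by move=> n; exact: (continuous_measurable_fun (picard_cpath n i k)).
by move=> t _; have [] := picard_cvg i t k.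
Qed.

(** The geometric rate of [picard_cvg], inserted in the contraction estimate, passes to the limit
    inside the integral at every time. *)
Lemma picard_sol_map i t : picard_sol Z i t = picard_map Z (picard_sol Z) i t.
Proof.
apply/rowP => k; apply/eqP; rewrite -subr_eq0; apply/eqP.
have g0 := G0 i k; have C10 : 0 <= C1 by rewrite !mulr_ge0 // expR_ge0.
apply: (@geometric_eq0 _ _ (2 * C1 * (1 + expR (Lam * T)))) => n.
have [_ H] := picard_cvg i t k.
rewrite -(subrK (picard Z n.+1 i t ord0 k) (picard_sol Z i t ord0 k)) -addrA (le_trans (ler_normD _ _)) //.
rewrite mulrDr mulrDl mulr1 lerD //.
  rewrite distrC (le_trans (H n.+1)) // ler_wpM2l ?mulr_ge0// exprS ler_piMl ?exprn_ge0 ?invr_ge0//.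
  by rewrite invf_le1 // ler1n.
have -> : picard Z n.+1 i t ord0 k - picard_map Z (picard_sol Z) i t ord0 k =
    \int[mul]_(s in `[0, clamp t]) b (picard Z n) s i ord0 k - \int[mul]_(s in `[0, clamp t]) b (picard_sol Z) s i ord0 k.
  by rewrite /= /picard_map !mxE; ring.
have D0 : 0 <= 2 * C1 * 2^-1 ^+ n by rewrite !mulr_ge0 // exprn_ge0 // invr_ge0.
have Hn r j m : 0 <= r <= T -> `|picard Z n j r ord0 m - picard_sol Z j r ord0 m| <= 2 * C1 * 2^-1 ^+ n * expR (Lam * r).
  move=> /andP[r0 _]; have [_ /(_ n)/le_trans] := picard_cvg j r m; apply.
  by rewrite ler_peMr // -expR0 ler_expR mulr_ge0 // ltW.
apply: (le_trans (contraction (cpath_mpath (picard_cpath n)) picard_sol_mpath D0 Lam0 LLam (lexx _) Hn i k (clamp_range t))).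
have /andP[c0 c1] := clamp_range t.
rewrite mulrAC [leRHS]mulrAC -mulrA; apply: ler_pM => //.
by rewrite mulrC -[leRHS]mul1r ler_pM ?expR_ge0 // ?invf_le1 ?ler1n// ler_expR ler_wpM2l // ltW.
Qed.

Lemma picard_sol_cpath : cpath (picard_sol Z).
Proof.
rewrite (_ : picard_sol Z = picard_map Z (picard_sol Z)); first by apply: picard_map_continuous => //; exact: picard_sol_mpath.
by apply/funext => i; apply/funext => t; exact: picard_sol_map.
Qed.

Lemma picard_sol_solves : solves Z (picard_sol Z) T.
Proof. by move=> i t tT; rewrite picard_sol_map /picard_map clamp_id. Qed.

End one_path.

Section adapted.
Context d' (E : measurableType d') (Z : E -> path).
Hypothesis cZ : forall w, cpath (fun i t => Z w i (clamp t)).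
Hypothesis mZ : forall i t, measurable_fun [set: E] (fun w => Z w i (clamp t)).

Let mZ2 : mfamily (fun w i t => Z w i (clamp t)).
Proof.
move=> i; apply: measurable_fun_rVP => k.
have H := @measurable_caratheodory _ E R (fun t w => Z w i (clamp t) ord0 k)
  (fun t => measurable_row k (mZ i t)) (fun w => @cZ w i k).
apply: (measurableT_comp H (g := fun p : (E * R)%type => (p.2, p.1))).
exact: measurable_fun_pair.
Qed.

Lemma measurable_clamp : measurable_fun [set: R] clamp.
Proof. by apply: measurable_maxr => //; exact: measurable_minr. Qed.

Lemma picard_mfamily n : mfamily (fun w => picard (Z w) n).
Proof.
elim: n => [|n IH] i; first exact: mZ2.
apply: measurable_fun_rVP => k.
rewrite (_ : _ \o _ = fun p : (E * R)%type => Z p.1 i (clamp p.2) ord0 k +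
   \int[mul]_(s in `[0, clamp p.2]) b (picard (Z p.1) n) s i ord0 k); last first.
  by apply/funext => p; rewrite /rV_coord /= /picard_map !mxE.
apply: measurable_funD; first exact: (measurable_row k (mZ2 i)).
have H := measurable_primitive (g := fun w s => b (picard (Z w) n) s i ord0 k) (bmeas i k IH).
apply: (measurableT_comp H (g := fun p : (E * R)%type => (p.1, clamp p.2))).
by apply: measurable_fun_pair => //; exact: (measurableT_comp measurable_clamp measurable_snd).
Qed.

Lemma picard_sol_mfamily : mfamily (fun w => picard_sol (Z w)).
Proof.
move=> i; apply: measurable_fun_rVP => k.
apply: (@measurable_realfun.measurable_fun_cvg _ _ _ _ (fun n (p : (E * R)%type) => picard (Z p.1) n i p.2 ord0 k)).
  by move=> n; exact: (measurable_row k (picard_mfamily n i)).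
by move=> p _; have [] := picard_cvg (@cZ p.1) i p.2 k.
Qed.

End adapted.

Lemma stopped_cpath Z t : cpath (fun i s => Z i (clamp s)) -> 0 <= t ->
  cpath (fun j s => Z j (Num.min (clamp s) t)).
Proof.
move=> cZ t0 j k; rewrite (_ : (fun s => _) = (fun s => Z j (clamp s) ord0 k) \o (fun s => Num.min s t)).
  move=> s; apply: continuous_comp; last exact: cZ.
  by apply: continuous_min; [exact: cvg_id | exact: cvg_cst].
apply/funext => s /=; congr (Z j _ ord0 k); rewrite /clamp /Num.max /Num.min; do !case: ifP; lra.
Qed.

(** By uniqueness on [[0, t]] the solution at time [t] does not change when the noise is stopped at
    [t]. Together with measurable dependence on the noise this gives adaptedness. *)
Lemma picard_sol_stopped Z t : cpath (fun i s => Z i (clamp s)) -> 0 <= t <= T ->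
  forall i, picard_sol Z i t = picard_sol (fun j s => Z j (Num.min s t)) i t.
Proof.
move=> cZ tT i; have /andP[t0 t1] := tT.
have cZt := stopped_cpath cZ t0.
pose Zt : path := fun j s => Z j (Num.min s t).
have s1 := picard_sol_solves cZ; have s2 := @picard_sol_solves Zt cZt.
apply: (@solves_unique Z _ _ t (picard_sol_mpath cZ) (@picard_sol_mpath Zt cZt) t1); last by rewrite t0 lexx.
- by move=> j s /andP[s0 st]; apply: s1; rewrite s0 (le_trans st).
- move=> j s /andP[s0 st]; rewrite s2 ?s0 ?(le_trans st)//.
  by rewrite /Zt min_l.
Qed.

End picard_iteration.

Lemma clamp_continuous (R : realType) (T : R) (U : topologicalType) (f : R -> U) : 0 <= T ->
  {within `[0, T], continuous f} -> continuous (f \o clamp T).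
Proof.
move=> T0 /subspace_continuousP cf t.
have cT : `[0, T]%classic (clamp T t) by rewrite /= in_itv /=; exact: clamp_range.
apply: cvg_comp (cf _ cT) => A [e /= e0 eA]; exists e => //= s ts.
apply: eA => /=; last by rewrite in_itv /=; exact: clamp_range.
apply: le_lt_trans ts.
wlog st : s t {cT} / s <= t => [H|].
  by have [/H//|/ltW/H] := leP s t; rewrite distrC [`|t - s|]distrC.
have /andP[h1 h2] := clamp_lip T st.
rewrite !ger0_norm ?subr_ge0//; move: h2; clear; lra.
Qed.

(** * Brownian paths *)

Section chaining.
Context (R : realType) (T th : R) (f : R -> R) (n0 : nat).
Hypothesis T0 : 0 < T.
Hypothesis th01 : 0 < th < 1.
Hypothesis cf : continuous f.
Let pt n j : R := T * j%:R / 2 ^+ n.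
Hypothesis step : forall n j, (n0 <= n)%N -> (j < 2 ^ n)%N ->
  `|f (T * j.+1%:R / 2 ^+ n) - f (T * j%:R / 2 ^+ n)| <= th ^+ n.
Let fl n t : nat := Num.truncn (t / T * 2 ^+ n).
Let c := th / (1 - th).

Let p2 n : (0 : R) < 2 ^+ n. Proof. by rewrite exprn_gt0. Qed.

Let flP n t : 0 <= t -> (fl n t)%:R <= t / T * 2 ^+ n < (fl n t).+1%:R.
Proof.
move=> t0; have p0 : 0 <= t / T * 2 ^+ n by rewrite mulr_ge0 ?divr_ge0 ?(ltW (p2 n))// ltW.
by rewrite /fl truncnS_gt truncn_le p0.
Qed.

Let fl_le n t : 0 <= t <= T -> (fl n t <= 2 ^ n)%N.
Proof.
move=> /andP[t0 tT]; have /andP[h _] := flP n t0.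
rewrite -(ler_nat R) (le_trans h) // natrX ler_piMl ?(ltW (p2 n))//.
by rewrite ler_pdivrMr // mul1r.
Qed.

Let fl_step n t : 0 <= t -> fl n.+1 t = (fl n t).*2 \/ fl n.+1 t = (fl n t).*2.+1.
Proof.
move=> t0; have /andP[h1 h2] := flP n t0; have /andP[h3 h4] := flP n.+1 t0.
rewrite exprSr mulrA in h3 h4.
have a1 : ((fl n t).*2 < (fl n.+1 t).+1)%N.
  by rewrite -(ltr_nat R) (le_lt_trans _ h4) // -muln2 natrM ler_wpM2r.
have a2 : (fl n.+1 t < (fl n t).+1.*2)%N.
  by rewrite -(ltr_nat R) (le_lt_trans h3) // -muln2 natrM ltr_pM2r.
move: a1 a2; rewrite ltnS doubleS ltnS leq_eqVlt => /predU1P[->|a1 a2]; first by left.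
by right; apply/eqP; rewrite eqn_leq a1 a2.
Qed.

Let refine1 n t : (n0 <= n)%N -> 0 <= t <= T -> `|f (pt n.+1 (fl n.+1 t)) - f (pt n (fl n t))| <= th ^+ n.+1.
Proof.
move=> n0n tT; have /andP[t0 _] := tT; have /andP[h1 h2] := th01.
have E : pt n (fl n t) = pt n.+1 (fl n t).*2.
  rewrite /pt -muln2 natrM exprS; field; by rewrite gt_eqF.
rewrite E; case: (fl_step n t0) => fE; rewrite fE; first by rewrite subrr normr0 exprn_ge0 // ltW.
apply: step; first exact: leqW.
by have := fl_le n.+1 tT; rewrite fE.
Qed.

Let refine n m t : (n0 <= n)%N -> 0 <= t <= T ->
  `|f (pt (n + m) (fl (n + m) t)) - f (pt n (fl n t))| <= c * (th ^+ n - th ^+ (n + m)).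
Proof.
move=> n0n tT; have /andP[h1 h2] := th01; elim: m => [|m IH].
  by rewrite addn0 !subrr normr0 mulr0.
rewrite addnS -(subrK (f (pt (n + m) (fl (n + m) t))) (f (pt (n + m).+1 _))) -addrA.
rewrite (le_trans (ler_normD _ _)) // (le_trans (lerD (refine1 _ tT) IH)) ?(leq_trans n0n) ?leq_addr//.
rewrite le_eqVlt; apply/orP; left; apply/eqP; rewrite /c exprS; field.
by rewrite subr_eq0 gt_eqF.
Qed.

Let approx n t : (n0 <= n)%N -> 0 <= t <= T -> `|f t - f (pt n (fl n t))| <= c * th ^+ n.
Proof.
move=> n0n tT; have /andP[h1 h2] := th01; have /andP[t0 _] := tT.
have c0 : 0 <= c by rewrite divr_ge0 ?subr_ge0 // ltW.
apply/ler_addgt0Pr => e e0.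
have /cvgrPdist_le /(_ e e0) [r /= r0 Hr] := @cf t.
have [k hk] := geometric_small (2 * T) (divr_gt0 r0 (@ltr0n R 2)).
have near_t m : (k <= m)%N -> `|t - pt m (fl m t)| < r.
  move=> km; have /andP[g1 g2] := flP m t0.
  have E : t - pt m (fl m t) = T * (t / T * 2 ^+ m - (fl m t)%:R) / 2 ^+ m.
    by rewrite /pt; field; rewrite gt_eqF //= gt_eqF // p2.
  rewrite E normrM (ger0_norm (_ : 0 <= (2 ^+ m)^-1)) ?invr_ge0 ?(ltW (p2 m))//.
  rewrite normrM (ger0_norm (ltW T0)) ger0_norm ?subr_ge0//.
  have p3 : (2 ^+ m)^-1 <= 2^-1 ^+ k :> R.
    by rewrite exprVn lef_pV2 ?posrE // ler_eXn2l // ltr1n.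
  apply: (@le_lt_trans _ _ (T * 1 * 2^-1 ^+ k)).
    apply: ler_pM => //; first by rewrite mulr_ge0 ?subr_ge0 // ltW.
    by rewrite ler_wpM2l ?(ltW T0)// lerBlDr addrC natr1 ltW.
  have q0 : 0 < 2^-1 ^+ k :> R by rewrite exprn_gt0 // invr_gt0.
  move: hk r0 q0; lra.
pose m := k; have km : (k <= n + m)%N by exact: leq_addl.
rewrite -(subrK (f (pt (n + m) (fl (n + m) t))) (f t)) -addrA (le_trans (ler_normD _ _)) // [leRHS]addrC.
apply: lerD; first by apply: Hr => /=; exact: near_t.
by rewrite (le_trans (refine m n0n tT)) // ler_wpM2l // gerBl exprn_ge0 // ltW.
Qed.

(** Each time is joined to its left dyadic neighbour of level [n] by telescoping over the finer
    levels, continuity closing the chain; this costs at most the sum [th / (1 - th) * th^n] of the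
    later steps. The two neighbours coincide or are adjacent when [t - s <= T / 2^n]. *)
Lemma chaining n s t : (n0 <= n)%N -> 0 <= s -> s <= t -> t <= T -> t - s <= T / 2 ^+ n ->
  `|f t - f s| <= (1 + 2 * (th / (1 - th))) * th ^+ n.
Proof.
move=> n0n s0 st tT ts; have t0 := le_trans s0 st; have sT := le_trans st tT.
have tT' : 0 <= t <= T by rewrite t0. have sT' : 0 <= s <= T by rewrite s0.
have /andP[h1 h2] := th01.
have H : `|f (pt n (fl n t)) - f (pt n (fl n s))| <= th ^+ n.
  have /andP[g1 g2] := flP n t0; have /andP[g3 g4] := flP n s0.
  have e1 : t / T * 2 ^+ n - s / T * 2 ^+ n <= 1.
    rewrite -mulrBl -mulrBl mulrAC ler_pdivrMr // mul1r -ler_pdivlMr //.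
  have e2 : s / T * 2 ^+ n <= t / T * 2 ^+ n.
    by rewrite ler_wpM2r ?(ltW (p2 n))// ler_wpM2r // invr_ge0 ltW.
  have a1 : (fl n s < (fl n t).+1)%N by rewrite -(ltr_nat R) (le_lt_trans g3) // (le_lt_trans e2).
  have a2 : (fl n t < (fl n s).+2)%N.
    rewrite -(ltr_nat R) (le_lt_trans g1) // -[(fl n s).+2%:R]natr1.
    have -> : t / T * 2 ^+ n = (t / T * 2 ^+ n - s / T * 2 ^+ n) + s / T * 2 ^+ n by ring.
    by rewrite addrC ltr_leD.
  move: a1; rewrite ltnS leq_eqVlt => /predU1P[->|a1]; first by rewrite subrr normr0 exprn_ge0 // ltW.
  have fE : fl n t = (fl n s).+1 by apply/eqP; rewrite eqn_leq a1 andbT -ltnS.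
  rewrite fE; apply: step => //; rewrite -fE; exact: fl_le.
have at_ := approx n0n tT'; have as_ := approx n0n sT'.
rewrite [X in `|X|](_ : _ = (f t - f (pt n (fl n t))) + ((f (pt n (fl n t)) - f (pt n (fl n s))) - (f s - f (pt n (fl n s))))); last by ring.
rewrite (le_trans (ler_normD _ _)) // -/c mulrDl mul1r.
have := ler_normB (f (pt n (fl n t)) - f (pt n (fl n s))) (f s - f (pt n (fl n s))).
move: at_ as_ H; lra.
Qed.

End chaining.

Section gaussian.
Context (R : realType).
Implicit Types (s x : R).

Let gaussian_aux1 (r u e1 e2 : R) : r != 0 -> r * e1 * (r^-1 * u * e2) = u * (e1 * e2).
Proof. by move=> r0; field. Qed.

Let gaussian_aux2 x y s : s != 0 ->
  - (x ^+ 2 / (4 * s ^+ 2)) + - y ^+ 2 / (2 * s ^+ 2 *+ 2) - - y ^+ 2 / (s ^+ 2 *+ 2)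
  = (y ^+ 2 - x ^+ 2) / (4 * s ^+ 2).
Proof.
move=> s0; have s2 : s ^+ 2 != 0 by rewrite sqrf_eq0.
rewrite -[s ^+ 2 *+ 2]mulr_natl -[2 * s ^+ 2 *+ 2]mulr_natl.
by move: (s ^+ 2) (x ^+ 2) (y ^+ 2) s2 => a b c a0; field.
Qed.

(** Where [|y| > x], the density with variance [s^2] is at most [sqrt 2 * exp (- x^2 / (4 s^2))]
    times the one with variance [2 s^2], whose integral is 1. *)
Lemma normal_tail s x : 0 < s -> 0 <= x ->
  (normal_prob 0%R s [set y : R | (x < `|y|)%R] <= (Num.sqrt 2 * expR (- (x ^+ 2 / (4 * s ^+ 2))))%:E)%E.
Proof.
move=> s0 x0; rewrite /normal_prob.
have mD : measurable [set y : R | x < `|y|].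
  rewrite (_ : [set _ | _] = (fun y : R => `|y|) @^-1` `]x, +oo[%classic); last first.
    by apply/seteqP; split => y /=; rewrite in_itv /= andbT.
  by rewrite -[X in measurable X]setTI; apply: measurableT_comp.
set C := Num.sqrt 2 * _.
have C0 : 0 <= C by rewrite mulr_ge0 ?expR_ge0.
pose s' := Num.sqrt 2 * s.
have s2 : s' ^+ 2 = 2 * s ^+ 2 by rewrite exprMn sqr_sqrtr.
have s'0 : s' != 0 by rewrite mulf_neq0 // ?gt_eqF // sqrtr_gt0.
have P y : x < `|y| -> normal_pdf 0 s y <= C * normal_pdf 0 s' y.
  have E v : v != 0 -> normal_pdf 0 v y = normal_peak v * normal_fun 0 v y by move=> v0; rewrite normal_pdfE.
  move=> xy; rewrite (E s (lt0r_neq0 s0)) (E s' s'0) /normal_peak /normal_fun !subr0 s2.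
  have -> : 2 * s ^+ 2 * pi *+ 2 = 2 * (s ^+ 2 * pi *+ 2) by rewrite mulrnAr mulrA.
  have [p p0 ->] : exists2 p : R, 0 < p & s ^+ 2 * pi *+ 2 = p.
    by exists (s ^+ 2 * pi *+ 2); rewrite // mulrn_wgt0// mulr_gt0 ?pi_gt0// exprn_gt0.
  rewrite [Num.sqrt (2 * _)]sqrtrM // invfM.
  have r2 : Num.sqrt 2 != 0 :> R by rewrite gt_eqF // sqrtr_gt0.
  rewrite [leRHS](_ : _ = (Num.sqrt p)^-1 * (expR (- (x ^+ 2 / (4 * s ^+ 2))) * expR (- y ^+ 2 / ((2 * s ^+ 2) *+ 2)))); last first.
    exact: gaussian_aux1.
  rewrite ler_wpM2l ?invr_ge0// -expRD ler_expR.
  have xy2 : x ^+ 2 <= y ^+ 2.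
    by rewrite -(real_normK (num_real y)) lerXn2r ?nnegrE // ltW.
  have sp : s != 0 by rewrite gt_eqF.
  rewrite -subr_ge0 gaussian_aux2 //.
  by rewrite divr_ge0 ?subr_ge0// mulr_ge0 // sqr_ge0.
have mpdf v : measurable_fun setT (fun y => (normal_pdf 0 v y)%:E : \bar R).
  by apply/measurable_EFinP; exact: measurable_normal_pdf.
have mC : measurable_fun setT (fun y => (C%:E * (normal_pdf 0 s' y)%:E)%E : \bar R).
  by apply: emeasurable_funM => //; exact: measurable_cst.
apply: (@le_trans _ _ (\int[lebesgue_measure]_y (C%:E * (normal_pdf 0 s' y)%:E))%E).
  apply: (@le_trans _ _ (\int[lebesgue_measure]_(y in [set y | (x < `|y|)%R]) (C%:E * (normal_pdf 0 s' y)%:E))%E).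
    apply: ge0_le_integral => //.
    - by move=> y _; rewrite lee_fin normal_pdf_ge0.
    - exact: (measurable_funS measurableT (@subsetT _ _) (mpdf s)).
    - exact: (measurable_funS measurableT (@subsetT _ _) mC).
  apply: ge0_subset_integral => // y _.
  by rewrite -EFinM lee_fin mulr_ge0 // normal_pdf_ge0.
rewrite ge0_integralZl_EFin //; last by apply/measurable_EFinP; exact: measurable_normal_pdf.
  by rewrite integral_normal_pdf mule1.
by move=> y _; rewrite lee_fin normal_pdf_ge0.
Qed.

(** With [q^m >= 4], the inequality [(y / m)^m <= exp y] at [y = a q^n] beats [4^n]. One factor
    [2^n] will count the increments of level [n], the other makes the levels summable. *)
Lemma super_exponential (a q : R) : 0 < a -> 1 < q ->
  exists2 C : R, 0 <= C & forall n, 4 ^+ n * expR (- (a * q ^+ n)) <= C.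
Proof.
move=> a0 q1; have q0 : 0 < q by exact: lt_trans q1.
have [m m0 qm] : exists2 m : nat, (0 < m)%N & 4 <= q ^+ m.
  pose r := q - 1; have r0 : 0 < r by rewrite subr_gt0.
  pose m := (Num.truncn (4 / r)).+1; exists m => //.
  have B k : 1 + k%:R * r <= q ^+ k.
    elim: k => [|k IH]; first by rewrite mul0r addr0.
    rewrite exprS (le_trans _ (ler_wpM2l (ltW q0) IH)) //.
    have k0 : (0 : R) <= k%:R by []. have kr : 0 <= k%:R * r * r by rewrite !mulr_ge0 // ltW.
    rewrite -natr1 (_ : q = 1 + r); last by rewrite /r; ring.
    move: kr; clear; nra.
  apply: le_trans (B m).
  have : 4 / r < m%:R by exact: truncnS_gt.
  by rewrite ltr_pdivrMr // => h; move: h; clear; lra.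
have mp : (0 : R) < m%:R by rewrite ltr0n.
exists ((m%:R / a) ^+ m) => [|n]; first by rewrite exprn_ge0 // divr_ge0 // ltW.
rewrite expRN ler_pdivrMr ?expR_gt0//.
have e1 : (a * q ^+ n / m%:R) ^+ m <= expR (a * q ^+ n).
  have -> : expR (a * q ^+ n) = expR (a * q ^+ n / m%:R) ^+ m.
    by rewrite -expRM_natl [X in _ = expR X]mulrC divfK // gt_eqF.
  have p0 : 0 <= a * q ^+ n / m%:R by rewrite !mulr_ge0 ?invr_ge0 ?exprn_ge0 // ltW.
  rewrite lerXn2r ?nnegrE ?expR_ge0//.
  by apply: le_trans (expR_ge1Dx _); rewrite lerDr.
have e2 : 4 ^+ n <= (q ^+ n) ^+ m by rewrite -exprM mulnC exprM lerXn2r ?nnegrE // exprn_ge0 // ltW.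
rewrite (le_trans e2) // (_ : (q ^+ n) ^+ m = (m%:R / a) ^+ m * (a * q ^+ n / m%:R) ^+ m); last first.
  by rewrite -exprMn; congr (_ ^+ m); field; rewrite !gt_eqF.
by rewrite ler_wpM2l // exprn_ge0 // divr_ge0 // ltW.
Qed.

End gaussian.

Section wiener_holder.
Context (R : realType) (disp : measure_display) (Omega : measurableType disp).
Context (P : probability Omega R) (T : R) (F : R -> set (set Omega)) (d : nat).
Variable W : R -> Omega -> 'rV[R]_d.
Hypothesis T0 : 0 < T.
Hypothesis FU : usual_filtration P T F.
Hypothesis WW : wiener_process P T F W.

Lemma wiener_measurable t : 0 <= t <= T -> measurable_fun setT (W t).
Proof.
move=> tT _ B mB; rewrite setTI; apply: (filtration_sub_measurable FU) (wiener_adapted WW _ mB);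
  by rewrite in_itv.
Qed.

Let mincr s t k : 0 <= s <= T -> 0 <= t <= T ->
  measurable_fun setT (fun w => `|(W t w - W s w) ord0 k|).
Proof.
move=> sT tT; apply: measurableT_comp => //; apply: measurable_row.
by apply: measurable_subr; exact: wiener_measurable.
Qed.

Let E s t k (x : R) := [set w | x < `|(W t w - W s w) ord0 k|].

Let mE s t k x : 0 <= s <= T -> 0 <= t <= T -> measurable (E s t k x).
Proof.
move=> sT tT; rewrite (_ : E s t k x = (fun w => `|(W t w - W s w) ord0 k|) @^-1` `]x, +oo[%classic); last first.
  by apply/seteqP; split => y /=; rewrite in_itv /= andbT.
by rewrite -[X in measurable X]setTI; apply: mincr.
Qed.

Lemma wiener_tail s t k x : 0 <= s -> s < t -> t <= T -> 0 <= x ->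
  (P (E s t k x) <= (Num.sqrt 2 * expR (- (x ^+ 2 / (4 * (t - s)))))%:E)%E.
Proof.
move=> s0 st tT x0.
pose B j : set R := if j == k then [set y | x < `|y|] else setT.
have mB j : measurable (B j).
  rewrite /B; case: ifP => // _.
  rewrite (_ : [set _ | _] = (fun y : R => `|y|) @^-1` `]x, +oo[%classic); last first.
    by apply/seteqP; split => y /=; rewrite in_itv /= andbT.
  by rewrite -[X in measurable X]setTI; apply: measurableT_comp.
have := wiener_increment_law WW s0 st tT mB.
rewrite (_ : [set w | _] = E s t k x); last first.
  apply/seteqP; split => [w /(_ k)|w wx j]; rewrite /B ?eqxx //.
  by case: eqP => [->|].
move=> ->; rewrite (bigD1 k) //= big1 ?mule1 => [|j jk]; last first.
  by rewrite /B (negbTE jk); exact: (probability_setT (normal_prob 0 (Num.sqrt (t - s)))).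
rewrite /B eqxx; have st0 : 0 < t - s by rewrite subr_gt0.
by have := @normal_tail _ (Num.sqrt (t - s)) x (_ : 0 < _) x0; rewrite sqrtr_gt0 => /(_ st0); rewrite sqr_sqrtr // ltW.
Qed.

(** Borel-Cantelli: an increment of level [n] has variance [T / 2^n], so it exceeds [th^n] with
    probability at most a constant times [exp (- (2 th^2)^n / (4 T))]. As [2 th^2 > 1], this beats
    the number [2^n] of increments. *)
Lemma wiener_dyadic th k : 0 < th -> 1 < 2 * th ^+ 2 ->
  {ae P, forall w, exists n0 : nat, forall n j, (n0 <= n)%N -> (j < 2 ^ n)%N ->
    `|(W (T * j.+1%:R / 2 ^+ n) w - W (T * j%:R / 2 ^+ n) w) ord0 k| <= th ^+ n}.
Proof.
move=> th0 q1.
pose pt n j : R := T * j%:R / 2 ^+ n.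
have p2 n : (0 : R) < 2 ^+ n by rewrite exprn_gt0.
have ptT n j : (j <= 2 ^ n)%N -> 0 <= pt n j <= T.
  move=> jn; rewrite /pt divr_ge0 ?mulr_ge0 ?(ltW T0) ?(ltW (p2 n))//=.
  by rewrite ler_pdivrMr // ler_wpM2l ?(ltW T0)// -natrX ler_nat.
pose A n := \big[setU/set0]_(j < 2 ^ n) E (pt n j) (pt n j.+1) k (th ^+ n).
have mA n : measurable (A n).
  apply: bigsetU_measurable => j _; apply: mE; apply: ptT => //; exact: ltnW.
have a0 : 0 < (4 * T)^-1 by rewrite invr_gt0 mulr_gt0.
have [C C0 HC] := super_exponential a0 q1.
have PA n : (P (A n) <= (2 * Num.sqrt 2 * C / (2 ^ (n + 1))%:R)%:E)%E.
  apply: (@le_trans _ _ (\sum_(j < 2 ^ n) P (E (pt n j) (pt n j.+1) k (th ^+ n)))%E).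
    apply: (@content_subadditive _ _ _ P (A n) (fun j => E (pt n j) (pt n j.+1) k (th ^+ n)) (2 ^ n)%N) => //.
    by move=> j jn; apply: mE; apply: ptT => //; exact: ltnW.
  apply: (@le_trans _ _ (\sum_(j < 2 ^ n) (Num.sqrt 2 * expR (- ((4 * T)^-1 * (2 * th ^+ 2) ^+ n)))%:E)%E).
    apply: lee_sum => j _.
    have jT := ptT n j (ltnW (ltn_ord j)); have jT' := ptT n j.+1 (ltn_ord j).
    have jj : pt n j.+1 - pt n j = T / 2 ^+ n by rewrite /pt -natr1; ring.
    have lt : pt n j < pt n j.+1 by rewrite -subr_gt0 jj divr_gt0.
    have /andP[h1 h2] := jT; have /andP[h3 h4] := jT'.
    rewrite (le_trans (wiener_tail k h1 lt h4 _)) ?exprn_ge0 ?(ltW th0)//.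
    rewrite lee_fin ler_wpM2l // ler_expR lerN2 jj le_eqVlt; apply/orP; left; apply/eqP.
    rewrite exprMn -!exprM mulnC; field; by rewrite !gt_eqF.
  rewrite sumEFin lee_fin sumr_const card_ord -[leLHS]mulr_natl natrX.
  have q2 : (2 ^ (n + 1))%:R = 2 * 2 ^+ n :> R by rewrite addn1 expnS natrM natrX.
  have q4 : 4 ^+ n = 2 ^+ n * 2 ^+ n :> R by rewrite -exprMn -natrM.
  have := HC n; rewrite q2 q4.
  move: (expR _) (2 ^+ n) (p2 n) (Num.sqrt 2) (@sqrtr_ge0 R 2) => X q q0 r r0 h.
  rewrite (_ : 2 * r * C / (2 * q) = r * (C / q)); last by field; rewrite gt_eqF.
  by rewrite mulrCA ler_wpM2l // ler_pdivlMr // mulrAC.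
have sA : (\sum_(n <oo) P (A n) < +oo)%E.
  apply: (@le_lt_trans _ _ (\sum_(n <oo) (2 * Num.sqrt 2 * C / (2 ^ (n + 1))%:R)%:E)%E).
    by apply: lee_nneseries => // n _; exact: PA.
  have := @cvg_geometric_eseries_half R (2 * Num.sqrt 2 * C) 0 => /cvg_lim.
  by rewrite /eseries => ->//; rewrite ltry.
have N0 := lim_sup_set_cvg0 mA sA.
exists (lim_sup_set A); split => //.
  by apply: bigcap_measurable => // n _; apply: bigcup_measurable.
move=> w /= H n _; apply: contrapT => Hn; apply: H; exists n => m j nm jm.
rewrite leNgt; apply/negP => h; apply: Hn; exists m => //.
by rewrite /A -(bigcup_mkord (2 ^ m) (fun j => E (pt m j) (pt m j.+1) k (th ^+ m))) /=; exists j.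
Qed.

Lemma wiener_modulus th : 0 < th < 1 -> 1 < 2 * th ^+ 2 ->
  {ae P, forall w, forall k, exists n0 : nat, forall n s t, (n0 <= n)%N ->
    0 <= s -> s <= t -> t <= T -> t - s <= T / 2 ^+ n ->
    `|W t w ord0 k - W s w ord0 k| <= (1 + 2 * (th / (1 - th))) * th ^+ n}.
Proof.
move=> th01 q1; have /andP[th0 _] := th01.
have cW := wiener_continuous WW; apply: filter_forall => k.
apply: filterS2 (wiener_dyadic k th0 q1) cW => w [n0 Hn0] cw; exists n0 => n s t n0n s0 st tT ts.
pose f u := W (clamp T u) w ord0 k.
have cf : continuous f.
  move=> u; have := clamp_continuous (ltW T0) cw => /(_ u) c1.
  by apply: (@continuous_comp _ _ _ (fun u => W (clamp T u) w) (fun x : 'rV[R]_d => x ord0 k) u c1);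
    exact: coord_continuous.
have := @chaining R T th f n0 T0 th01 cf _ n s t n0n s0 st tT ts.
rewrite /f !clamp_id ?(ltW T0) //; try by rewrite ?s0 ?tT ?(le_trans s0 st) ?(le_trans st tT).
apply => m j n0m jm; have := Hn0 m j n0m jm; rewrite !mxE.
have p2 : (0 : R) < 2 ^+ m by rewrite exprn_gt0.
have ptT i : (i <= 2 ^ m)%N -> 0 <= T * i%:R / 2 ^+ m <= T.
  move=> im; rewrite divr_ge0 ?mulr_ge0 ?(ltW T0) ?(ltW p2)//=.
  by rewrite ler_pdivrMr // ler_wpM2l ?(ltW T0)// -natrX ler_nat.
by rewrite /f !clamp_id ?(ltW T0) // ptT // ltnW.
Qed.

End wiener_holder.

Section noise.
Context (R : realType).

Lemma exprn_small (q C e : R) : 0 <= q < 1 -> 0 < e -> exists n0, forall n, (n0 <= n)%N -> C * q ^+ n <= e.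
Proof.
move=> /andP[q0 q1] e0; have := @cvg_geometric R C q; rewrite ger0_norm // => /(_ q1).
move=> /cvgrPdist_le /(_ e e0) [n0 _ H]; exists n0 => n n0n.
have := H n n0n; rewrite /= sub0r normrN; apply: le_trans; exact: ler_norm.
Qed.

Variables (disp : measure_display) (Omega : measurableType disp).
Variables (P : probability Omega R) (T : R) (F : R -> set (set Omega)) (d N : nat).
Variable W : 'I_N -> R -> Omega -> 'rV[R]_d.
Hypothesis T0 : 0 < T.
Hypothesis FU : usual_filtration P T F.
Hypothesis WW : forall i, wiener_process P T F (W i).

(* Brownian paths are Hoelder continuous with some exponent larger than 1/g, since g > 2. *)
Lemma wiener_noise (g sigma : R) : 2 < g ->
  {ae P, forall w, forall kap kap1 rb : R, 0 < kap -> 0 < kap1 -> 0 < rb ->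
    exists r, [/\ 0 < r, r <= rb & forall i k s t, 0 <= s -> s <= t -> t <= T -> t - s <= kap * r `^ g ->
      `|sigma * W i t w ord0 k - sigma * W i s w ord0 k| <= kap1 * r]}.
Proof.
move=> g2; have g0 : 0 < g by exact: lt_trans g2.
have l2 : 0 < ln (2 : R) by rewrite ln_gt0 // ltr1n.
pose e := (g^-1 + 2^-1) / 2.
have gi : g^-1 < 2^-1 by rewrite ltf_pV2 ?posrE.
have gi0 : 0 < g^-1 by rewrite invr_gt0.
have e1 : g^-1 < e by rewrite /e; move: gi; lra.
have e2 : e < 2^-1 by rewrite /e; move: gi; lra.
(* [th = 2^(-e)] is the decay rate of the increments over the dyadic levels, and [rho = 2^(-1/g)]
   that of the radii whose windows [kap r^g] have dyadic length. The choice [1/g < e < 1/2] gives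
   both [th / rho < 1] and [2 th^2 > 1]. *)
pose th := expR (- (e * ln 2)); pose rho := expR (- (g^-1 * ln (2 : R))).
have th01 : 0 < th < 1.
  rewrite expR_gt0 /= -[ltRHS]expR0 ltr_expR oppr_lt0 mulr_gt0 //; exact: lt_trans e1.
have q1 : 1 < 2 * th ^+ 2.
  rewrite -[X in X * _](@lnK _ 2) ?posrE// -expRM_natl -expRD -[ltLHS]expR0 ltr_expR.
  rewrite mulrN -mulNr mulrA -{1}[ln 2]mul1r -mulrDl mulr_gt0 //; move: e2; lra.
have thr : 0 <= th / rho < 1.
  rewrite divr_ge0 ?expR_ge0 //= ltr_pdivrMr ?expR_gt0// mul1r ltr_expR ltrN2.
  by rewrite ltr_pM2r.
have rho01 : 0 <= rho < 1.
  by rewrite expR_ge0 /= -[ltRHS]expR0 ltr_expR oppr_lt0 mulr_gt0.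
have rho0 : 0 < rho by exact: expR_gt0.
set C := 1 + 2 * (th / (1 - th)).
have H : {ae P, forall w, forall i k, exists n0 : nat, forall n s t, (n0 <= n)%N ->
    0 <= s -> s <= t -> t <= T -> t - s <= T / 2 ^+ n ->
    `|W i t w ord0 k - W i s w ord0 k| <= C * th ^+ n}.
  by apply: filter_forall => i; exact: (wiener_modulus T0 FU (WW i) th01 q1).
apply: filterS H => w Hw kap kap1 rb kap0 kap10 rb0.
have [n1 Hn1] : exists n1 : nat, forall i k n s t, (n1 <= n)%N ->
    0 <= s -> s <= t -> t <= T -> t - s <= T / 2 ^+ n ->
    `|W i t w ord0 k - W i s w ord0 k| <= C * th ^+ n.
  have Hc (p : ('I_N * 'I_d)%type) : exists n0 : nat, forall n s t, (n0 <= n)%N ->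
    0 <= s -> s <= t -> t <= T -> t - s <= T / 2 ^+ n ->
    `|W p.1 t w ord0 p.2 - W p.1 s w ord0 p.2| <= C * th ^+ n by exact: Hw.
  have [m Hm] := choice Hc; exists (\max_p m p) => i k n s t mn.
  by apply: (Hm (i, k)); apply: leq_trans mn; exact: leq_bigmax.
(* Calibrated so that the radius [r = D * rho^n] has window [kap * r^g = T / 2^n]. *)
pose D := (T / kap) `^ g^-1; have D0 : 0 < D by rewrite powR_gt0 // divr_gt0.
have kD : 0 < kap1 * D by rewrite mulr_gt0.
have [n2 Hn2] := exprn_small (`|sigma| * C) thr kD.
have [n3 Hn3] := exprn_small D rho01 rb0.
pose n := maxn n1 (maxn n2 n3).
exists (D * rho ^+ n); split.
- by rewrite mulr_gt0 // exprn_gt0.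
- by apply: Hn3; rewrite /n !leq_max leqnn !orbT.
move=> i k s t s0 st tT ts.
have E : kap * (D * rho ^+ n) `^ g = T / 2 ^+ n.
  rewrite powRM ?(ltW D0) ?exprn_ge0 ?(ltW rho0)// /D -powRrM mulVf ?gt_eqF// powRr1 ?divr_ge0 ?(ltW T0) ?(ltW kap0)//.
  rewrite /rho -expRM_natl -expRM.
  have -> : n%:R * - (g^-1 * ln 2) * g = - (n%:R * ln (2 : R)) by field; rewrite gt_eqF.
  by rewrite expRN expRM_natl lnK ?posrE//; field; rewrite !gt_eqF // exprn_gt0.
rewrite E in ts; rewrite -mulrBr normrM.
have n1n : (n1 <= n)%N by rewrite /n leq_max leqnn.
have n2n : (n2 <= n)%N by rewrite /n !leq_max leqnn !orbT.
have h1 := Hn1 i k n s t n1n s0 st tT ts.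
apply: (le_trans (ler_wpM2l (normr_ge0 sigma) h1)).
have := Hn2 n n2n; rewrite expr_div_n !mulrA ler_pdivrMr // exprn_gt0 //.
Qed.

End noise.

(** * Distinct initial positions, and continuity in L^2 *)

Section distinct.
Local Open Scope ereal_scope.
Context (R : realType) (disp : measure_display) (Omega : measurableType disp).
Variables (P : probability Omega R) (d : nat) (A B alpha beta : R).
Hypotheses (A0 : (0 < A)%R) (B0 : (0 < B)%R) (beta0 : (0 < beta)%R) (ab : (beta < alpha)%R).

(** The potential is bounded below, so on a probability space its negative part is integrable. The
    bound on the expectation then makes the positive part integrable, hence almost surely finite,
    whereas its value at 0 is infinite. *)
Lemma LJ_ext_ae (x : Omega -> 'rV[R]_d) : measurable_fun setT x ->
  \int[P]_w LJ_ext A B alpha beta (x w) < +oo -> {ae P, forall w, x w != 0%R}.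
Proof.
move=> mx; pose f w := LJ_ext A B alpha beta (x w).
have fE w : f w = if x w == 0%R then +oo else (LJr A B alpha beta (enorm (x w)))%:E.
  by rewrite /f /LJ_ext; case: ifP => // _; rewrite LJE.
have me : measurable_fun [set: Omega] (fun w => enorm (x w)).
  exact: (measurableT_comp (@measurable_enorm R d) mx).
have mf : measurable_fun [set: Omega] f.
  rewrite (_ : f = fun w => if x w == 0%R then +oo else (LJr A B alpha beta (enorm (x w)))%:E); last exact/funext.
  apply: measurable_fun_ifT => //; first by apply: measurable_row_eq.
  apply/measurable_EFinP; apply: measurable_funB; apply: measurable_funM => //;
    exact: (measurableT_comp (measurable_powR (R := R) _) me).
have [b b0 Hb] := LJr_ge A0 B0 beta0 ab.
have fb w : - b%:E <= f w.
  rewrite fE; case: ifP => [_|/eqP/eqP x0]; first by rewrite leey.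
  rewrite -EFinN lee_fin; have e0 : (0 < enorm (x w))%R by rewrite enorm_gt0.
  apply: le_trans (Hb _ e0); rewrite lerBrDr addrC subrr.
  by rewrite mulr_ge0 ?powR_ge0 // divr_ge0 // ltW.
have mn := measurable_funeneg mf; have mp := measurable_funepos mf.
have In : \int[P]_w f^\- w <= b%:E.
  apply: (@le_trans _ _ (\int[P]_w (cst b%:E) w)).
    apply: ge0_le_integral => //.
    by move=> w _; rewrite funenegE ge_max lee_fin b0 andbT leeNl.
  by rewrite integral_cst // -[X in _ * X <= _]/(P setT) probability_setT mule1.
have In0 : 0 <= \int[P]_w f^\- w by apply: integral_ge0.
have Ip0 : 0 <= \int[P]_w f^\+ w by apply: integral_ge0.
rewrite integralE => If.
have Ip : \int[P]_w f^\+ w < +oo.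
  rewrite ltey; apply/eqP => Ipy; move: If; rewrite Ipy.
  have : \int[P]_w f^\- w \is a fin_num by rewrite ge0_fin_numE // (le_lt_trans In) // ltry.
  by move=> /fineK <-; rewrite addye.
have iP : P.-integrable setT f^\+.
  apply/integrableP; split => //.
  by under eq_integral do rewrite gee0_abs //.
apply: filterS (integrable_ae measurableT iP) => w /(_ Logic.I).
by apply: contraL => /eqP xw; rewrite funeposE fE xw eqxx.
Qed.

End distinct.

Section L2.
Context (R : realType) (d : nat).
Notation leb := (@lebesgue_rV R d).
Implicit Types (f g : 'rV[R]_d -> R).

Lemma Lnorm2_le f g (a : R) : measurable_fun setT f -> measurable_fun setT g -> 0 <= a ->
  (forall z, 0 <= g z) -> (forall z, `|f z| <= a * g z) ->
  ('N[leb]_2%:E[EFin \o f] <= a%:E * 'N[leb]_2%:E[EFin \o g])%E.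
Proof.
move=> mf mg a0 g0 fg; rewrite unlock.
have pE h : (\int[leb]_z (`|(EFin \o h) z| `^ 2) = \int[leb]_z (h z ^+ 2)%:E)%E.
  apply: eq_integral => z _; rewrite /=; congr EFin.
  by rewrite -(real_normK (num_real (h z))) -powR_mulrn.
rewrite !pE.
have I0 h : (0 <= \int[leb]_z (h z ^+ 2)%:E)%E by apply: integral_ge0 => z _; rewrite lee_fin sqr_ge0.
have a2 : (a%:E = (a ^+ 2)%:E `^ 2^-1)%E.
  by rewrite poweR_EFin; congr EFin; rewrite powR12_sqrt ?sqr_ge0// sqrtr_sqr ger0_norm.
rewrite a2 -poweRM ?lee_fin ?sqr_ge0//.
apply: gt0_ler_poweR; rewrite ?in_itv/= ?I0 ?leey ?invr_ge0//.
  by rewrite mule_ge0 ?lee_fin ?sqr_ge0.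
rewrite -ge0_integralZl_EFin ?sqr_ge0//; last 2 first.
- by move=> z _; rewrite lee_fin sqr_ge0.
- by apply/measurable_EFinP; exact: measurable_funX.
apply: ge0_le_integral => //.
- by move=> z _; rewrite lee_fin sqr_ge0.
- by apply/measurable_EFinP; exact: measurable_funX.
- by apply: emeasurable_funM => //; apply/measurable_EFinP; exact: measurable_funX.
- move=> z _; rewrite -EFinM lee_fin -exprMn -(real_normK (num_real (f z))).
  by rewrite lerXn2r ?nnegrE ?mulr_ge0.
Qed.

(** A pointwise Lipschitz bound in time with a fixed weight [g] in L^2 passes to the norm; for the
    field the weight is the initial profile. *)
Lemma continuous_L2_lip (T C D : R) (c : R -> 'rV[R]_d -> R) g :
  g \in Lfun leb 2%:E -> (forall z, 0 <= g z) -> 0 <= C -> 0 <= D ->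
  (forall t, 0 <= t <= T -> measurable_fun setT (c t)) ->
  (forall t z, 0 <= t <= T -> `|c t z| <= D * g z) ->
  (forall s t z, 0 <= s <= T -> 0 <= t <= T -> `|c t z - c s z| <= C * `|t - s| * g z) ->
  continuous_L2 T c.
Proof.
move=> gL g0 C0 D0 mc cD cC.
have mg : measurable_fun setT g by have := sub_Lfun_mfun gL; rewrite inE.
have gfin : ('N[leb]_2%:E[EFin \o g] < +oo)%E.
  by have := sub_Lfun_finLfun gL; rewrite inE.
have gge : (0 <= 'N[leb]_2%:E[EFin \o g])%E by exact: Lnorm_ge0.
split=> [t|t0]; rewrite in_itv /= => tT.
  apply/andP; split; rewrite inE /=; first exact: mc.
  rewrite /finite_norm (le_lt_trans (Lnorm2_le (mc t tT) mg D0 g0 _)) //.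
    by move=> z; exact: cD.
  by rewrite lte_mul_pinfty.
pose G := fine 'N[leb]_2%:E[EFin \o g].
have GE : ('N[leb]_2%:E[EFin \o g] = G%:E)%E by rewrite fineK // ge0_fin_numE.
apply: (@squeeze_cvge _ _ _ _ (cst 0%E) _ (fun t => (C * `|t - t0| * G)%:E)).
- near=> t; have tT' : 0 <= t <= T by near: t; apply: withinT.
  apply/andP; split; first exact: Lnorm_ge0.
  rewrite EFinM -GE; apply: Lnorm2_le => //.
  + by apply: measurable_funB; exact: mc.
  + by rewrite mulr_ge0.
  + by move=> z; exact: cC.
- exact: cvg_cst.
- apply: cvg_EFin; first by near=> t.
  rewrite (_ : 0 = C * `|t0 - t0| * G); last by rewrite subrr normr0 mulr0 mul0r.
  apply: cvg_within_filter; apply: cvgM; last exact: cvg_cst.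
  apply: cvgM; first exact: cvg_cst.
  by apply: cvg_norm; apply: cvgB; [exact: cvg_id | exact: cvg_cst].
Unshelve. all: by end_near. Qed.

End L2.

Lemma eq_row_Rintegral (R : realType) (n : nat) (t : R) (f g : R -> 'rV[R]_n) :
  (forall s k, 0 <= s <= t -> f s ord0 k = g s ord0 k) ->
  \row_k \int[@lebesgue_measure R]_(s in `[0, t]) f s ord0 k =
  \row_k \int[@lebesgue_measure R]_(s in `[0, t]) g s ord0 k.
Proof.
move=> fg; apply/rowP => k; rewrite !mxE; apply: eq_Rintegral => s.
by rewrite inE /= in_itv /=; exact: fg.
Qed.

Lemma cvg_eventually (R : realType) (u : nat -> R) (l : R) :
  (exists m, forall n, (m <= n)%N -> u n = l) -> u @ \oo --> l.
Proof.
move=> [m H]; apply/cvgrPdist_le => e e0; exists m => // n /= mn.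
by rewrite H // subrr normr0 ltW.
Qed.

(** * Trajectories of the particle system *)

Section trajectories.
Context (R : realType) (d N Nt : nat) (A B alpha beta Rad lam T Mlow Cc MK LK : R).
Context (m0 K c0 : 'rV[R]_d -> R).
Hypotheses (A0 : 0 < A) (B0 : 0 < B) (beta0 : 0 < beta) (ab : beta < alpha).
Hypothesis d0 : (0 < d)%N.
Hypothesis N0 : (0 < N)%N.
Hypothesis Nt_ge : (N <= Nt)%N.
Hypothesis Rad0 : 0 < Rad.
Hypothesis T0 : 0 < T.
Hypothesis mm0 : measurable_fun setT m0.
Hypothesis Mlow0 : 0 < Mlow.
Hypothesis m0_ge : forall x, Mlow <= m0 x.
Hypothesis mK : measurable_fun setT K.
Hypothesis KM : forall x, `|K x| <= MK.
Hypothesis LK0 : 0 <= LK.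
Hypothesis Klip : forall x y, `|K x - K y| <= LK * \sum_(m < d) `|x ord0 m - y ord0 m|.
Hypothesis mc0 : measurable_fun setT c0.
Hypothesis c0_range : forall x, 0 <= c0 x <= Cc.
Notation path := ('I_N -> R -> 'rV[R]_d).
Implicit Types (X Y Z : path) (x y z : 'rV[R]_d) (s t e : R) (i j : 'I_N) (k : 'I_d) (m : nat).
Notation mul := (@lebesgue_measure R).
Notation frc := (@force R A B alpha beta d).
Notation self_fieldX := (self_field Nt lam K c0).
Notation excl_fieldX := (excl_field Nt lam K c0).
Let nu : R := Nt%:R^-1.

Definition gap e (x : 'I_N -> 'rV[R]_d) := forall i j, i != j -> e <= enorm (x i - x j).

Lemma gapW e e' (x : 'I_N -> 'rV[R]_d) : e <= e' -> gap e' x -> gap e x.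
Proof. by move=> ee g i j ij; exact: le_trans (g _ _ ij). Qed.

Lemma tdrift_gap e X s i k : gap e (X^~ s) ->
  tdrift Nt A B alpha beta Rad lam m0 K c0 e X s i ord0 k =
  nu * total_force frc (X^~ s) i ord0 k + env_drift Rad m0 (self_fieldX X s) (X i s) ord0 k.
Proof.
move=> g; apply: etrans (tdriftE _ _ _ _ _ _ _ _ _ _ _ _ _ _ _) _; congr (_ * _ + _).
rewrite /total_force summxE; apply: eq_bigr => j _.
have [<-|ij] := eqVneq i j; first by rewrite subrr force0 !mxE mulr0.
by rewrite trunc_force_eq // g.
Qed.

Lemma drift_gap e (x : 'I_N -> 'rV[R]_d) v i k : 0 < e -> gap e x ->
  drift A B alpha beta Rad m0 Nt x v i ord0 k =
  nu * total_force frc x i ord0 k + env_drift Rad m0 v (x i) ord0 k.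
Proof.
move=> e0 g; rewrite /drift mxE; congr (_ + _).
rewrite mxE mxE summxE /total_force summxE [in RHS](bigD1 i) //= subrr force0 mxE add0r.
rewrite -mulrN -sumrN; congr (_ * _); apply: eq_bigr => j ji.
rewrite gradient_LJ //; first by rewrite mxE opprK.
by rewrite -enorm_gt0 (lt_le_trans e0) // g // eq_sym.
Qed.

Lemma driftE (x : 'I_N -> 'rV[R]_d) v i k : drift A B alpha beta Rad m0 Nt x v i ord0 k =
  - nu * (\sum_(j < N | j != i) gradient (LJ A B alpha beta) (x i - x j) ord0 k) +
  env_drift Rad m0 v (x i) ord0 k.
Proof. by rewrite /drift mxE mxE mxE summxE mulNr. Qed.

Lemma excl_fieldE X t x : excl_fieldX X t x = c0 x * expR (- lam * prim (fun s => reg_density K Nt (X^~ s) x) t).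
Proof. by []. Qed.

(* Vectors are compared entrywise below, which would make unification unfold these constants. *)
Opaque tdrift drift env_drift self_field excl_field total_force.

Definition trunc_level m : R := m.+1%:R^-1.
Definition tdriftn m := @tdrift R d N Nt A B alpha beta Rad lam m0 K c0 (trunc_level m).
Definition trunc_sol m Z := picard_sol T (tdriftn m) Z.

Let T0' : 0 <= T. Proof. exact: ltW. Qed.

Lemma trunc_level01 m : 0 < trunc_level m <= 1.
Proof. by rewrite /trunc_level invr_gt0 ltr0n /= invf_le1 // ler1n. Qed.

Let bM m X s i k : mpath X -> 0 <= s <= T ->
  `|tdriftn m X s i ord0 k| <= tdrift_max d A B alpha beta Rad lam T Mlow Cc MK (trunc_level m).
Proof. by move=> mX sT; apply: tdrift_bound => //; exact: trunc_level01. Qed.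

Let bL m X Y s i k (a : R) : mpath X -> mpath Y -> 0 <= s <= T -> 0 <= a ->
  (forall (r : R) j k, 0 <= r <= s -> `|X j r ord0 k - Y j r ord0 k| <= a) ->
  `|tdriftn m X s i ord0 k - tdriftn m Y s i ord0 k| <= tdrift_lipc d A B alpha beta Rad lam T Mlow Cc MK LK (trunc_level m) * a.
Proof. by move=> mX mY sT a0 XY; apply: tdrift_lip => //; exact: trunc_level01. Qed.

Let bmeas m d' (E : measurableType d') (X : E -> path) i k : mfamily X ->
  measurable_fun [set: (E * R)%type] (fun p : (E * R)%type => tdriftn m (X p.1) p.2 i ord0 k).
Proof. by move=> mX; exact: (measurable_tdrift _ _ _ _ _ _ _ mm0 Mlow0 m0_ge mK mc0 mX). Qed.

Let L0 m : 0 <= tdrift_lipc d A B alpha beta Rad lam T Mlow Cc MK LK (trunc_level m).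
Proof. exact: (tdrift_lipc_ge0 lam MK A0 B0 beta0 ab Rad0 T0' Mlow0 LK0 c0_range). Qed.

Lemma trunc_sol_solves m Z : cpath (fun i t => Z i (clamp T t)) -> solves (tdriftn m) Z (trunc_sol m Z) T.
Proof. move=> cZ; exact: (picard_sol_solves T0' (L0 m) (@bM m) (@bL m) (@bmeas m) cZ). Qed.

Lemma trunc_sol_cpath m Z : cpath (fun i t => Z i (clamp T t)) -> cpath (trunc_sol m Z).
Proof. move=> cZ; exact: (@picard_sol_cpath _ _ _ _ _ _ _ T0' (L0 m) (@bM m) (@bL m) (@bmeas m) Z cZ). Qed.

Lemma trunc_sol_clamp m Z i t : cpath (fun i t => Z i (clamp T t)) -> trunc_sol m Z i (clamp T t) = trunc_sol m Z i t.
Proof.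
move=> cZ; rewrite /trunc_sol !(picard_sol_map T0' (L0 m) (@bM m) (@bL m) (@bmeas m) cZ) /picard_map clampK //.
Qed.

Lemma trunc_sol_unique m Z X Y : mpath X -> mpath Y -> solves (tdriftn m) Z X T -> solves (tdriftn m) Z Y T ->
  forall i t, 0 <= t <= T -> X i t = Y i t.
Proof.
move=> mX mY; exact: (solves_unique T0' (L0 m) (@bM m) (@bL m) (@bmeas m) mX mY (lexx T)).
Qed.

Lemma trunc_sol_adapted m d' (E : measurableType d') (Z : E -> path) t i :
  (forall w, cpath (fun i t => Z w i (clamp T t))) -> 0 <= t <= T ->
  (forall j s, 0 <= s <= t -> measurable_fun [set: E] (fun w => Z w j s)) ->
  measurable_fun [set: E] (fun w => trunc_sol m (Z w) i t).
Proof.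
move=> cZ tT mZ; have /andP[t0 t1] := tT.
pose Zt w : path := fun j s => Z w j (Num.min s t).
have -> : (fun w => trunc_sol m (Z w) i t) = (fun w => picard_sol T (tdriftn m) (Zt w) i t).
  by apply/funext => w; exact: (picard_sol_stopped T0' (L0 m) (@bM m) (@bL m) (@bmeas m) (cZ w) tT i).
have cZt w : cpath (fun j s => Zt w j (clamp T s)) by exact: stopped_cpath.
have mZt j s : measurable_fun [set: E] (fun w => Zt w j (clamp T s)).
  apply: mZ; have /andP[h _] := clamp_range T0' s.
  by rewrite le_min h t0 /= ge_min lexx orbT.
have H := picard_sol_mfamily T0' (L0 m) (@bM m) (@bL m) (@bmeas m) cZt mZt i.
exact: (measurable_fun_pair1 t H).
Qed.

Definition Genv := (1 + field_max lam T Cc MK / Mlow) * (2 * Rad) ^+ d.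

Lemma Genv_ge0 : 0 <= Genv.
Proof.
have h : 0 <= field_max lam T Cc MK by exact: (field_max_ge0 lam T MK c0_range).
rewrite /Genv; apply: mulr_ge0; last by rewrite exprn_ge0 // mulr_ge0 // ltW.
by apply: addr_ge0 => //; apply: divr_ge0 => //; exact: ltW.
Qed.

Lemma env_self_field_bound X s i k : mpath X -> 0 <= s <= T ->
  `|env_drift Rad m0 (self_fieldX X s) (X i s) ord0 k| <= Genv.
Proof.
move=> mX sT; apply: (env_drift_bound Rad0 mm0 Mlow0 m0_ge); first exact: measurable_self_field1.
by move=> z; exact: self_field_range.
Qed.

(* The properties of a noise path [Z] that hold almost surely and suffice for existence,
   uniqueness and absence of collisions. *)
Definition good Z := [/\ cpath (fun i t => Z i (clamp T t)), (forall i j, i != j -> Z i 0 != Z j 0) &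
  forall kap kap1 rb : R, 0 < kap -> 0 < kap1 -> 0 < rb ->
    exists r, [/\ 0 < r, r <= rb & forall i k s t, 0 <= s -> s <= t -> t <= T ->
      t - s <= kap * r `^ (alpha + 2) -> `|Z i t ord0 k - Z i s ord0 k| <= kap1 * r]].

Lemma min_gap (x : 'I_N -> 'rV[R]_d) : (forall i j, i != j -> x i != x j) -> exists2 e : R, 0 < e & gap e x.
Proof.
move=> xx; pose S := \sum_(p : ('I_N * 'I_N)%type) (enorm (x p.1 - x p.2))^-1.
have S0 : 0 <= S by apply: sumr_ge0 => p _; rewrite invr_ge0 enorm_ge0.
exists (1 + S)^-1; first by rewrite invr_gt0 ltr_pwDl.
move=> i j ij; have g0 : 0 < enorm (x i - x j) by rewrite enorm_gt0 subr_eq0 xx.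
rewrite -[leRHS]invrK lef_pV2 ?posrE ?invr_gt0 ?ltr_pwDl//.
rewrite /S (bigD1 (i, j)) //= addrCA lerDl addr_ge0 // sumr_ge0 // => p _.
by rewrite invr_ge0 enorm_ge0.
Qed.

(** The threshold [e] is chosen from the noise path before [X] and [h]. The drift [h] is compared
    with the singular force only while the gaps are at least [e], so the lemma covers solutions
    truncated at or below [e] as well as solutions of the original system. *)
Lemma good_gap Z : good Z -> exists2 e, 0 < e <= 1 &
  forall X (h : path), cpath X -> (forall i, X i 0 = Z i 0) ->
  (forall i k s t (a b : R), 0 <= s -> s <= t -> t <= T ->
     (forall u, s <= u <= t -> `|h i u ord0 k - a| <= b) ->
     `|X i t ord0 k - X i s ord0 k - (t - s) * a - (Z i t ord0 k - Z i s ord0 k)| <= (t - s) * b) ->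
  (forall i k s, 0 <= s <= T -> gap e (X^~ s) ->
     `|h i s ord0 k - nu * total_force frc (X^~ s) i ord0 k| <= Genv) ->
  forall t, 0 <= t <= T -> gap e (X^~ t).
Proof.
move=> [cZ Z0 nZ].
have nu01 : 0 < nu <= 1.
  have Nt0 : (0 < Nt)%N by exact: leq_trans Nt_ge.
  by rewrite invr_gt0 ltr0n Nt0 /= invf_le1 ?ltr0n // ler1n.
have [kap [kap1 [th [Kc [rbar [[kap0 kap10] th0 Kc0 rbar0 H]]]]]] :=
  no_blowup d A0 B0 beta0 ab N0 nu01 Genv_ge0.
have [dl dl0 Hdl] := min_gap Z0.
(* Radii up to [dl / Kc] make the initial gap [dl] at least [Kc * r], as the starting condition of
   [no_blowup] requires. *)
have rb0 : 0 < Num.min rbar (dl / Kc) by rewrite lt_min rbar0 divr_gt0.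
have [r [r0 rrb Hr]] := nZ kap kap1 _ kap0 kap10 rb0.
move: rrb; rewrite le_min => /andP[rrbar rdl].
have [thr1 HH] := H r r0 rrbar; exists (th * r); first by rewrite mulr_gt0.
move=> X h cX X0 hX hb t /andP[t0 tT].
apply: (HH T X h Z) => //.
- by move=> i j ij; rewrite !X0 (le_trans _ (Hdl i j ij)) // mulrC -ler_pdivlMr.
- by move=> i k s s0 sT g; apply: hb; rewrite ?s0.
Qed.

Lemma solves_increment m Z X i k s t (a b : R) : mpath X -> solves (tdriftn m) Z X T ->
  0 <= s -> s <= t -> t <= T -> (forall u, s <= u <= t -> `|tdriftn m X u i ord0 k - a| <= b) ->
  `|X i t ord0 k - X i s ord0 k - (t - s) * a - (Z i t ord0 k - Z i s ord0 k)| <= (t - s) * b.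
Proof.
move=> mX sX s0 st tT hb; rewrite (sX i t) ?tT ?(le_trans s0)// (sX i s) ?s0 ?(le_trans st)//.
have := b_increment (@bM m) (@bmeas m) mX s0 st tT hb.
by rewrite !mxE; congr (`|_| <= _); ring.
Qed.

Lemma solves0 m Z X i : solves (tdriftn m) Z X T -> X i 0 = Z i 0.
Proof.
move=> sX; rewrite (sX i 0) ?lexx ?T0'//; apply/rowP => k.
by rewrite !mxE set_itv1 Rintegral_set1 addr0.
Qed.

(* Beyond some index the truncation of the singular force is never felt. *)
Lemma trunc_sol_gap Z : good Z -> exists2 e, 0 < e <= 1 &
  (forall X (h : path), cpath X -> (forall i, X i 0 = Z i 0) ->
  (forall i k s t (a b : R), 0 <= s -> s <= t -> t <= T ->
     (forall u, s <= u <= t -> `|h i u ord0 k - a| <= b) ->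
     `|X i t ord0 k - X i s ord0 k - (t - s) * a - (Z i t ord0 k - Z i s ord0 k)| <= (t - s) * b) ->
  (forall i k s, 0 <= s <= T -> gap e (X^~ s) ->
     `|h i s ord0 k - nu * total_force frc (X^~ s) i ord0 k| <= Genv) ->
  forall t, 0 <= t <= T -> gap e (X^~ t)) /\
  forall m, trunc_level m <= e -> forall t, 0 <= t <= T -> gap e ((trunc_sol m Z)^~ t).
Proof.
move=> gZ; have [cZ _ _] := gZ; have [e e01 He] := good_gap gZ; exists e => //; split=> // m me.
have sX := trunc_sol_solves m cZ; have cX := @trunc_sol_cpath m _ cZ.
have mX := cpath_mpath cX.
apply: (He (trunc_sol m Z) (fun i s => tdriftn m (trunc_sol m Z) s i)) => //.
- by move=> i; exact: solves0 sX.
- by move=> i k s t a b; exact: solves_increment.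
- move=> i k s sT g; rewrite /tdriftn (tdrift_gap i k (gapW me g)) addrAC subrr add0r.
  exact: env_self_field_bound.
Qed.

Lemma trunc_level_small e : 0 < e -> exists m0' : nat, forall m, (m0' <= m)%N -> trunc_level m <= e.
Proof.
move=> e0; exists (Num.truncn e^-1) => m mm.
have h : e^-1 < m.+1%:R by rewrite (lt_le_trans (truncnS_gt _)) // ler_nat.
by rewrite /trunc_level -[leRHS]invrK lef_pV2 ?posrE ?invr_gt0// ltW.
Qed.

Lemma solves_gap m m' Z X : mpath X -> (forall t, 0 <= t <= T -> gap (trunc_level m) (X^~ t)) ->
  (forall t, 0 <= t <= T -> gap (trunc_level m') (X^~ t)) -> solves (tdriftn m') Z X T -> solves (tdriftn m) Z X T.
Proof.
move=> mX g g' sX i t tT; apply: etrans (sX i t tT) (congr1 (fun z => Z i t + z) _).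
apply: (eq_row_Rintegral (f := fun s => tdriftn m' X s i) (g := fun s => tdriftn m X s i)) => s k /andP[s0 st].
have sT : 0 <= s <= T by case/andP: tT => _ /(le_trans st) ->; rewrite s0.
exact: (etrans (tdrift_gap i k (g' s sT)) (esym (tdrift_gap i k (g s sT)))).
Qed.

(** At gaps of at least [e] neither truncation acts, so the solution of level [m'] also solves the
    equation of level [m], and uniqueness identifies the two. Clamping extends the equality to all
    times. *)
Lemma trunc_sol_stable Z e m m' : good Z -> trunc_level m <= e -> trunc_level m' <= e ->
  (forall m, trunc_level m <= e -> forall t, 0 <= t <= T -> gap e ((trunc_sol m Z)^~ t)) ->
  forall i t, trunc_sol m Z i t = trunc_sol m' Z i t.
Proof.
move=> [cZ _ _] me me' g i t; rewrite -(trunc_sol_clamp m i t cZ) -(trunc_sol_clamp m' i t cZ).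
have mX n := cpath_mpath (@trunc_sol_cpath n _ cZ).
apply: (@trunc_sol_unique m Z _ _ (mX _) (mX _)); last exact: clamp_range.
- exact: trunc_sol_solves.
- apply: (@solves_gap m m'); [exact: mX| | |exact: trunc_sol_solves].
  + by move=> s sT; apply: gapW (g m' me' s sT).
  + by move=> s sT; apply: gapW (g m' me' s sT).
Qed.

Variable sigma : R.
Notation psol := (path_solution A B alpha beta Rad m0 K Nt sigma lam T).

Lemma path_solution_trunc_sol (W X : path) (X0 : 'I_N -> 'rV[R]_d) m :
  cpath X -> (forall t, 0 <= t <= T -> gap (trunc_level m) (X^~ t)) ->
  solves (tdriftn m) (fun i t => X0 i + sigma *: W i t) X T ->
  psol W X0 c0 X (excl_fieldX X).
Proof.
move=> cX g sX; have mX := cpath_mpath cX; have /andP[e0 e1] := trunc_level01 m.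
have gneq s i j : 0 <= s <= T -> i != j -> X i s - X j s != 0.
  by move=> sT ij; rewrite -enorm_gt0 (lt_le_trans e0) // g.
have itvP s : `[0, T]%classic s -> 0 <= s <= T by rewrite /= in_itv.
have drift_tdrift i k s : 0 <= s <= T ->
    drift A B alpha beta Rad m0 Nt (X^~ s) (excl_fieldX X s) i ord0 k = tdriftn m X s i ord0 k.
  move=> sT; have He := @env_drift_excl_field _ _ _ Nt Rad lam Mlow m0 K c0 X s (X i s) d0 mm0 Mlow0 m0_ge mK mc0 mX.
  apply: etrans (drift_gap _ i k e0 (g s sT)) (etrans _ (esym (tdrift_gap i k (g s sT)))).
  exact: (congr1 (fun z : 'rV[R]_d => nu * total_force frc (X^~ s) i ord0 k + z ord0 k) He).
have lin x := linear_exists lam T0' (measurable_reg_density1 Nt mK x mX) (fun s => reg_density_bound Nt_ge KM (X^~ s) x) (c0 x).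
have mf i j k : measurable_fun [set: R] (fun s => trunc_force A B alpha beta (trunc_level m) (X i s - X j s) ord0 k).
  apply: (measurableT_comp (measurable_trunc_force A B alpha beta (trunc_level m) k)).
  by apply: measurable_subr; exact: mX.
split.
- apply: aeW => s; rewrite in_itv /= => sT i j ij.
  by rewrite -subr_eq0 gneq.
- move=> i j k ij.
  apply: (@eq_integrable _ _ _ mul _ _ (EFin \o (fun s => - trunc_force A B alpha beta (trunc_level m) (X i s - X j s) ord0 k))) => //.
    move=> s; rewrite inE => /itvP sT /=; rewrite gradient_LJ ?gneq// (trunc_force_eq _ _ _ _ (g s sT i j ij)).
    by rewrite [in RHS]mxE.
  apply: (integrable_bounded (M := force_cst A B alpha beta * trunc_level m `^ (- alpha - 1))) => //.
  + exact: lebesgue_cc_lty.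
  + by apply: measurable_funTS; apply: measurable_funN; exact: mf.
  + by move=> s _; rewrite normrN (le_trans (coord_le_enorm _ _)) // enorm_trunc_force // trunc_level01.
- move=> i k.
  have -> : (fun s => (env_drift Rad m0 (excl_fieldX X s) (X i s) ord0 k)%:E) =
      EFin \o (fun s => env_drift Rad m0 (self_fieldX X s) (X i s) ord0 k).
    apply/funext => s; apply: (congr1 (fun z : 'rV[R]_d => (z ord0 k)%:E)).
    exact: (env_drift_excl_field Nt Rad lam s (X i s) d0 mm0 Mlow0 m0_ge mK mc0 mX).
  apply: (integrable_bounded (M := Genv)) => //.
  + exact: lebesgue_cc_lty.
  + apply: measurable_funTS.
    exact: (measurable_fun_pair2 (0 : R) (measurable_env_drift Nt Rad lam mm0 Mlow0 m0_ge mK mc0 (mpath_family mX) i k)).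
  + by move=> s /itvP sT; exact: env_self_field_bound.
- by move=> x; have [] := lin x.
- move=> i t; rewrite in_itv /= => tT; apply: etrans (sX i t tT) (etrans _ (addrAC _ _ _)).
  apply: (congr1 (fun z => X0 i + sigma *: W i t + z)).
  apply: (eq_row_Rintegral (f := fun s => tdriftn m X s i)
    (g := fun s => drift A B alpha beta Rad m0 Nt (X^~ s) (excl_fieldX X s) i)) => s k /andP[s0 st].
  by apply/esym/drift_tdrift; rewrite s0; case/andP: tT => _; exact: le_trans.
- by move=> t x; rewrite in_itv /= => tT; have [_] := lin x; exact.
Qed.

Lemma path_solutionE (W X : path) (X0 : 'I_N -> 'rV[R]_d) (c : R -> 'rV[R]_d -> R) :
  good (fun i t => X0 i + sigma *: W i t) ->
  (forall i, {within `[0, T], continuous (X i)}) -> psol W X0 c0 X c ->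
  exists m1 : nat, forall m, (m1 <= m)%N -> forall t, 0 <= t <= T ->
   (forall i, X i t = trunc_sol m (fun i t => X0 i + sigma *: W i t) i t) /\
   forall x, c t x = excl_fieldX (trunc_sol m (fun i t => X0 i + sigma *: W i t)) t x.
Proof.
set Z : path := fun i t => _; move=> gZ cX [sep iint eint cint part field].
pose X' : path := fun i t => X i (clamp T t).
have X'E i t : 0 <= t <= T -> X' i t = X i t by move=> tT; rewrite /X' clamp_id.
have cX' : cpath X'.
  move=> i k t; have c1 := clamp_continuous T0' (cX i) (x := t).
  by apply: (@continuous_comp _ _ _ (fun t => X i (clamp T t)) (fun x : 'rV[R]_d => x ord0 k) t c1);
    exact: coord_continuous.
have mX' := cpath_mpath cX'.
have itvT s t : `[0, t]%classic s -> t <= T -> 0 <= s <= T.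
  by rewrite /= in_itv /= => /andP[-> /le_trans]; exact.
have cE t x : 0 <= t <= T -> c t x = excl_fieldX X' t x.
  move=> tT; rewrite excl_fieldE.
  have rd s : 0 <= s <= T -> reg_density K Nt (X'^~ s) x = reg_density K Nt (X^~ s) x.
    by move=> sT; congr reg_density; apply/funext => i; exact: X'E.
  have mu := measurable_reg_density1 Nt mK x mX'.
  have bu s := reg_density_bound Nt_ge KM (X'^~ s) x.
  apply: (@linear_unique _ T lam MK _ T0' mu bu (c0 x) (c^~ x)) => //.
    by apply: eq_integrable (cint x) => // s; rewrite inE => /itvT /(_ (lexx T)) sT /=; rewrite rd.
  move=> t' t'T; have t'i : t' \in `[0, T] by rewrite in_itv.
  have I : \int[mul]_(s in `[0, t']) (c s x * reg_density K Nt (X^~ s) x) =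
           \int[mul]_(s in `[0, t']) (c s x * reg_density K Nt (X'^~ s) x).
    apply: eq_Rintegral => s; rewrite inE => /itvT h; rewrite rd //; apply: h.
    by case/andP: t'T.
  by rewrite -I (field t' x t'i).
have cf t : 0 <= t <= T -> c t = excl_fieldX X' t by move=> tT; apply/funext => x; exact: cE.
(* Collisions are not excluded at this stage, and there the value of [h] is meaningless. Only its
   integrability and its values at gaps of at least [e] enter the argument. *)
pose h : path := fun i s => drift A B alpha beta Rad m0 Nt (X'^~ s) (c s) i.
have hE i k s : 0 <= s <= T -> h i s ord0 k = drift A B alpha beta Rad m0 Nt (X^~ s) (c s) i ord0 k.
  by move=> sT; rewrite /h (_ : X'^~ s = X^~ s) //; apply/funext => j; exact: X'E.
have ih i k t : t <= T -> mul.-integrable `[0, t] (EFin \o (fun s => h i s ord0 k)).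
  move=> tT.
  have i1 : mul.-integrable `[0, T] (EFin \o (fun s => \sum_(j < N | j != i) gradient (LJ A B alpha beta) (X i s - X j s) ord0 k)).
    rewrite (_ : _ \o _ = fun s => (\sum_(j < N | j != i) (gradient (LJ A B alpha beta) (X i s - X j s) ord0 k)%:E)%E); last first.
      by apply/funext => s /=; rewrite sumEFin.
    by apply: integrable_sum => // j ji; apply: iint; rewrite eq_sym.
  have i2 := integrableZl _ (- nu) i1; move/(_ (measurable_itv _)) : i2 => i2.
  have i3 := integrableD _ i2 (eint i k); move/(_ (measurable_itv _)) : i3 => i3.
  have : mul.-integrable `[0, T] (EFin \o (fun s => h i s ord0 k)).
    apply: eq_integrable i3 => // s; rewrite inE => /itvT /(_ (lexx T)) sT /=.
    by rewrite hE // driftE -EFinM -EFinD.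
  by apply: integrableS => //; apply: subset_itvl; rewrite bnd_simp.
have eqX i t : 0 <= t <= T -> X' i t = Z i t + \row_k \int[mul]_(s in `[0, t]) h i s ord0 k.
  move=> tT; rewrite X'E //.
  apply: etrans (part i t _) (etrans (addrAC _ _ _) (congr1 (fun z => Z i t + z) _)); first by rewrite in_itv.
  apply: (eq_row_Rintegral (f := fun s => drift A B alpha beta Rad m0 Nt (X^~ s) (c s) i) (g := fun s => h i s)) => s k /andP[s0 st].
  by apply/esym/hE; rewrite s0; case/andP: tT => _; exact: le_trans.
have incr i k s t a b : 0 <= s -> s <= t -> t <= T -> (forall u, s <= u <= t -> `|h i u ord0 k - a| <= b) ->
     `|X' i t ord0 k - X' i s ord0 k - (t - s) * a - (Z i t ord0 k - Z i s ord0 k)| <= (t - s) * b.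
  move=> s0 st tT hb; rewrite (eqX i t) ?tT ?(le_trans s0)// (eqX i s) ?s0 ?(le_trans st)//.
  have := Rintegral_increment s0 st (ih i k t tT) hb.
  by rewrite !mxE; congr (`|_| <= _); ring.
have [e /andP[e0 e1] [Hgap gsol]] := trunc_sol_gap gZ.
have envE i s : 0 <= s <= T -> env_drift Rad m0 (c s) (X' i s) = env_drift Rad m0 (self_fieldX X' s) (X' i s).
  move=> sT; rewrite (cf s sT); exact: (env_drift_excl_field Nt Rad lam s (X' i s) d0 mm0 Mlow0 m0_ge mK mc0 mX').
have g : forall t, 0 <= t <= T -> gap e (X'^~ t).
  apply: (Hgap X' h) => //.
  - move=> i; rewrite eqX ?lexx ?T0'//; apply/rowP => k.
    by rewrite mxE [X in _ + X]mxE set_itv1 Rintegral_set1 addr0.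
  - move=> i k s sT gs; rewrite /h (drift_gap _ i k e0 gs) addrAC subrr add0r envE //.
    exact: env_self_field_bound.
have [m1 Hm1] := trunc_level_small e0; exists m1 => m mm1.
have me := Hm1 m mm1; have [cZ _ _] := gZ.
have sX' : solves (tdriftn m) Z X' T.
  move=> i t tT; apply: etrans (eqX i t tT) (congr1 (fun z => Z i t + z) _).
  apply: (eq_row_Rintegral (f := fun s => h i s) (g := fun s => tdriftn m X' s i)) => s k /andP[s0 st].
  have sT : 0 <= s <= T by rewrite s0; case/andP: tT => _; exact: le_trans.
  have gm := gapW me (g s sT).
  apply: etrans (drift_gap _ i k e0 (g s sT)) (etrans _ (esym (tdrift_gap i k gm))).
  exact: (congr1 (fun z : 'rV[R]_d => nu * total_force frc (X'^~ s) i ord0 k + z ord0 k) (envE i s sT)).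
have XS i t : 0 <= t <= T -> X' i t = trunc_sol m Z i t.
  exact: (trunc_sol_unique mX' (cpath_mpath (@trunc_sol_cpath m _ cZ)) sX' (trunc_sol_solves m cZ)).
move=> t tT; split=> [i|x]; first by rewrite -X'E // XS.
have E : X' = trunc_sol m Z.
  apply/funext => i; apply/funext => s.
  by rewrite -(trunc_sol_clamp m i s cZ) -XS ?clamp_range // /X' clampK.
by rewrite -E; exact: cE.
Qed.

Lemma path_solution_unique (W X Y : path) (X0 : 'I_N -> 'rV[R]_d) (c c' : R -> 'rV[R]_d -> R) :
  good (fun i t => X0 i + sigma *: W i t) ->
  (forall i, {within `[0, T], continuous (X i)}) -> psol W X0 c0 X c ->
  (forall i, {within `[0, T], continuous (Y i)}) -> psol W X0 c0 Y c' ->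
  forall t, 0 <= t <= T -> (forall i, X i t = Y i t) /\ forall x, c t x = c' t x.
Proof.
move=> gZ cX sX cY sY t tT.
have [m1 H1] := path_solutionE gZ cX sX; have [m2 H2] := path_solutionE gZ cY sY.
have [E1 F1] := H1 _ (leq_maxl m1 m2) t tT; have [E2 F2] := H2 _ (leq_maxr m1 m2) t tT.
by split=> [i|x]; [rewrite E1 E2 | rewrite F1 F2].
Qed.

(* The sequence is eventually constant, from an index that depends on [Z]: taking the limit
   keeps the solution adapted. *)
Definition lim_path Z : path := fun i t => \row_k limn (fun m => trunc_sol m Z i t ord0 k).

Lemma lim_pathE Z : good Z -> exists m1 : nat, forall m, (m1 <= m)%N ->
  lim_path Z = trunc_sol m Z /\ forall t, 0 <= t <= T -> gap (trunc_level m) ((trunc_sol m Z)^~ t).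
Proof.
move=> gZ; have [e /andP[e0 e1] [_ Hg]] := trunc_sol_gap gZ.
have [m1 Hm1] := trunc_level_small e0; exists m1 => m m1m; have me := Hm1 m m1m.
split; last by move=> t tT; apply: gapW (Hg m me t tT).
apply/funext => i; apply/funext => t; apply/rowP => k; rewrite mxE; apply: cvg_lim => //.
apply: cvg_eventually; exists m1 => n m1n.
by rewrite (trunc_sol_stable gZ (Hm1 n m1n) me Hg).
Qed.

Lemma lim_path_cpath Z : good Z -> cpath (lim_path Z).
Proof.
move=> gZ; have [cZ _ _] := gZ; have [m /(_ m (leqnn m)) [-> _]] := lim_pathE gZ.
exact: (@trunc_sol_cpath m _ cZ).
Qed.

Lemma lim_path_clamp Z i t : good Z -> lim_path Z i (clamp T t) = lim_path Z i t.
Proof.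
move=> gZ; have [cZ _ _] := gZ; have [m /(_ m (leqnn m)) [-> _]] := lim_pathE gZ.
exact: trunc_sol_clamp.
Qed.

Lemma lim_path_neq Z i j t : good Z -> 0 <= t <= T -> i != j -> lim_path Z i t <> lim_path Z j t.
Proof.
move=> gZ tT ij; have [m /(_ m (leqnn m)) [-> g]] := lim_pathE gZ => E.
have /andP[e0 _] := trunc_level01 m; have := g t tT i j ij.
by rewrite E subrr enorm0 leNgt e0.
Qed.

Lemma lim_path_solution (W : path) (X0 : 'I_N -> 'rV[R]_d) (Z := fun i t => X0 i + sigma *: W i t) :
  good Z -> psol W X0 c0 (lim_path Z) (excl_fieldX (lim_path Z)).
Proof.
move=> gZ; have [cZ _ _] := gZ; have [m /(_ m (leqnn m)) [E g]] := lim_pathE gZ.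
rewrite E; apply: (path_solution_trunc_sol (m := m)) => //; first exact: (@trunc_sol_cpath m _ cZ).
exact: trunc_sol_solves.
Qed.

Section adaptedness.
Context d' (E : measurableType d').

Lemma lim_path_adapted (Z : E -> path) i t : (forall w, good (Z w)) -> 0 <= t <= T ->
  (forall j s, 0 <= s <= t -> measurable_fun [set: E] (fun w => Z w j s)) ->
  measurable_fun [set: E] (fun w => lim_path (Z w) i t).
Proof.
move=> gZ tT mZ; apply: measurable_fun_rVP => k.
apply: (@measurable_realfun.measurable_fun_cvg _ _ _ _ (fun m w => trunc_sol m (Z w) i t ord0 k)).
  move=> m; apply: measurable_row; apply: trunc_sol_adapted => // w.
  by have [cZ _ _] := gZ w.
move=> w _; have [m1 H] := lim_pathE (gZ w).
apply: cvg_eventually; exists m1 => n /H [E1 _].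
by rewrite /rV_coord /= E1.
Qed.

Lemma cpath_mfamily (X : E -> path) : (forall w, cpath (X w)) ->
  (forall i s, measurable_fun [set: E] (fun w => X w i s)) -> mfamily X.
Proof.
move=> cX mX i; apply: measurable_fun_rVP => k.
have H := @measurable_caratheodory _ E R (fun t w => X w i t ord0 k)
  (fun t => measurable_row k (mX i t)) (fun w => @cX w i k).
apply: (measurableT_comp H (g := fun p : (E * R)%type => (p.2, p.1))).
exact: measurable_fun_pair.
Qed.

(** The field at time [t] involves the particles up to [t] only. Stopping them at [t] makes the
    whole family measurable for the sigma-algebra at hand, so that joint measurability applies. *)
Lemma excl_field_adapted (X : E -> path) t x : (forall w, cpath (X w)) -> 0 <= t <= T ->
  (forall j s, 0 <= s <= t -> measurable_fun [set: E] (fun w => X w j s)) ->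
  measurable_fun [set: E] (fun w => excl_fieldX (X w) t x).
Proof.
move=> cX tT mX; have /andP[t0 t1] := tT.
pose Xt w : path := fun j s => X w j (Num.min (clamp T s) t).
have cXt w : cpath (Xt w).
  apply: stopped_cpath => // i k s.
  have c1 : {for s, continuous (clamp T)}.
    have cid : {within `[0, T], continuous (@id R)} by apply: continuous_subspaceT => u; exact: cvg_id.
    exact: (clamp_continuous T0' cid).
  exact: (@continuous_comp _ _ _ (clamp T) (fun u => X w i u ord0 k) s c1 (@cX w i k _)).
have mXt i s : measurable_fun [set: E] (fun w => Xt w i s).
  apply: mX; have /andP[h _] := clamp_range T0' s.
  by rewrite le_min h t0 /= ge_min lexx orbT.
have H := measurable_excl_field Nt lam mK mc0 (cpath_mfamily cXt mXt).
have -> : (fun w => excl_fieldX (X w) t x) = (fun w => excl_fieldX (Xt w) t x).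
  apply/funext => w; rewrite !excl_fieldE; apply: (congr1 (fun u => c0 x * expR (- lam * u))).
  apply: eq_Rintegral => s; rewrite inE /= in_itv /= => /andP[s0 st].
  have e1 : (X w)^~ s = (Xt w)^~ s.
    by apply/funext => i; rewrite /Xt clamp_id ?s0 ?(le_trans st)// min_l.
  by rewrite e1.
have H2 := measurable_fun_pair1 t H.
exact: (measurable_fun_pair1 x H2).
Qed.

Lemma excl_field_jointly_measurable (X : E -> path) : (forall w, cpath (X w)) ->
  (forall i s, measurable_fun [set: E] (fun w => X w i s)) ->
  measurable_fun [set: (R * ('rV[R]_d * E))%type]
    (fun p : (R * ('rV[R]_d * E))%type => excl_fieldX (X p.2.2) p.1 p.2.1).
Proof.
move=> cX mX; have H := measurable_excl_field Nt lam mK mc0 (cpath_mfamily cX mX).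
apply: (measurableT_comp H (g := fun p : (R * ('rV[R]_d * E))%type => (p.2.2, p.2.1, p.1))).
apply: measurable_fun_pair => //; apply: measurable_fun_pair.
- exact: (measurableT_comp measurable_snd measurable_snd).
- exact: (measurableT_comp measurable_fst measurable_snd).
Qed.

End adaptedness.

Lemma excl_field_continuous_L2 X : mpath X -> c0 \in Lfun (@lebesgue_rV R d) 2%:E ->
  continuous_L2 T (excl_fieldX X).
Proof.
move=> mX cL2; pose Q := expR (`|lam| * MK * T).
have MK0 : 0 <= MK by exact: le_trans (KM 0).
have Q0 : 0 <= Q by exact: expR_ge0.
have c00 x : 0 <= c0 x by have /andP[] := c0_range x.
have mu x := measurable_reg_density1 Nt mK x mX.
have bu x s := reg_density_bound Nt_ge KM (X^~ s) x.
have lb x t : 0 <= t <= T -> - lam * prim (fun s => reg_density K Nt (X^~ s) x) t <= `|lam| * MK * T.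
  by move=> /andP[t0 t1]; have [] := linear_bound lam (mu x) (bu x) t0 t1.
apply: (continuous_L2_lip (C := Q * (`|lam| * MK)) (D := Q) cL2) => //.
- by rewrite !mulr_ge0.
- by move=> t tT; exact: measurable_excl_field1.
- move=> t x tT; rewrite excl_fieldE normrM (ger0_norm (c00 x)) mulrC ler_wpM2r //.
  by rewrite ger0_norm ?expR_ge0// ler_expR lb.
- move=> s t x sT tT; rewrite !excl_fieldE -mulrBr normrM (ger0_norm (c00 x)) mulrC ler_wpM2r //.
  apply: (le_trans (expR_lip (lb x t tT) (lb x s sT))); rewrite -[leRHS]mulrA ler_wpM2l //.
  rewrite -mulrBr normrM normrN -[leRHS]mulrA ler_wpM2l //.
  have /andP[s0 s1] := sT; have /andP[t0 t1] := tT.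
  wlog st : s t sT tT s0 s1 t0 t1 / s <= t => [H|].
    by have [/H|/ltW/H] := leP s t; [exact | rewrite distrC [`|t - s|]distrC; exact].
  by rewrite [`|t - s|]ger0_norm ?subr_ge0//; exact: (prim_lip (mu x) (bu x)).
Qed.

End trajectories.

(** * Adaptedness, and proof of the theorem *)

Section filtration.
Context (T : pointedType) (G : set (set T)).
Hypothesis sG : sigma_algebra setT G.

(** Equipped with the sigma-algebra [G], the sample space becomes a measurable type of its own, so
    that results for an arbitrary parameter space [E] yield adaptedness. *)
Lemma sub_measurableP d (E : measurableType d) (f : T -> E) :
  (forall B, measurable B -> G (f @^-1` B)) <->
  measurable_fun [set: g_sigma_algebraType G] (f : g_sigma_algebraType G -> E).
Proof.
split=> [H _ B mB|H B mB].
  by rewrite setTI; apply: sub_sigma_algebra; exact: H.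
have := H measurableT B mB; rewrite setTI.
by rewrite /measurable /= sigma_algebra_id.
Qed.

End filtration.

Theorem theorem2p2
  (R : realType) (d N Nt : nat) (T : R)
  (A B alpha beta Rad sigma lambda : R)
  (m0 : 'rV[R]_d -> R) (Mlow mhigh : R) (K : 'rV[R]_d -> R)
  (disp : measure_display) (Omega : measurableType disp)
  (P : probability Omega R) (F : R -> set (set Omega))
  (W : 'I_N -> R -> Omega -> 'rV[R]_d)
  (X0 : 'I_N -> Omega -> 'rV[R]_d) (c0 : 'rV[R]_d -> R)
  (d_ge1 : (1 <= d)%N) (N_ge2 : (2 <= N)%N) (Nt_ge : (N <= Nt)%N) (T_gt0 : 0 < T)
  (A_gt0 : 0 < A) (B_gt0 : 0 < B) (beta_gt0 : 0 < beta) (alpha_gt : beta < alpha)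
  (Rad_gt0 : 0 < Rad) (lambda_gt0 : 0 < lambda)
  (m0_measurable : measurable_fun setT m0)
  (Mlow_gt0 : 0 < Mlow) (m0_bounds : forall x, Mlow <= m0 x <= mhigh)
  (K_smooth : Cb_smooth K)
  (F_usual : usual_filtration P T F)
  (W_wiener : forall i, wiener_process P T F (W i))
  (W_independent : independent_processes P T W)
  (X0_measurable : forall i, sub_measurable (F 0) (X0 i))
  (X0_moment : (\int[P]_w (\sum_(i < N) enorm (X0 i w) ^+ 2)%:E < +oo)%E)
  (X0_energy : forall i j : 'I_N, (i < j)%N ->
     (\int[P]_w LJ_ext A B alpha beta (X0 i w - X0 j w)%R < +oo)%E)
  (c0_measurable : measurable_fun setT c0)
  (c0_bounded : exists M : R, forall x, `|c0 x| <= M)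
  (c0_L2 : c0 \in Lfun (@lebesgue_rV R d) 2%:E)
  (c0_range : forall x, 0 <= c0 x <= m0 x) :
  let solution :=
    strong_solution A B alpha beta Rad m0 K Nt sigma lambda P T F W X0 c0 in
  let collision (X : 'I_N -> R -> Omega -> 'rV[R]_d) :=
    [set w | exists (t : R) i j, [/\ t \in `[0, T], i != j & X i t w = X j t w]] in
  pathwise_unique A B alpha beta Rad m0 K Nt sigma lambda P T F W X0 c0 /\
  exists (X : 'I_N -> R -> Omega -> 'rV[R]_d) (c : R -> 'rV[R]_d -> Omega -> R),
    [/\ solution X c,
        measurable (collision X),
        P (collision X) = 0%E &
        {ae P, forall w,
          [/\ forall (t : R) x, t \in `[0, T] -> 0 <= c t x w,
              exists M : R, forall (t : R) x, t \in `[0, T] -> `|c t x w| <= M &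
              continuous_L2 T (fun t x => c t x w)]}].
Proof.
move=> solution collision.
have T0 : 0 <= T by exact: ltW.
have d0 : (0 < d)%N by [].
have N0 : (0 < N)%N by exact: ltnW.
have m0_ge x : Mlow <= m0 x by have /andP[] := m0_bounds x.
have mK : measurable_fun setT K by apply: continuous_measurable_rV; exact: Cb_smooth_continuous.
have [MK MK0 KM] := Cb_smooth_bounded K_smooth.
have [LK LK0 Klip] := Cb_smooth_lip K_smooth.
have [Cc Hc0] := c0_bounded.
have c0_r x : 0 <= c0 x <= Cc.
  by have /andP[h _] := c0_range x; rewrite h (le_trans (ler_norm _) (Hc0 x)).
pose Z w : 'I_N -> R -> 'rV[R]_d := fun i t => X0 i w + sigma *: W i t w.
have alpha2 : 2 < alpha + 2 by rewrite ltrDr (lt_trans beta_gt0).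
have itvP t : (t \in `[0, T]) = (0 <= t <= T) by rewrite in_itv.
have X0m i : measurable_fun setT (X0 i).
  move=> _ B' mB; rewrite setTI; apply: (filtration_sub_measurable F_usual (t := 0)); last exact: X0_measurable.
  by rewrite itvP lexx.
have X0_neq : {ae P, forall w, forall i j, i != j -> X0 i w != X0 j w}.
  have H (p : ('I_N * 'I_N)%type) : {ae P, forall w, (p.1 < p.2)%N -> X0 p.1 w - X0 p.2 w != 0}.
    case: (ltnP p.1 p.2) => p12; last by apply: aeW.
    have mX : measurable_fun setT (fun w => X0 p.1 w - X0 p.2 w) by exact: measurable_subr.
    have H0 := LJ_ext_ae A_gt0 B_gt0 beta_gt0 alpha_gt mX (X0_energy _ _ p12).
    by apply: filterS H0 => w h _; exact: h.
  have H' : {ae P, forall w, forall p : ('I_N * 'I_N)%type, (p.1 < p.2)%N -> X0 p.1 w - X0 p.2 w != 0}.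
    exact: filter_forall.
  apply: filterS H' => w Hw i j ij.
  have [ij'|ji|/val_inj e] := ltngtP i j; last by rewrite e eqxx in ij.
  - by have := Hw (i, j) ij'; rewrite subr_eq0.
  - by have := Hw (j, i) ji; rewrite subr_eq0 eq_sym.
have good_ae : {ae P, forall w, good alpha T (Z w)}.
  have H1 := wiener_noise T_gt0 F_usual W_wiener sigma alpha2.
  have H2 : {ae P, forall w, forall i, {within `[0, T], continuous (fun t => W i t w)}}.
    by apply: filter_forall => i; exact: wiener_continuous (W_wiener i).
  have H3 : {ae P, forall w, forall i, W i 0 w = 0}.
    by apply: filter_forall => i; exact: wiener_start (W_wiener i).
  apply: filterS2 (filterI H1 H2) (filterI H3 X0_neq) => w [h1 h2] [h3 h4].
  have ZE i t k : Z w i t ord0 k = X0 i w ord0 k + sigma * W i t w ord0 k by rewrite !mxE.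
  split.
  - move=> i k; have c1 := clamp_continuous T0 (h2 i).
    rewrite (_ : (fun t => _) = (fun t => X0 i w ord0 k + sigma * W i (clamp T t) w ord0 k)); last first.
      by apply/funext => t; exact: ZE.
    move=> t; apply: cvgD; first exact: cvg_cst.
    apply: cvgM; first exact: cvg_cst.
    by apply: (@continuous_comp _ _ _ (fun u => W i (clamp T u) w) (fun x : 'rV[R]_d => x ord0 k) t (c1 t));
      exact: coord_continuous.
  - by move=> i j ij; rewrite /Z !h3 scaler0 !addr0 h4.
  - move=> kap kap1 rb k0 k1 rb0; have [r [r0 rr Hr]] := h1 kap kap1 rb k0 k1 rb0.
    exists r; split=> // i k s t s0 st tT ts; rewrite !ZE opprD addrACA subrr add0r.
    exact: Hr.
split.
  move=> X c X' c' [_ cX _ _ _ eX] [_ cX' _ _ _ eX'].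
  apply: filterS2 (filterI good_ae eX) eX' => w [gw ew] ew' t; rewrite itvP => tT.
  exact: (path_solution_unique A_gt0 B_gt0 beta_gt0 alpha_gt d0 N0 Nt_ge Rad_gt0 T_gt0 m0_measurable
    Mlow_gt0 m0_ge mK KM LK0 Klip c0_measurable c0_r gw (cX^~ w) ew (cX'^~ w) ew' tT).
(* Outside the good event the noise is replaced by constant distinct positions, so that no
   trajectory at all has a collision; completeness of [F 0] preserves adaptedness. *)
pose v (i : 'I_N) : 'rV[R]_d := const_mx i%:R.
pose Zt w : 'I_N -> R -> 'rV[R]_d := fun i t => if `[< good alpha T (Z w) >] then Z w i t else v i.
have goodv : good alpha T (fun i (_ : R) => v i).
  split.
  - by move=> i k t; exact: cvg_cst.
  - move=> i j ij; apply/eqP => /matrixP /(_ ord0 (Ordinal d0)); rewrite !mxE => /eqP.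
    by rewrite eqr_nat => /eqP /val_inj e; rewrite e eqxx in ij.
  - move=> kap kap1 rb _ k1 rb0; exists rb; split=> // i k s t _ _ _ _.
    by rewrite subrr normr0 mulr_ge0 // ltW.
have goodZt w : good alpha T (Zt w).
  rewrite /Zt; case: asboolP => [//|_]; exact: goodv.
have sF t : 0 <= t <= T -> sigma_algebra setT (F t).
  by move=> tT; apply: (filtration_sigma_algebra F_usual); rewrite itvP.
have Fle s t A' : 0 <= s -> s <= t -> t <= T -> F s A' -> F t A'.
  by move=> s0 st tT; exact: (filtration_nondecreasing F_usual).
have bad : F 0 (~` [set w | good alpha T (Z w)]) by apply: (filtration_complete F_usual).
have ZtF i s t : 0 <= s -> s <= t -> t <= T ->
    measurable_fun [set: g_sigma_algebraType (F t)] (fun w => Zt w i s).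
  move=> s0 st tT; have t0 := le_trans s0 st.
  have tT' : 0 <= t <= T by rewrite t0.
  have mX0 : measurable_fun [set: g_sigma_algebraType (F t)] (X0 i : g_sigma_algebraType (F t) -> _).
    by apply/(sub_measurableP (sF t tT')) => B' mB; apply: (Fle 0) => //; exact: X0_measurable.
  have mW : measurable_fun [set: g_sigma_algebraType (F t)] (W i s : g_sigma_algebraType (F t) -> _).
    apply/(sub_measurableP (sF t tT')) => B' mB; apply: (Fle s) => //.
    by apply: (wiener_adapted (W_wiener i)) => //; rewrite itvP s0 (le_trans st).
  apply: measurable_fun_ifT.
  - apply: (measurable_fun_bool true); rewrite setTI.
    rewrite (_ : _ @^-1` _ = ~` (~` [set w | good alpha T (Z w)])); last first.
      by rewrite setCK; apply/seteqP; split => w /= /asboolP.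
    apply: measurableC; apply: sub_sigma_algebra; exact: (Fle 0).
  - apply: measurable_fun_rVP => k.
    rewrite (_ : _ \o _ = fun w => X0 i w ord0 k + sigma * W i s w ord0 k); last first.
      by apply/funext => w; rewrite /rV_coord /= !mxE.
    apply: measurable_funD; first exact: measurable_row mX0.
    by apply: measurable_funM => //; exact: measurable_row mW.
  - exact: measurable_cst.
pose lp w := lim_path Nt A B alpha beta Rad lambda T m0 K c0 (Zt w).
have lp_cpath w : cpath (lp w).
  exact: (lim_path_cpath A_gt0 B_gt0 beta_gt0 alpha_gt N0 Nt_ge Rad_gt0 T_gt0 m0_measurable
    Mlow_gt0 m0_ge mK KM LK0 Klip c0_measurable c0_r (goodZt w)).
have lpF i s t : 0 <= s -> s <= t -> t <= T ->
    measurable_fun [set: g_sigma_algebraType (F t)] (fun w => lp w i s).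
  move=> s0 st tT; have sT : 0 <= s <= T by rewrite s0 (le_trans st).
  apply: (lim_path_adapted (E := g_sigma_algebraType (F t)) (Z := Zt) lambda A_gt0 B_gt0 beta_gt0 alpha_gt N0 Nt_ge Rad_gt0 T_gt0 m0_measurable
    Mlow_gt0 m0_ge mK KM LK0 Klip c0_measurable c0_r _ goodZt sT).
  by move=> j r /andP[r0 rs]; apply: ZtF => //; exact: le_trans st.
have lpm i s : measurable_fun [set: Omega] (fun w => lp w i s).
  have cT := clamp_range T0 s; have /andP[c1 c2] := cT.
  (* The paths are frozen outside [[0, T]], so measurability at every real time follows from
     adaptedness at the clamped time. *)
  have -> : (fun w => lp w i s) = (fun w => lp w i (clamp T s)).
    apply/funext => w; apply/esym.
    exact: (lim_path_clamp lambda A_gt0 B_gt0 beta_gt0 alpha_gt N0 Nt_ge Rad_gt0 T_gt0 m0_measurable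
      Mlow_gt0 m0_ge mK KM LK0 Klip c0_measurable c0_r _ _ (goodZt w)).
  have := lpF i (clamp T s) (clamp T s) c1 (lexx _) c2.
  move=> /(sub_measurableP (sF _ cT)) H _ B' mB; rewrite setTI.
  by apply: (filtration_sub_measurable F_usual (t := clamp T s)); [rewrite itvP | exact: H].
exists (fun i t w => lp w i t), (fun t x w => excl_field Nt lambda K c0 (lp w) t x).
have cge t x w : 0 <= t <= T -> 0 <= excl_field Nt lambda K c0 (lp w) t x <= field_max lambda T Cc MK.
  by move=> tT; apply: excl_field_range => //; exact: cpath_mpath.
have coll0 : collision (fun i t w => lp w i t) = set0.
  apply/seteqP; split => // w [t [i [j [tT ij]]]].
  apply: (lim_path_neq A_gt0 B_gt0 beta_gt0 alpha_gt N0 Nt_ge Rad_gt0 T_gt0 m0_measurable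
    Mlow_gt0 m0_ge mK KM LK0 Klip c0_measurable c0_r (goodZt w) _ ij).
  by rewrite -itvP.
split; last 1 first.
- apply: aeW => w; split.
  + by move=> t x; rewrite itvP => tT; have /andP[] := cge t x w tT.
  + exists (field_max lambda T Cc MK) => t x; rewrite itvP => tT; have /andP[h1 h2] := cge t x w tT.
    by rewrite ger0_norm.
  + exact: (excl_field_continuous_L2 lambda T Nt_ge mK KM c0_measurable c0_r
      (cpath_mpath (lp_cpath w)) c0_L2).
- split.
  + move=> i t; rewrite itvP => tT; apply/(sub_measurableP (sF t tT)).
    by have /andP[t0 t1] := tT; exact: lpF.
  + move=> i w; apply: continuous_subspaceT => t; apply: continuous_row_at => k.
    exact: lp_cpath.
  + by move=> t x w; rewrite itvP => tT; have /andP[] := cge t x w tT.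
  + move=> t x; rewrite itvP => tT; apply/(sub_measurableP (sF t tT)).
    have /andP[t0 t1] := tT.
    apply: (excl_field_adapted (E := g_sigma_algebraType (F t)) (X := lp) Nt lambda T_gt0 mK c0_measurable x lp_cpath tT).
    by move=> j s /andP[s0 st]; exact: lpF.
  + apply: measurable_funTS.
    exact: (excl_field_jointly_measurable Nt lambda mK c0_measurable lp_cpath lpm).
  + apply: filterS good_ae => w gw.
    have -> : lp w = lim_path Nt A B alpha beta Rad lambda T m0 K c0 (Z w).
      by rewrite /lp; congr lim_path; apply/funext => i; apply/funext => t; rewrite /Zt asboolT.
    exact: (lim_path_solution lambda A_gt0 B_gt0 beta_gt0 alpha_gt d0 N0 Nt_ge Rad_gt0 T_gt0 m0_measurable
      Mlow_gt0 m0_ge mK KM LK0 Klip c0_measurable c0_r gw).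
- by rewrite coll0.
- by rewrite coll0 measure0.
Qed.
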